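(* Let $G_1$ and $G_2$ be two finitely generated subgroups of $\mathrm{Diff}^{\omega}(S^1)$ that are conjugate by a homeomorphism of $S^1$, with $G_1$ locally $C^2$-non-discrete. Assume that $G_1$ satisfies the following conditions. (1) All the orbits of $G_1$ (and hence of $G_2$) are dense in $S^1$. (2) There is an interval $I = [-a,a] \subset \mathbb{R} \subset S^1$ ($a \neq 0$) and an element $F_1 \in G_1$ satisfying $F_1(0)=0$ and $F_1'(0)=\lambda_1 \in (0,1)$. (3) For every $\varepsilon > 0$ there is a finite set $S_1 = \{\overline{g}_{1,1}, \ldots, \overline{g}_{1,N}\} \subset G_1$ such that: the elements $\overline{g}_{1,1}, \ldots, \overline{g}_{1,N}$ are $\varepsilon$-close to the identity in the $C^2$-topology on $I$; they generate a non-solvable subgroup of $\mathrm{Diff}^{\omega}(S^1)$ having no finite orbit; and, for a certain fixed $n \in \mathbb{N}^*$, setting $\widetilde{S}_1(k) = F_1^{-kn} \circ S_1(k) \circ F_1^{kn}$ for $k \in \mathbb{N}$ (where $S_1(k)$ is the sequence of sets of iterated commutators associated with $S_1$), every sequence $(g_{1,k})$ with $g_{1,k} \in \widetilde{S}_1(k)$ converges to the identity in the $C^2$-topology on $I$. (4) In fact, if $(g_{1,k})$ is such that $g_{1,k} \in \widetilde{S}_1(k)$ for $k \in \mathbb{N}$, then for every $\Theta > 0$, $$\lim_{k \to \infty} \frac{\Vert g_{1,k} - \mathrm{id} \Vert_{2,[-a,a]}}{\Theta^k} = 0 .$$ Assume also that every point $p \in S^1$ is expandable for $G_2$. Then every orientation-preserving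 homeomorphism $h : S^1 \to S^1$ conjugating $G_1$ to $G_2$ (i.e. $G_2 = h^{-1}\circ G_1 \circ h$) is an element of $\mathrm{Diff}^{\omega}(S^1)$.
   Context: $\mathrm{Diff}^{\omega}(S^1)$ denotes the group of orientation-preserving real analytic diffeomorphisms of the circle $S^1$. A subgroup $G$ of $\mathrm{Diff}^{\omega}(S^1)$ is locally $C^m$-non-discrete if there is a non-empty open interval $I \subseteq S^1$ and a sequence $(g_i)$ of elements of $G$, $g_i \neq \mathrm{id}$ for every $i$, whose restrictions to $I$ converge to the identity in the $C^m$-topology. A point $p \in S^1$ is expandable for a group $G \subset \mathrm{Diff}^{\omega}(S^1)$ if there is $g \in G$ with $g'(p) > 1$. The interval $[-a,a]$ is viewed in a local coordinate of $S^1$, and $\Vert\cdot\Vert_{2,[-a,a]}$ is the $C^2$-norm on $[-a,a]$. Given a finite set $S$ of diffeomorphisms, the sets $S(k)$ are defined inductively by $S(0)=S$ and: for $k \geq 1$, $S(k)$ is the set of all commutators $[\tilde f_i^{\pm 1}, \tilde f_j^{\pm 1}]$ with $\tilde f_i \in S(k-1)$ and $\tilde f_j \in S(k-1)\cup S(k-2)$ ($\tilde f_j \in S(0)$ if $k=1$), where $[f,g] = f\circ g\circ f^{-1}\circ g^{-1}$. *)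

(* Defs.v *)
From Stdlib Require Import Reals Lra Lia List.
From Stdlib Require Import ProofIrrelevance FunctionalExtensionality.
From Coquelicot Require Import Coquelicot.
Open Scope R_scope.

Definition circle : Type := {z : C | Cmod z = 1}.

Definition circle_ball (p : circle) (eps : R) (q : circle) : Prop :=
  ball (proj1_sig p) eps (proj1_sig q).

Lemma circle_ball_center (p : circle) (eps : posreal) : circle_ball p eps p.
Proof. exact (ball_center (proj1_sig p) eps). Qed.

Lemma circle_ball_sym (p q : circle) (eps : R) :
  circle_ball p eps q -> circle_ball q eps p.
Proof. exact (ball_sym (proj1_sig p) (proj1_sig q) eps). Qed.

Lemma circle_ball_triangle (p q r : circle) (e1 e2 : R) :
  circle_ball p e1 q -> circle_ball q e2 r -> circle_ball p (e1 + e2) r.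
Proof.
exact (ball_triangle (proj1_sig p) (proj1_sig q) (proj1_sig r) e1 e2).
Qed.

Lemma circle_nonempty : Cmod (RtoC 1) = 1.
Proof. exact Cmod_1. Qed.

Definition circle_UniformSpace_mixin : UniformSpace.mixin_of circle :=
  UniformSpace.Mixin circle (exist _ (RtoC 1) circle_nonempty) circle_ball
    circle_ball_center circle_ball_sym circle_ball_triangle.

Canonical circle_UniformSpace : UniformSpace :=
  UniformSpace.Pack circle circle_UniformSpace_mixin circle.

Lemma cis_on_circle (x : R) :
  Cmod (cos (2 * PI * x), sin (2 * PI * x)) = 1.
Proof.
unfold Cmod; simpl fst; simpl snd.
replace (cos (2 * PI * x) ^ 2 + sin (2 * PI * x) ^ 2) with 1.
- exact sqrt_1.
- generalize (sin2_cos2 (2 * PI * x)); unfold Rsqr; lra.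
Qed.

(* Lifts and derivatives use the angle coordinate of period 1. *)
Definition cis (x : R) : circle :=
  exist _ (cos (2 * PI * x), sin (2 * PI * x)) (cis_on_circle x).

Record homeo : Type := Homeo {
  fwd :> circle -> circle;
  bwd : circle -> circle;
  fwdK : forall p, bwd (fwd p) = p;
  bwdK : forall p, fwd (bwd p) = p;
  fwd_continuous : forall p, continuous fwd p;
  bwd_continuous : forall p, continuous bwd p }.

Lemma homeo_ext (f g : homeo) : (forall p, f p = g p) -> f = g.
Proof.
destruct f as [f f' fK f'K cf cf'], g as [g g' gK g'K cg cg']; simpl; intro e.
assert (e1 : f = g) by now apply functional_extensionality.
subst g.
assert (e2 : f' = g').
{ apply functional_extensionality; intro p.
  now rewrite <- (g'K p) at 1; rewrite fK. }
subst g'.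
f_equal; apply proof_irrelevance.
Qed.

Definition hid : homeo :=
  Homeo (fun p => p) (fun p => p) (fun _ => eq_refl) (fun _ => eq_refl)
    (fun p => continuous_id p) (fun p => continuous_id p).

Definition hinv (f : homeo) : homeo :=
  Homeo (bwd f) (fwd f) (bwdK f) (fwdK f) (bwd_continuous f) (fwd_continuous f).

Lemma hcomp_fwdK (f g : homeo) (p : circle) : bwd g (bwd f (f (g p))) = p.
Proof. now rewrite fwdK, fwdK. Qed.

Lemma hcomp_bwdK (f g : homeo) (p : circle) : f (g (bwd g (bwd f p))) = p.
Proof. now rewrite bwdK, bwdK. Qed.

Definition hcomp (f g : homeo) : homeo :=
  Homeo (fun p => f (g p)) (fun p => bwd g (bwd f p))
    (hcomp_fwdK f g) (hcomp_bwdK f g)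
    (fun p => continuous_comp g f p (fwd_continuous g p) (fwd_continuous f (g p)))
    (fun p => continuous_comp (bwd f) (bwd g) p
                (bwd_continuous f p) (bwd_continuous g (bwd f p))).

Definition hpow (f : homeo) (n : nat) : homeo := Nat.iter n (hcomp f) hid.

Definition hcomm (f g : homeo) : homeo :=
  hcomp f (hcomp g (hcomp (hinv f) (hinv g))).

Definition is_subgroup (G : homeo -> Prop) : Prop :=
  G hid /\ (forall f g, G f -> G g -> G (hcomp f g)) /\
  (forall f, G f -> G (hinv f)).

Inductive generated (S : homeo -> Prop) : homeo -> Prop :=
| generated_in f : S f -> generated S f
| generated_id : generated S hid
| generated_comp f g :
    generated S f -> generated S g -> generated S (hcomp f g)
| generated_inv f : generated S f -> generated S (hinv f).

Definition generated_by (l : list homeo) : homeo -> Prop :=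
  generated (fun f => In f l).

Definition finitely_generated (G : homeo -> Prop) : Prop :=
  exists l : list homeo, forall g, G g <-> generated_by l g.

Definition derived_subgroup (G : homeo -> Prop) : homeo -> Prop :=
  generated (fun c => exists f g, G f /\ G g /\ c = hcomm f g).

Definition solvable (G : homeo -> Prop) : Prop :=
  exists n : nat, forall g, Nat.iter n derived_subgroup G g -> g = hid.

Definition conjugates (h : homeo) (G1 G2 : homeo -> Prop) : Prop :=
  forall g, G2 g <-> exists f, G1 f /\ g = hcomp (hinv h) (hcomp f h).

Definition orbit (G : homeo -> Prop) (p q : circle) : Prop :=
  exists g, G g /\ q = g p.

Definition dense (A : circle -> Prop) : Prop :=
  forall (q : circle) (eps : posreal), exists p, A p /\ ball q eps p.

Definition has_finite_orbit (G : homeo -> Prop) : Prop :=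
  exists (p : circle) (l : list circle), forall q, orbit G p q -> In q l.

Definition analytic_at (f : R -> R) (x : R) : Prop :=
  exists a : nat -> R, locally x (fun y => is_pseries a (y - x) (f y)).

(* The lift of a circle map is unique up to an integer constant. *)
Definition is_lift (f : circle -> circle) (F : R -> R) : Prop :=
  (forall x, continuous F x) /\ forall x, f (cis x) = cis (F x).

Definition orientation_preserving (f : homeo) : Prop :=
  exists F, is_lift f F /\ forall x y, x < y -> F x < F y.

Definition circle_analytic (f : circle -> circle) : Prop :=
  exists F, is_lift f F /\ forall x, analytic_at F x.

Definition diff_omega (f : homeo) : Prop :=
  orientation_preserving f /\ circle_analytic f /\ circle_analytic (hinv f).

Definition circle_derive (f : circle -> circle) (p : circle) (d : R) : Prop :=
  exists F x, is_lift f F /\ cis x = p /\ is_derive F x d.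

Definition expandable (G : homeo -> Prop) (p : circle) : Prop :=
  exists g d, G g /\ circle_derive g p d /\ 1 < d.

(* Sup of the sup norms over the orders 0..m, not their sum.  Derive_n is a
   two-sided derivative, so f must be C^m on a neighbourhood of X. *)
Definition Cm_norm (m : nat) (X : R -> Prop) (f : R -> R) : Rbar :=
  Lub_Rbar (fun r => exists j x, (j <= m)%nat /\ X x /\ r = Rabs (Derive_n f j x)).

(* The interval of the circle is the arc cis ((alpha, beta)), and closeness to
   the identity is read on lifts. *)
Definition locally_nondiscrete (m : nat) (G : homeo -> Prop) : Prop :=
  exists (alpha beta : R) (g : nat -> homeo) (F : nat -> R -> R),
    alpha < beta <= alpha + 1 /\
    (forall i, G (g i) /\ g i <> hid /\ is_lift (g i) (F i)) /\
    forall eps : posreal, eventually (fun i =>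
      Rbar_lt (Cm_norm m (fun x => alpha < x < beta) (fun x => F i x - x)) eps).

(* The values of coord outside of cdom and of param outside of cimg are
   irrelevant. *)
Record chart : Type := Chart {
  cdom : circle -> Prop;
  cimg : R -> Prop;
  coord : circle -> R;
  param : R -> circle;
  cdom_open : open cdom;
  cimg_open : open cimg;
  coord_img : forall p, cdom p -> cimg (coord p);
  param_dom : forall x, cimg x -> cdom (param x);
  coordK : forall p, cdom p -> param (coord p) = p;
  paramK : forall x, cimg x -> coord (param x) = x;
  coord_analytic :
    forall x, cdom (cis x) -> analytic_at (fun y => coord (cis y)) x;
  param_analytic :
    forall x, cimg x -> exists phi,
      analytic_at phi x /\ locally x (fun y => param y = cis (phi y)) }.

Definition in_chart (c : chart) (g : circle -> circle) (x : R) : R :=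
  coord c (g (param c x)).

Definition segment (a x : R) : Prop := - a <= x <= a.

Definition C2_dist_id (c : chart) (a : R) (g : circle -> circle) : Rbar :=
  Cm_norm 2 (segment a) (fun x => in_chart c g x - x).

(* The first condition makes in_chart c g meaningful on [-a, a]. *)
Definition C2_close_id (c : chart) (a eps : R) (g : circle -> circle) : Prop :=
  (forall x, segment a x -> cdom c (g (param c x))) /\
  Rbar_lt (C2_dist_id c a g) eps.

Definition C2_cvg_id (c : chart) (a : R) (g : nat -> homeo) : Prop :=
  forall eps : posreal, eventually (fun k => C2_close_id c a eps (g k)).

Definition pm (f f' : homeo) : Prop := f' = f \/ f' = hinv f.

(* The pair (S(k), S(k-1)), with S(-1) empty. *)
Fixpoint iter_comm_pair (S : homeo -> Prop) (k : nat) :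
    (homeo -> Prop) * (homeo -> Prop) :=
  match k with
  | O => (S, fun _ => False)
  | Datatypes.S k' =>
      let (S1, S2) := iter_comm_pair S k' in
      (fun c => exists fi fj fi' fj',
         S1 fi /\ (S1 fj \/ S2 fj) /\ pm fi fi' /\ pm fj fj' /\
         c = hcomm fi' fj',
       S1)
  end.

Definition iter_comm (S : homeo -> Prop) (k : nat) : homeo -> Prop :=
  fst (iter_comm_pair S k).

Definition renormalized_comm (F : homeo) (n : nat) (S : homeo -> Prop)
    (k : nat) (g : homeo) : Prop :=
  exists f, iter_comm S k f /\
    g = hcomp (hinv (hpow F (k * n))) (hcomp f (hpow F (k * n))).

(* Main.v *)
Require Import Defs.
From Stdlib Require Import Reals List.
From Coquelicot Require Import Coquelicot.
From Stdlib Require Import Lra Lia Psatz ZArith.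
From Stdlib Require Import Classical ClassicalEpsilon FunctionalExtensionality ProofIrrelevance.
Open Scope R_scope.

(* A hyperbolic fixed point of G_1 together with elements C^1-close to the
   identity that move it makes every point expandable for G_1, by iterating such
   an element in the Koenigs coordinate.  Since both groups expand, h and its
   inverse are Hoelder continuous.  Hence small distortion telescopes
   simultaneously on both sides of the conjugacy: were G_2 discrete in the
   bilateral C^1 sense, an element close to the identity, written as a geodesic
   word in the generators, would have bounded distortion on a definite interval
   on both sides, and a C^0-small element of bounded distortion is C^1-small.  So
   there are elements of G_2 that are C^1-close to the identity together with
   their conjugates by h.  Near a common hyperbolic fixed point, such an element
   is nearly a translation in both Koenigs coordinates; comparing its iterates
   with the two homotheties shows that h is linear there, on one side of the
   fixed point.  Thus h is analytic on an interval, and by minimality everywhere. *)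

(** * Lifts of circle homeomorphisms and distortion *)

(** The word that represents an element close to the identity can be arbitrarily long, so distortion
    cannot be controlled by counting letters. The substitute is a finiteness property: in a
    bilaterally discrete group, the elements of bounded distortion between intervals of macroscopic
    size have bounded word length. Call depth of a short interval the number of expanding steps that
    make it macroscopic. Two images of an interval under prefixes of a geodesic word are linked,
    after blow-up, by such an element, so the distance of their indices is at most linear in their
    depths. Few images are therefore long, and the sum of their lengths is bounded whatever the
    length of the word. On both lines lengths must decay geometrically in the depth, at some rate;
    this is what Hoelder continuity provides. All small elements may fix the given hyperbolic point;
    conjugation by powers of the contraction yields elements that move a point of its orbit. They
    move it to one side, which is why linearity is obtained on one side. The multipliers on the two
    lines are a priori different. *)

Definition deg1 (g : R -> R) : Prop :=
  (forall x y, x < y -> g x < g y) /\ forall x, g (x + 1) = g x + 1.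

(** Continuity follows from monotonicity and bijectivity ([line_homeo_continuous]). [K] stands for a
    lift of the conjugacy. *)
Definition line_homeo (K Ki : R -> R) : Prop :=
  deg1 K /\ deg1 Ki /\ (forall x, K (Ki x) = x) /\ forall x, Ki (K x) = x.

(** With [K = Ki = ids], every notion below that is relative to [K] becomes the usual one on the
    original line; each estimate is thus proved once for both sides of the conjugacy. *)
Definition ids (x : R) : R := x.

Lemma ids_line_homeo : line_homeo ids ids.
Proof. repeat split; unfold ids; intros; lra. Qed.

Lemma line_homeo_sym (K Ki : R -> R) : line_homeo K Ki -> line_homeo Ki K.
Proof. intros (a & b & c & d); repeat split; try apply a; try apply b; auto. Qed.

Lemma deg1_nat (g : R -> R) : deg1 g -> forall n x, g (x + INR n) = g x + INR n.
Proof.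
intros [_ h] n; induction n as [|n IH]; intro x.
- simpl; rewrite !Rplus_0_r; easy.
- rewrite S_INR. replace (x + (INR n + 1)) with ((x + INR n) + 1) by ring.
  rewrite h, IH; ring.
Qed.

Lemma deg1_Z (g : R -> R) : deg1 g -> forall k x, g (x + IZR k) = g x + IZR k.
Proof.
intros h k x.
destruct (Z_le_gt_dec 0 k) as [c|c].
- rewrite <- (Z2Nat.id k c), <- INR_IZR_INZ. now apply deg1_nat.
- replace (IZR k) with (- INR (Z.to_nat (- k))).
  2:{ rewrite INR_IZR_INZ, Z2Nat.id by lia. rewrite opp_IZR; ring. }
  set (n := Z.to_nat (- k)).
  assert (e := deg1_nat g h n (x + - INR n)).
  replace (x + - INR n + INR n) with x in e by ring. lra.
Qed.

Lemma deg1_le (g : R -> R) : deg1 g -> forall x y, x <= y -> g x <= g y.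
Proof.
intros [h _] x y [c|c]; [apply Rlt_le; now apply h | subst; apply Rle_refl].
Qed.

Lemma deg1_lt_inv (g : R -> R) : deg1 g -> forall x y, g x < g y -> x < y.
Proof.
intros h x y c. destruct (Rlt_le_dec x y) as [l|l]; auto.
apply (deg1_le g h) in l; lra.
Qed.

Lemma deg1_le_inv (g : R -> R) : deg1 g -> forall x y, g x <= g y -> x <= y.
Proof.
intros [h _] x y c. destruct (Rle_lt_dec x y) as [l|l]; auto.
apply h in l; lra.
Qed.

Lemma deg1_comp (f g : R -> R) : deg1 f -> deg1 g -> deg1 (fun x => f (g x)).
Proof.
intros [a b] [c d]; split; intros.
- now apply a, c.
- now rewrite d, b.
Qed.

Lemma line_homeo_continuous (K Ki : R -> R) :
  line_homeo K Ki -> forall x, continuous K x.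
Proof.
intros (dK & dKi & e & e') x.
apply continuity_pt_filterlim. intros eps he.
exists (Rmin (x - Ki (K x - eps)) (Ki (K x + eps) - x)).
assert (Ki (K x - eps) < x) by (rewrite <- (e' x) at 2; apply dKi; lra).
assert (x < Ki (K x + eps)) by (rewrite <- (e' x) at 1; apply dKi; lra).
split; [apply Rmin_pos; lra|].
intros y [_ hy]. simpl in *. unfold Rdist in *.
assert (h1 := Rmin_l (x - Ki (K x - eps)) (Ki (K x + eps) - x)).
assert (h2 := Rmin_r (x - Ki (K x - eps)) (Ki (K x + eps) - x)).
apply Rabs_def2 in hy. apply Rabs_def1.
- assert (y < Ki (K x + eps)) by lra.
  apply dK in H1. rewrite e in H1. lra.
- assert (Ki (K x - eps) < y) by lra.
  apply dK in H1. rewrite e in H1. lra.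
Qed.

Lemma Int_part_bounds (x : R) : 0 <= x - IZR (Int_part x) < 1.
Proof. generalize (base_Int_part x); lra. Qed.

Lemma line_homeo_unif (K Ki : R -> R) : line_homeo K Ki ->
  forall eps, 0 < eps -> exists d, 0 < d /\
    forall x y, Rabs (x - y) <= d -> Rabs (K x - K y) <= eps.
Proof.
intros L eps he.
(* After subtraction of the integer part of [x], the first point lies in [0, 1) and the second at
   distance at most 1 from it, hence both in [-1, 2]. *)
destruct (@Heine_cor2 K (-1) 2) with (eps := mkposreal eps he) as [d hd].
{ intros x _. apply continuity_pt_filterlim. now apply (line_homeo_continuous K Ki). }
exists (Rmin (d / 2) 1). split.
{ apply Rmin_pos; [|lra]. generalize (cond_pos d); lra. }
intros x y h.
assert (h1 := Rmin_l (d / 2) 1). assert (h2 := Rmin_r (d / 2) 1).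
assert (hp := cond_pos d).
assert (hb := Int_part_bounds x). set (k := Int_part x) in *.
assert (ex : K x = K (x - IZR k) + IZR k).
{ rewrite <- (deg1_Z K (proj1 L)). f_equal; ring. }
assert (ey : K y = K (y - IZR k) + IZR k).
{ rewrite <- (deg1_Z K (proj1 L)). f_equal; ring. }
rewrite ex, ey.
replace (K (x - IZR k) + IZR k - (K (y - IZR k) + IZR k))
  with (K (x - IZR k) - K (y - IZR k)) by ring.
apply Rlt_le.
assert (h3 : Rabs (x - y) <= 1) by lra. apply Rabs_le_between in h3.
apply (hd (x - IZR k) (y - IZR k)); try lra.
replace (x - IZR k - (y - IZR k)) with (x - y) by ring. lra.
Qed.

(* Derivatives on the conjugate line are indexed by the point y of the original
   line whose image is K y. *)
Definition dv (K Ki g : R -> R) (y : R) : R :=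
  Derive (fun x => K (g (Ki x))) (K y).

(** The regularity behind Denjoy-type estimates: [N] bounds the distortion that [g] creates per unit
    of length. *)
Definition log_lipschitz (K Ki g : R -> R) : Prop :=
  (forall x, ex_derive (fun t => K (g (Ki t))) x) /\
  (forall y, 0 < dv K Ki g y) /\
  exists N, forall x y,
    Rabs (ln (dv K Ki g x) - ln (dv K Ki g y)) <= N * Rabs (K x - K y).

(* Distortion bound on [a, b], scaled so that Q does not depend on the length. *)
Definition distortion (K Ki : R -> R) (Q : R) (g : R -> R) (a b : R) : Prop :=
  forall x y, a <= x <= b -> a <= y <= b ->
    Rabs (ln (dv K Ki g x) - ln (dv K Ki g y))
      <= Q * (Rabs (K x - K y) / (K b - K a)).

(** * Calculus of distortion on one line *)

Section OneSide.
Variables K Ki : R -> R.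
Hypothesis LK : line_homeo K Ki.

Let KiK : forall x, Ki (K x) = x := proj2 (proj2 (proj2 LK)).
Let KKi : forall x, K (Ki x) = x := proj1 (proj2 (proj2 LK)).
Let dK : deg1 K := proj1 LK.
Let dKi : deg1 Ki := proj1 (proj2 LK).

Lemma dv_comp (f g : R -> R) (y : R) : log_lipschitz K Ki f -> log_lipschitz K Ki g ->
  dv K Ki (fun x => f (g x)) y = dv K Ki f (g y) * dv K Ki g y.
Proof.
intros [sf _] [sg _]. unfold dv.
rewrite (Derive_ext (fun x => K (f (g (Ki x))))
  (fun x => (fun t => K (f (Ki t))) ((fun t => K (g (Ki t))) x))).
2:{ intro t. now rewrite KiK. }
rewrite (Derive_comp (fun t => K (f (Ki t))) (fun t => K (g (Ki t)))) by auto.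
rewrite KiK. apply Rmult_comm.
Qed.

Lemma dv_id (y : R) : dv K Ki (fun x => x) y = 1.
Proof.
unfold dv. rewrite (Derive_ext _ (fun x => x)) by (intro; apply KKi).
apply Derive_id.
Qed.

Lemma dv_mvt (g : R -> R) (a b : R) : log_lipschitz K Ki g -> a <= b ->
  exists c, a <= c <= b /\ K (g b) - K (g a) = dv K Ki g c * (K b - K a).
Proof.
intros [sg _] h.
assert (hK := deg1_le K dK a b h).
destruct (MVT_gen (fun x => K (g (Ki x))) (K a) (K b)
  (Derive (fun x => K (g (Ki x))))) as [c [hc e]].
- intros x _. apply Derive_correct, sg.
- intros x _. apply continuity_pt_filterlim.
  apply (ex_derive_continuous (fun x => K (g (Ki x)))), sg.
- rewrite Rmin_left, Rmax_right in hc by auto.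
  exists (Ki c). rewrite !KiK in e. split.
  + rewrite <- (KiK a), <- (KiK b); split; now apply deg1_le.
  + unfold dv. now rewrite KKi.
Qed.

Lemma dv_inv (g gi : R -> R) (y : R) : log_lipschitz K Ki g -> log_lipschitz K Ki gi ->
  (forall x, gi (g x) = x) -> dv K Ki gi (g y) = / dv K Ki g y.
Proof.
intros sg si e.
assert (h := dv_comp gi g y si sg).
replace (fun x => gi (g x)) with (fun x : R => x) in h.
2:{ apply functional_extensionality; intro; now rewrite e. }
rewrite dv_id in h.
assert (p := proj1 (proj2 sg) y).
field_simplify_eq; lra.
Qed.

Lemma K_pos (a b : R) : a < b -> 0 < K b - K a.
Proof. intro h; apply dK in h; lra. Qed.

Lemma ln_exp_ratio (u v Q : R) : 0 < u -> 0 < v ->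
  Rabs (ln u - ln v) <= Q -> u <= exp Q * v.
Proof.
intros hu hv h. apply Rabs_le_between in h.
rewrite <- (exp_ln u hu), <- (exp_ln v hv) at 1. rewrite <- exp_plus.
destruct (Req_dec (ln u) (Q + ln v)) as [e|e].
- rewrite e; lra.
- apply Rlt_le, exp_increasing; lra.
Qed.

Lemma distortion_bound (Q : R) (g : R -> R) (a b : R) : 0 <= Q -> a < b ->
  distortion K Ki Q g a b -> forall x y, a <= x <= b -> a <= y <= b ->
  Rabs (ln (dv K Ki g x) - ln (dv K Ki g y)) <= Q.
Proof.
intros hQ hab h x y hx hy.
apply Rle_trans with (1 := h x y hx hy).
rewrite <- (Rmult_1_r Q) at 2. apply Rmult_le_compat_l; auto.
assert (p := K_pos a b hab).
apply Rle_div_l; auto. rewrite Rmult_1_l.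
assert (K a <= K x <= K b) by (split; apply deg1_le; tauto).
assert (K a <= K y <= K b) by (split; apply deg1_le; tauto).
apply Rabs_le; lra.
Qed.

(** Both quotients of lengths are derivatives at intermediate points, whose logarithms differ by at
    most [Q]. *)
Lemma distortion_ratio (Q : R) (g : R -> R) (a b : R) : 0 <= Q -> a < b -> log_lipschitz K Ki g ->
  distortion K Ki Q g a b -> forall x y, a <= x <= b -> a <= y <= b ->
  Rabs (K (g x) - K (g y)) / (K (g b) - K (g a))
    <= exp Q * (Rabs (K x - K y) / (K b - K a)).
Proof.
intros hQ hab sg h.
assert (p := K_pos a b hab).
assert (base : forall x y, a <= x <= b -> a <= y <= b -> x <= y ->
   Rabs (K (g x) - K (g y)) / (K (g b) - K (g a))
    <= exp Q * (Rabs (K x - K y) / (K b - K a))).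
{ intros x y hx hy hxy.
  destruct (dv_mvt g x y sg hxy) as [c [hc e]].
  destruct (dv_mvt g a b sg (Rlt_le _ _ hab)) as [c' [hc' e']].
  assert (q := deg1_le K dK x y hxy).
  assert (pc := proj1 (proj2 sg) c). assert (pc' := proj1 (proj2 sg) c').
  rewrite Rabs_minus_sym, e, e', (Rabs_minus_sym (K x)), Rabs_mult.
  rewrite (Rabs_pos_eq (dv K Ki g c)), (Rabs_pos_eq (K y - K x)) by lra.
  assert (l : dv K Ki g c <= exp Q * dv K Ki g c').
  { apply ln_exp_ratio; auto. apply (distortion_bound Q g a b); auto; lra. }
  replace (dv K Ki g c * (K y - K x) / (dv K Ki g c' * (K b - K a)))
    with (dv K Ki g c / dv K Ki g c' * ((K y - K x) / (K b - K a))) by (field; lra).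
  apply Rmult_le_compat_r.
  - apply Rdiv_le_0_compat; lra.
  - apply Rle_div_l; auto. }
intros x y hx hy. destruct (Rle_lt_dec x y) as [l|l].
- now apply base.
- rewrite (Rabs_minus_sym (K (g x))), (Rabs_minus_sym (K x)). apply base; auto; lra.
Qed.

Lemma distortion_weaken (Q Q' : R) (g : R -> R) (a b : R) : a < b -> Q <= Q' ->
  distortion K Ki Q g a b -> distortion K Ki Q' g a b.
Proof.
intros hab hQ h x y hx hy. apply Rle_trans with (1 := h x y hx hy).
apply Rmult_le_compat_r; auto.
apply Rdiv_le_0_compat; [apply Rabs_pos | now apply K_pos].
Qed.

Lemma distortion_sub (Q : R) (g : R -> R) (a b a' b' : R) : 0 <= Q ->
  a <= a' -> a' < b' -> b' <= b -> distortion K Ki Q g a b -> distortion K Ki Q g a' b'.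
Proof.
intros hQ h1 h2 h3 h x y hx hy.
apply Rle_trans with (1 := h x y ltac:(lra) ltac:(lra)).
apply Rmult_le_compat_l; auto. apply Rmult_le_compat_l; [apply Rabs_pos|].
apply Rinv_le_contravar; [now apply K_pos|].
assert (K a <= K a') by now apply deg1_le.
assert (K b' <= K b) by now apply deg1_le.
lra.
Qed.

(** By [distortion_ratio], relative distances in [g a, g b] exceed those in [a, b] by a factor at
    most [exp Q]; this is the factor that multiplies [Q']. *)
Lemma distortion_comp (Q Q' : R) (f g : R -> R) (a b : R) : 0 <= Q -> 0 <= Q' -> a < b ->
  deg1 g -> log_lipschitz K Ki f -> log_lipschitz K Ki g ->
  distortion K Ki Q g a b -> distortion K Ki Q' f (g a) (g b) ->
  distortion K Ki (Q + Q' * exp Q) (fun x => f (g x)) a b.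
Proof.
intros hQ hQ' hab dg sf sg hg hf x y hx hy.
rewrite (dv_comp f g x), (dv_comp f g y) by auto.
assert (pf := proj1 (proj2 sf)). assert (pg := proj1 (proj2 sg)).
rewrite !ln_mult by auto.
assert (h1 := hg x y hx hy).
assert (h2 := hf (g x) (g y)
  (conj (deg1_le g dg _ _ (proj1 hx)) (deg1_le g dg _ _ (proj2 hx)))
  (conj (deg1_le g dg _ _ (proj1 hy)) (deg1_le g dg _ _ (proj2 hy)))).
assert (h3 := distortion_ratio Q g a b hQ hab sg hg x y hx hy).
apply (Rmult_le_compat_l Q' _ _ hQ') in h3.
assert (h4 := Rle_trans _ _ _ h2 h3).
set (r := Rabs (K x - K y) / (K b - K a)) in *.
replace ((Q + Q' * exp Q) * r) with (Q' * (exp Q * r) + Q * r) by ring.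
clear h2 h3. apply Rabs_le_between in h4. apply Rabs_le_between in h1.
apply Rabs_le. lra.
Qed.

(** The estimate [base] is the reverse of [distortion_ratio]: returning from the image to [a, b]
    also costs a factor at most [exp Q]. *)
Lemma distortion_inv (Q : R) (g gi : R -> R) (a b : R) : 0 <= Q -> a < b ->
  deg1 g -> deg1 gi -> log_lipschitz K Ki g -> log_lipschitz K Ki gi ->
  (forall x, gi (g x) = x) -> (forall x, g (gi x) = x) ->
  distortion K Ki Q g a b -> distortion K Ki (Q * exp Q) gi (g a) (g b).
Proof.
intros hQ hab dg di sg si e e' h x y hx hy.
assert (hx' : a <= gi x <= b).
{ split; apply (deg1_le_inv g dg); rewrite e'; tauto. }
assert (hy' : a <= gi y <= b).
{ split; apply (deg1_le_inv g dg); rewrite e'; tauto. }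
rewrite <- (e' x), <- (e' y).
rewrite !(dv_inv g gi) by auto.
assert (pg := proj1 (proj2 sg)).
rewrite !ln_Rinv by auto.
replace (- ln (dv K Ki g (gi x)) - - ln (dv K Ki g (gi y)))
  with (- (ln (dv K Ki g (gi x)) - ln (dv K Ki g (gi y)))) by ring.
rewrite Rabs_Ropp.
apply Rle_trans with (1 := h _ _ hx' hy').
rewrite Rmult_assoc. apply Rmult_le_compat_l; auto.
assert (p := K_pos a b hab).
assert (base : forall u v, a <= u <= b -> a <= v <= b -> u <= v ->
   Rabs (K u - K v) / (K b - K a) <=
   exp Q * (Rabs (K (g u) - K (g v)) / (K (g b) - K (g a)))).
{ intros u v hu hv huv.
  destruct (dv_mvt g u v sg huv) as [c [hc ec]].
  destruct (dv_mvt g a b sg (Rlt_le _ _ hab)) as [c' [hc' ec']].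
  assert (q := deg1_le K dK u v huv).
  assert (pc := pg c). assert (pc' := pg c').
  rewrite (Rabs_minus_sym (K (g u))), ec, ec', (Rabs_minus_sym (K u)), Rabs_mult.
  rewrite (Rabs_pos_eq (dv K Ki g c)), (Rabs_pos_eq (K v - K u)) by lra.
  assert (l : dv K Ki g c' <= exp Q * dv K Ki g c).
  { apply ln_exp_ratio; auto. apply (distortion_bound Q g a b); auto; lra. }
  replace (exp Q * (dv K Ki g c * (K v - K u) / (dv K Ki g c' * (K b - K a))))
    with (exp Q * dv K Ki g c / dv K Ki g c' * ((K v - K u) / (K b - K a)))
    by (field; lra).
  rewrite <- (Rmult_1_l ((K v - K u) / (K b - K a))) at 1.
  apply Rmult_le_compat_r.
  - apply Rdiv_le_0_compat; lra.
  - apply Rle_div_r; auto. lra. }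
destruct (Rle_lt_dec (gi x) (gi y)) as [l|l].
- now apply base.
- rewrite (Rabs_minus_sym (K (gi x))), (Rabs_minus_sym (K (g (gi x)))).
  apply base; auto; lra.
Qed.

Lemma distortion_len (Q : R) (g : R -> R) (a b y : R) : 0 <= Q -> a < b -> a <= y <= b ->
  log_lipschitz K Ki g -> distortion K Ki Q g a b ->
  K (g b) - K (g a) <= exp Q * dv K Ki g y * (K b - K a) /\
  dv K Ki g y * (K b - K a) <= exp Q * (K (g b) - K (g a)).
Proof.
intros hQ hab hy sg h.
assert (p := K_pos a b hab).
destruct (dv_mvt g a b sg (Rlt_le _ _ hab)) as [c [hc e]].
assert (pg := proj1 (proj2 sg)).
rewrite e. split.
- apply Rmult_le_compat_r; [lra|].
  apply ln_exp_ratio; auto. apply (distortion_bound Q g a b); auto.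
- rewrite <- Rmult_assoc. apply Rmult_le_compat_r; [lra|].
  apply ln_exp_ratio; auto. apply (distortion_bound Q g a b); auto.
Qed.

(** The mean of the derivative over a period is 1, so it equals 1 at some point whose image by [K]
    is within 1 of [K y]. *)
Lemma dv_le_exp (g : R -> R) (N : R) : deg1 g -> log_lipschitz K Ki g -> 0 <= N ->
  (forall x y, Rabs (ln (dv K Ki g x) - ln (dv K Ki g y)) <= N * Rabs (K x - K y)) ->
  forall y, dv K Ki g y <= exp N.
Proof.
intros dg s hN hl y.
destruct (dv_mvt g y (y + 1) s ltac:(lra)) as [c [hc e]].
rewrite (proj2 dg), !(proj2 dK) in e.
assert (e1 : dv K Ki g c = 1) by lra.
assert (q := hl y c). rewrite e1, ln_1, Rminus_0_r in q.
assert (h1 := deg1_le K dK _ _ (proj1 hc)). assert (h2 := deg1_le K dK _ _ (proj2 hc)).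
rewrite (proj2 dK) in h2.
assert (Rabs (K y - K c) <= 1) by (apply Rabs_le; lra).
assert (N * Rabs (K y - K c) <= N) by (rewrite <- (Rmult_1_r N) at 2; now apply Rmult_le_compat_l).
rewrite <- (exp_ln (dv K Ki g y)) by apply (proj1 (proj2 s)).
apply Rabs_le_between in q.
destruct (Req_dec (ln (dv K Ki g y)) N) as [->|]; [lra|].
apply Rlt_le, exp_increasing; lra.
Qed.

Lemma dv_bounded (g : R -> R) : deg1 g -> log_lipschitz K Ki g ->
  exists M, 1 <= M /\ forall y, dv K Ki g y <= M.
Proof.
intros dg s. assert (s' := s). destruct s' as (_ & _ & N & hN).
exists (exp (Rmax N 0)). split.
- generalize (exp_ineq1_le (Rmax N 0)) (Rmax_r N 0); lra.
- apply dv_le_exp; auto; [apply Rmax_r|].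
  intros x y. apply Rle_trans with (1 := hN x y).
  apply Rmult_le_compat_r; [apply Rabs_pos|apply Rmax_l].
Qed.

(* Interpolation: a displacement small against the distortion forces the
   derivative to be close to 1 at some nearby point, hence everywhere. *)
Lemma distortion_interp (Q l eta : R) : 0 <= Q -> 0 < l -> 0 < eta -> exists eps, 0 < eps /\
  forall g a b, a < b -> l <= K b - K a -> log_lipschitz K Ki g -> distortion K Ki Q g a b ->
  (forall x, a <= x <= b -> Rabs (K (g x) - K x) <= eps) ->
  forall x, a <= x <= b -> Rabs (dv K Ki g x - 1) <= eta.
Proof.
intros hQ hl heta.
assert (hcont : continuous (fun t => exp t) 0) by apply continuous_exp.
assert (h1 : exists k, 0 < k <= 1 /\ forall t, Rabs t <= k -> Rabs (exp t - 1) <= eta / 4).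
{ assert (chart_H := proj1 (filterlim_locally _ _) hcont
    (mkposreal (eta/4) ltac:(lra))).
  destruct chart_H as [d hd]. exists (Rmin (d/2) 1).
  assert (hdp := cond_pos d).
  assert (m1 := Rmin_l (d/2) 1). assert (m2 := Rmin_r (d/2) 1). split.
  { split; [apply Rmin_pos; lra | lra]. }
  intros t ht. apply Rlt_le. rewrite <- exp_0. apply (hd t).
  change (Rabs (t - 0) < d). rewrite Rminus_0_r. lra. }
destruct h1 as [k [hk hexp]].
(* A subinterval of [K]-length [s] fits in [a, b] on one side of [x], and over it the logarithm of
   the derivative varies by at most [Q * s / l <= k]. *)
set (s := Rmin (l / 4) (k * l / (Q + 1))).
assert (hs : 0 < s).
{ apply Rmin_pos; [lra|]. apply Rdiv_lt_0_compat; nra. }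
(* With [m = Rmin (eta / 8) (1/4)], a displacement at most [s * m] at both ends of the subinterval
   puts the mean derivative over it within [2 * m] of 1. *)
exists (s * Rmin (eta / 8) (1/4)).
assert (hm : 0 < Rmin (eta / 8) (1/4)) by (apply Rmin_pos; lra).
split. { now apply Rmult_lt_0_compat. }
intros g a b hab hlen sg hBD hd x hx.
assert (hs1 : s <= l / 4) by apply Rmin_l.
assert (hs2 : s * (Q+1) <= k * l).
{ apply Rle_trans with (k * l / (Q+1) * (Q+1)).
  - apply Rmult_le_compat_r; [lra|apply Rmin_r].
  - right; field; lra. }
assert (ex : exists u v, a <= u /\ v <= b /\ u < v /\ K v - K u = s /\ u <= x <= v).
{ destruct (Rle_lt_dec (K x + s) (K b)) as [c|c].
  - exists x, (Ki (K x + s)). rewrite KKi.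
    assert (x < Ki (K x + s)) by (rewrite <- (KiK x) at 1; apply dKi; lra).
    repeat split; try lra.
    rewrite <- (KiK b). now apply deg1_le.
  - exists (Ki (K x - s)), x. rewrite KKi.
    assert (Ki (K x - s) < x) by (rewrite <- (KiK x) at 2; apply dKi; lra).
    repeat split; try lra.
    rewrite <- (KiK a) at 1. apply deg1_le; auto. lra. }
destruct ex as (u & v & hu & hv & huv & hs3 & hx').
destruct (dv_mvt g u v sg (Rlt_le _ _ huv)) as [c [hc e]].
assert (hdu := hd u ltac:(lra)). assert (hdv := hd v ltac:(lra)).
assert (hc1 : Rabs (dv K Ki g c - 1) <= 2 * Rmin (eta/8) (1/4)).
{ assert (hz : Rabs ((dv K Ki g c - 1) * s) <= 2 * Rmin (eta/8) (1/4) * s).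
  { replace ((dv K Ki g c - 1) * s) with ((K (g v) - K v) - (K (g u) - K u)).
    2:{ rewrite <- hs3, Rmult_minus_distr_r, <- e. ring. }
    apply Rle_trans with (1 := Rabs_triang _ _). rewrite Rabs_Ropp. lra. }
  rewrite Rabs_mult, (Rabs_pos_eq s) in hz by lra.
  now apply Rmult_le_reg_r in hz. }
assert (m1 := Rmin_l (eta/8) (1/4)). assert (m2 := Rmin_r (eta/8) (1/4)).
assert (hBDx := hBD x c ltac:(lra) ltac:(lra)).
assert (hvar : Rabs (ln (dv K Ki g x) - ln (dv K Ki g c)) <= k).
{ apply Rle_trans with (1 := hBDx).
  assert (Rabs (K x - K c) <= s).
  { assert (K u <= K x <= K v) by (split; apply deg1_le; tauto).
    assert (K u <= K c <= K v) by (split; apply deg1_le; tauto).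
    apply Rabs_le; lra. }
  assert (Rabs (K x - K c) / (K b - K a) <= s / l).
  { apply Rmult_le_compat; try lra; [apply Rabs_pos| | ].
    - left; apply Rinv_0_lt_compat; lra.
    - apply Rinv_le_contravar; lra. }
  apply Rle_trans with (Q * (s / l)).
  - now apply Rmult_le_compat_l.
  - replace (Q * (s / l)) with (Q * s / l) by (field; lra).
    apply Rle_div_l; nra. }
assert (pc := proj1 (proj2 sg) c). assert (px := proj1 (proj2 sg) x).
assert (hE := hexp _ hvar).
replace (dv K Ki g x) with
  (exp (ln (dv K Ki g x) - ln (dv K Ki g c)) * dv K Ki g c).
2:{ unfold Rminus. rewrite exp_plus, exp_Ropp, !exp_ln by auto. field; lra. }
set (E := exp _) in *.
replace (E * dv K Ki g c - 1) with ((E - 1) * dv K Ki g c + (dv K Ki g c - 1)) by ring.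
apply Rle_trans with (1 := Rabs_triang _ _).
rewrite Rabs_mult, (Rabs_pos_eq (dv K Ki g c)) by lra.
assert (dv K Ki g c <= 2).
{ apply Rabs_le_between in hc1; lra. }
assert (Rabs (E-1) * dv K Ki g c <= eta/4 * 2).
{ apply Rmult_le_compat; auto; try lra. apply Rabs_pos. }
lra.
Qed.
End OneSide.

(** * Word length in groups of lifts *)

Lemma choice_fun {A B : Type} (P : A -> B -> Prop) :
  (forall a, exists b, P a b) -> exists f, forall a, P a (f a).
Proof.
intro h. exists (fun a => proj1_sig (constructive_indefinite_description _ (h a))).
intro a. exact (proj2_sig (constructive_indefinite_description _ (h a))).
Qed.

Definition infinite (S : nat -> Prop) : Prop := forall n, exists m, (n <= m)%nat /\ S m.

Lemma infinite_split (S P : nat -> Prop) : infinite S ->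
  infinite (fun n => S n /\ P n) \/ infinite (fun n => S n /\ ~ P n).
Proof.
intro h. destruct (classic (infinite (fun n => S n /\ P n))) as [c|c]; auto.
right. apply not_all_ex_not in c. destruct c as [n0 c].
intro n. destruct (h (max n n0)) as [m [h1 h2]].
exists m. repeat split; auto; try lia.
intro hp. apply c. exists m. repeat split; auto; lia.
Qed.

Lemma infinite_close (u : nat -> R) (eps : R) : 0 < eps -> forall k S c,
  infinite S -> (forall n, S n -> c <= u n <= c + INR k * eps) ->
  exists S', infinite S' /\ (forall n, S' n -> S n) /\
    forall n m, S' n -> S' m -> Rabs (u n - u m) <= eps.
Proof.
intro he. induction k as [|k IH]; intros S c hS hu.
- exists S. repeat split; auto. intros n m hn hm.
  apply hu in hn. apply hu in hm. simpl in *. apply Rabs_le; lra.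
- destruct (infinite_split S (fun n => u n <= c + eps) hS) as [h|h].
  + exists (fun n => S n /\ u n <= c + eps). repeat split; auto.
    { tauto. }
    intros n m [hn hn'] [hm hm'].
    apply hu in hn. apply hu in hm. apply Rabs_le; lra.
  + destruct (IH _ (c + eps) h) as [S' [h1 [h2 h3]]].
    { intros n [hn hn']. apply hu in hn. rewrite S_INR in hn. lra. }
    exists S'. split; [|split]; auto. intros n hn. now apply h2.
Qed.

(** Pigeonhole applied successively to finitely many bounded sequences; a discrete substitute for
    the Arzela-Ascoli theorem when these are the values at grid points. *)
Lemma infinite_close_finite (u : nat -> nat -> R) (eps c d : R) : 0 < eps ->
  forall k S, infinite S ->
  (forall j n, (j < k)%nat -> S n -> c <= u j n <= d) ->
  exists S', infinite S' /\ (forall n, S' n -> S n) /\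
    forall j n m, (j < k)%nat -> S' n -> S' m -> Rabs (u j n - u j m) <= eps.
Proof.
intro he. induction k as [|k IH]; intros S hS hu.
- exists S. repeat split; auto. intros; lia.
- destruct (IH S hS) as [S1 [h1 [h2 h3]]].
  { intros; apply hu; auto; lia. }
  destruct (infinite_close (u k) eps he (Z.to_nat (up ((d - c) / eps))) S1 c h1)
    as [S2 [g1 [g2 g3]]].
  { intros n hn. assert (hb := hu k n ltac:(lia) (h2 n hn)). split; [tauto|].
    assert (hup := archimed ((d - c) / eps)).
    assert (0 <= (d - c) / eps) by (apply Rdiv_le_0_compat; lra).
    rewrite INR_IZR_INZ, Z2Nat.id by (apply le_IZR; lra).
    assert ((d - c) / eps * eps <= IZR (up ((d - c) / eps)) * eps).
    { apply Rmult_le_compat_r; lra. }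
    replace ((d - c) / eps * eps) with (d - c) in H0 by (field; lra). lra. }
  exists S2. split; [|split]; auto.
  intros j n m hj hn hm. destruct (Nat.eq_dec j k) as [->|hne]; auto.
  apply h3; auto; lia.
Qed.

Lemma grid_find (u h y : R) : 0 < h -> forall N, u <= y <= u + INR N * h ->
  (0 < N)%nat -> exists j, (j < N)%nat /\ u + INR j * h <= y <= u + INR (S j) * h.
Proof.
intro chart_H. induction N as [|N IH]; intros hy hN; [lia|].
destruct (Rle_lt_dec (u + INR N * h) y) as [c|c].
- exists N. split; [lia|]. lra.
- destruct N as [|N]; [simpl in c; lra|].
  destruct IH as [j [hj hj']]; [lra|lia|]. exists j; split; [lia|auto].
Qed.

(* Equality of the circle maps that f and g lift. *)
Definition eqZ (f g : R -> R) : Prop := exists k : Z, forall x, f x = g x + IZR k.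

Lemma eqZ_refl (f : R -> R) : eqZ f f.
Proof. exists 0%Z. intro; simpl; ring. Qed.

Lemma eqZ_trans (f g h : R -> R) : eqZ f g -> eqZ g h -> eqZ f h.
Proof.
intros [k e] [l e']. exists (l + k)%Z. intro x. rewrite e, e', plus_IZR; ring.
Qed.

Lemma eqZ_comp (f f' g g' : R -> R) : deg1 f -> eqZ f f' -> eqZ g g' ->
  eqZ (fun x => f (g x)) (fun x => f' (g' x)).
Proof.
intros d [k e] [l e']. exists (k + l)%Z. intro x.
rewrite e', (deg1_Z f d), e, plus_IZR; ring.
Qed.

(** The full preimage on the line of a group of the circle: since integer translations belong to it,
    both the source and the target of an element can be normalised. *)
Record lift_group (Gm : (R -> R) -> Prop) : Prop := {
  lg_id : Gm ids;
  lg_comp : forall f g, Gm f -> Gm g -> Gm (fun x => f (g x));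
  lg_inv : forall f, Gm f -> exists g, Gm g /\ (forall x, f (g x) = x) /\
    forall x, g (f x) = x;
  lg_Z : forall k, Gm (fun x => x + IZR k);
  lg_deg : forall f, Gm f -> deg1 f }.

(** The letter [s 0] acts first, so the [traj s i] for [i <= n] are the prefixes of one word and
    describe the itinerary of a point. *)
Fixpoint traj (s : nat -> R -> R) (n : nat) : R -> R :=
  match n with O => ids | S n => fun x => s n (traj s n x) end.

Definition word (A : list (R -> R)) (n : nat) (g : R -> R) : Prop :=
  exists s, (forall i, In (s i) A) /\ eqZ g (traj s n).

(** The identity letter turns words of length [n] into words of length at most [n]. Inverses are
    asked up to integer translation, as words are compared by [eqZ]. *)
Record letters (Gm : (R -> R) -> Prop) (A : list (R -> R)) : Prop := {
  gn_id : In ids A;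
  gn_in : forall s, In s A -> Gm s;
  gn_inv : forall s, In s A -> exists s', In s' A /\ eqZ (fun x => s' (s x)) ids }.

Record generating (Gm : (R -> R) -> Prop) (A : list (R -> R)) : Prop := {
  gn_letters :> letters Gm A;
  gn_all : forall g, Gm g -> exists n, word A n g }.

Section Words.
Variable Gm : (R -> R) -> Prop.
Variable A : list (R -> R).
Hypothesis GG : lift_group Gm.
Hypothesis GA : letters Gm A.

Lemma traj_in (s : nat -> R -> R) (n : nat) :
  (forall i, (i < n)%nat -> In (s i) A) -> Gm (traj s n).
Proof.
induction n as [|n IH]; intro h; simpl.
- apply lg_id, GG.
- apply (lg_comp _ GG (s n)); [apply (gn_in _ _ GA), h; lia | apply IH; intros; apply h; lia].
Qed.

Lemma traj_add (s : nat -> R -> R) (m n : nat) :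
  traj s (m + n) = fun x => traj (fun i => s (m + i)%nat) n (traj s m x).
Proof.
induction n as [|n IH].
- now rewrite Nat.add_0_r.
- rewrite Nat.add_succ_r. simpl. now rewrite IH.
Qed.

Lemma traj_ext (s s' : nat -> R -> R) (n : nat) :
  (forall i, (i < n)%nat -> s i = s' i) -> traj s n = traj s' n.
Proof.
induction n as [|n IH]; intro h; simpl; auto.
now rewrite h, IH by (intros; try apply h; lia).
Qed.

Lemma word_eqZ (n : nat) (f g : R -> R) : eqZ f g -> word A n g -> word A n f.
Proof. intros e [s [h e']]. exists s; split; auto. eapply eqZ_trans; eauto. Qed.

Lemma word_comp (n m : nat) (f g : R -> R) : deg1 f ->
  word A n f -> word A m g -> word A (m + n) (fun x => f (g x)).
Proof.
intros df [s [h e]] [s' [h' e']].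
set (t := fun i => if lt_dec i m then s' i else s (i - m)%nat).
exists t. split.
{ intro i. unfold t. destruct (lt_dec i m); auto. }
rewrite traj_add.
replace (traj t m) with (traj s' m).
2:{ apply traj_ext. intros i hi. unfold t. destruct (lt_dec i m); auto; lia. }
replace (traj (fun i => t (m + i)%nat) n) with (traj s n).
2:{ apply traj_ext. intros i hi. unfold t. destruct (lt_dec (m + i) m); [lia|].
    f_equal; lia. }
now apply eqZ_comp.
Qed.

Lemma word_le (n m : nat) (g : R -> R) : (n <= m)%nat -> word A n g -> word A m g.
Proof.
intros hnm [s [h e]].
assert (hid : word A (m - n) ids).
{ exists (fun _ => ids). split; [intro; apply (gn_id _ _ GA)|].
  assert (traj (fun _ => ids) (m - n) = ids) as ->.
  { induction (m - n)%nat; simpl; auto. }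
  apply eqZ_refl. }
replace m with (n + (m - n))%nat by lia.
apply (word_comp (m - n) n ids g); auto.
- apply (proj1 ids_line_homeo).
- exists s; auto.
Qed.

Lemma word_one (s : R -> R) : In s A -> word A 1 s.
Proof.
intro h. exists (fun _ => s). split; auto. exists 0%Z. intro x. unfold traj, ids. ring.
Qed.

Lemma word_inv (n : nat) (f g : R -> R) : Gm f -> Gm g ->
  (forall x, f (g x) = x) -> word A n f -> word A n g.
Proof.
revert f g. induction n as [|n IH]; intros f g Hf Hg e [s [h e']].
- exists s; split; auto. destruct e' as [k e'].
  exists (- k)%Z. intro x. assert (q := e' (g x)). rewrite e in q.
  unfold traj, ids in *. rewrite opp_IZR; lra.
- set (p := traj s n) in *.
  assert (Hp : Gm p) by (apply traj_in; auto).
  destruct (lg_inv _ GG p Hp) as (pi & Hpi & e1 & e2).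
  destruct (gn_inv _ _ GA (s n) (h n)) as (s' & hs' & es').
  assert (w1 : word A n pi).
  { apply (IH p pi); auto. exists s; split; auto. apply eqZ_refl. }
  apply (word_eqZ _ _ (fun x => pi (s' x))).
  + destruct e' as [k e']. destruct es' as [l es'].
    exists (- k - l)%Z. intro x.
    assert (q := e' (g x)). rewrite e in q. simpl in q. fold p in q.
    assert (q2 : s' x = p (g x) + IZR (l + k)).
    { rewrite q at 1. rewrite (deg1_Z s').
      2:{ apply (lg_deg _ GG), (gn_in _ _ GA); auto. }
      rewrite es', plus_IZR. unfold ids; ring. }
    rewrite q2. rewrite (deg1_Z pi) by now apply (lg_deg _ GG).
    rewrite e2, minus_IZR, opp_IZR, plus_IZR; ring.
  + replace (S n) with (1 + n)%nat by lia. apply (word_comp n 1 pi s'); auto.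
    * now apply (lg_deg _ GG).
    * now apply word_one.
Qed.

Hypothesis GAll : forall g, Gm g -> exists n, word A n g.

Lemma geodesic (g : R -> R) : Gm g -> exists n s,
  (forall i, In (s i) A) /\ eqZ g (traj s n) /\
  forall i j k t, (i <= j <= n)%nat -> Gm t -> word A k t ->
    (forall x, traj s j x = t (traj s i x)) -> (j <= i + k)%nat.
Proof.
intro Hg.
destruct (GAll g Hg) as [n0 h0].
assert (hmin : exists n, word A n g /\ forall m, word A m g -> (n <= m)%nat).
{ revert h0. induction n0 as [n0 IH] using (well_founded_induction lt_wf). intro h0.
  destruct (classic (exists m, (m < n0)%nat /\ word A m g)) as [[m [c1 c2]]|c].
  - now apply (IH m).
  - exists n0. split; auto. intros m hm.
    destruct (le_lt_dec n0 m); auto. destruct c; exists m; auto. }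
destruct hmin as [n [[s [hs e]] hmin]].
exists n, s. split; [|split]; auto.
intros i j k t hij Ht hk et.
assert (hW : word A (i + k + (n - j)) g).
{ apply (word_eqZ _ _ (fun x => traj (fun a => s (j + a)%nat) (n - j) (t (traj s i x)))).
  - apply (eqZ_trans _ _ _ e).
    replace n with (j + (n - j))%nat at 1 by lia. rewrite traj_add.
    exists 0%Z. intro x. rewrite et; ring.
  - apply (word_comp (n - j) (i + k) (traj (fun a => s (j + a)%nat) (n - j))
      (fun x => t (traj s i x))).
    + apply (lg_deg _ GG), traj_in; auto.
    + exists (fun a => s (j + a)%nat); split; auto; apply eqZ_refl.
    + apply word_comp; auto.
      * now apply (lg_deg _ GG).
      * exists s; split; auto; apply eqZ_refl. }
apply hmin in hW. lia.
Qed.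
End Words.

(** The displacement is measured on the original line; uniform continuity of [H] controls it on the
    other one ([near_close]). *)
Definition near (H Hi : R -> R) (eta : R) (g : R -> R) (a b : R) : Prop :=
  forall y, a <= y <= b -> Rabs (g y - y) <= eta /\
    Rabs (dv ids ids g y - 1) <= eta /\ Rabs (dv H Hi g y - 1) <= eta.

(** For [H = Hi = ids] this is non-discreteness of the group itself in the C^1 sense. *)
Definition C1_nondiscrete (Gm : (R -> R) -> Prop) (H Hi : R -> R) : Prop :=
  exists a b, a < b /\ forall eta, 0 < eta ->
    exists g, Gm g /\ ~ eqZ g ids /\ near H Hi eta g a b.

Definition distortion2 (H Hi : R -> R) (Q : R) (g : R -> R) (a b : R) : Prop :=
  distortion ids ids Q g a b /\ distortion H Hi Q g a b.

Lemma dv_shift (K Ki b : R -> R) (k j : Z) (y : R) : line_homeo K Ki ->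
  dv K Ki (fun y => b (y + IZR k) + IZR j) y = dv K Ki b (y + IZR k).
Proof.
intros (dK & dKi & e & e'). unfold dv.
rewrite (Derive_ext _ (fun x => (fun t => K (b (Ki t)) + IZR j) (x + IZR k))).
2:{ intro t. now rewrite (deg1_Z K dK), (deg1_Z Ki dKi). }
rewrite (deg1_Z K dK).
set (F := fun t => K (b (Ki t))).
transitivity (Derive (fun x => F x + IZR j) (K y + IZR k)).
- unfold Derive. f_equal. apply Lim_ext. intro t. do 2 f_equal.
  replace (K y + t + IZR k) with (K y + IZR k + t) by ring. reflexivity.
- unfold Derive. f_equal. apply Lim_ext. intro t. unfold F. f_equal. ring.
Qed.

(** * Finiteness of families of bounded distortion in a discrete group *)

Section Finiteness.
Variables (Gm : (R -> R) -> Prop) (A : list (R -> R)) (H Hi : R -> R).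
Hypothesis GG : lift_group Gm.
Hypothesis GA : generating Gm A.
Hypothesis LH : line_homeo H Hi.
Hypothesis SM : forall g, Gm g -> log_lipschitz ids ids g /\ log_lipschitz H Hi g.
Hypothesis ND : ~ C1_nondiscrete Gm H Hi.

Lemma not_nondiscrete (a b : R) : a < b -> exists eta, 0 < eta /\
  forall g, Gm g -> near H Hi eta g a b -> eqZ g ids.
Proof.
intro hab. apply NNPP. intro c. apply ND. exists a, b. split; auto.
intros eta he. apply NNPP. intro c'. apply c. exists eta. split; auto.
intros g hg hn. apply NNPP. intro c2. apply c'. now exists g.
Qed.

(** The mean slope of [b] over [x, x'] is between [r1 / r2] and [r2 / r1], and bounded distortion
    spreads this to all slopes up to the factor [exp Q]. *)
Lemma bilip (Q r1 r2 : R) (b : R -> R) (x x' : R) : 0 <= Q -> 0 < r1 -> Gm b ->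
  r1 <= x' - x <= r2 -> r1 <= b x' - b x <= r2 -> distortion ids ids Q b x x' ->
  forall y z, x <= y -> y <= z -> z <= x' ->
    b z - b y <= (exp Q * r2 / r1) * (z - y) /\
    z - y <= (exp Q * r2 / r1) * (b z - b y).
Proof.
intros hQ h1 Hb hx hb hBD y z hy hyz hz.
destruct (SM b Hb) as [s _].
destruct (dv_mvt ids ids ids_line_homeo b y z s hyz) as [c [hc e]].
destruct (distortion_len ids ids ids_line_homeo Q b x x' c hQ ltac:(lra) ltac:(lra) s hBD)
  as [l1 l2].
assert (p := proj1 (proj2 s) c).
assert (eQ := exp_pos Q).
set (D := dv ids ids b c) in *.
change (b z - b y = D * (z - y)) in e.
change (b x' - b x <= exp Q * D * (x' - x)) in l1.
change (D * (x' - x) <= exp Q * (b x' - b x)) in l2.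
assert (u1 : D * r1 <= exp Q * r2).
{ apply Rle_trans with (D * (x' - x)); nra. }
assert (u2 : r1 <= exp Q * D * r2).
{ apply Rle_trans with (b x' - b x); [lra|]. apply Rle_trans with (1 := l1).
  apply Rmult_le_compat_l; nra. }
assert (eM : D <= exp Q * r2 / r1) by (apply Rle_div_r; lra).
assert (eM' : 1 <= exp Q * r2 / r1 * D).
{ replace (exp Q * r2 / r1 * D) with (exp Q * D * r2 / r1) by (field; lra).
  apply Rle_div_r; lra. }
rewrite e. split.
- apply Rmult_le_compat_r; lra.
- rewrite <- Rmult_assoc. nra.
Qed.

(** Compactness. Counterexamples of unbounded word length would have, on a common interval, a
    subsequence of uniformly close maps [b n]. The quotients of two of them by composition are
    C^0-small with bounded distortion, hence C^1-small on both lines by [distortion_interp], hence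
    trivial by discreteness; so all of them have the same word length, a contradiction. *)
Lemma bounded_family_word (Q r1 r2 : R) : 0 <= Q -> 0 < r1 -> exists L,
  forall b x x', Gm b -> r1 <= x' - x <= r2 -> r1 <= b x' - b x <= r2 ->
    distortion2 H Hi Q b x x' -> word A L b.
Proof.
intros hQ hr1. apply NNPP. intro NE.
assert (hseq : forall n : nat, exists t : (R -> R) * (R * R),
  let b := fst t in let x := fst (snd t) in let x' := snd (snd t) in
  Gm b /\ r1 <= x' - x <= r2 /\ r1 <= b x' - b x <= r2 /\ distortion2 H Hi Q b x x' /\
  ~ word A n b /\ 0 <= x <= 1 /\ 0 <= b x <= 1).
{ intro n. apply NNPP. intro c. apply NE. exists n.
  intros b x x' Hb hx hb hBD. apply NNPP. intro nW. apply c.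
  (* Integer translations bring [x] and [b x] into [0, 1); they change neither the distortion nor
     the length of words. *)
  set (k := Int_part x). set (j := Int_part (b x)).
  exists (fun y => b (y + IZR k) + IZR (- j), (x - IZR k, x' - IZR k)). simpl.
  replace (x - IZR k + IZR k) with x by ring.
  replace (x' - IZR k + IZR k) with x' by ring.
  assert (hk := Int_part_bounds x). assert (hj := Int_part_bounds (b x)).
  fold k in hk. fold j in hj. rewrite opp_IZR.
  assert (db := lg_deg _ GG b Hb).
  repeat split; try lra.
  - apply (lg_comp _ GG (fun y => y + - IZR j) (fun y => b (y + IZR k))).
    + rewrite <- opp_IZR. apply (lg_Z _ GG).
    + apply (lg_comp _ GG b (fun y => y + IZR k)); auto. apply (lg_Z _ GG).
  - intros y z hy hz. rewrite <- opp_IZR, !dv_shift by apply ids_line_homeo.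
    replace (Rabs (ids y - ids z) / (ids (x' - IZR k) - ids (x - IZR k))) with
     (Rabs (ids (y + IZR k) - ids (z + IZR k)) / (ids x' - ids x)).
    { apply (proj1 hBD); lra. }
    unfold ids. f_equal; [f_equal|]; ring.
  - intros y z hy hz. rewrite <- opp_IZR, !dv_shift by apply LH.
    replace (Rabs (H y - H z) / (H (x' - IZR k) - H (x - IZR k))) with
     (Rabs (H (y + IZR k) - H (z + IZR k)) / (H x' - H x)).
    { apply (proj2 hBD); lra. }
    destruct LH as (dH & _).
    assert (sh : forall w, H (w - IZR k) = H w - IZR k).
    { intro w. unfold Rminus. rewrite <- opp_IZR. now apply deg1_Z. }
    rewrite !sh, !(deg1_Z H dH). f_equal; [f_equal|]; ring.
  - intro w. apply nW. revert w. apply word_eqZ. exists (j - k)%Z. intro y.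
    rewrite (deg1_Z b db), minus_IZR; ring. }
apply choice_fun in hseq. destruct hseq as [t ht].
set (b := fun n => fst (t n)). set (x := fun n => fst (snd (t n))).
set (x' := fun n => snd (snd (t n))).
assert (hb : forall n, Gm (b n) /\ r1 <= x' n - x n <= r2 /\
  r1 <= b n (x' n) - b n (x n) <= r2 /\ distortion2 H Hi Q (b n) (x n) (x' n) /\
  ~ word A n (b n) /\ 0 <= x n <= 1 /\ 0 <= b n (x n) <= 1) by exact ht.
clearbody b x x'. clear t ht.
assert (hr2 : r1 <= r2) by (generalize (hb 0%nat); intros; lra).
destruct (infinite_close_finite (fun _ => x) (r1 / 8) 0 1 ltac:(lra) 1
  (fun _ => True)) as [S1 [i1 [_ c1]]].
{ intro n; exists n; split; auto. }
{ intros j n _ _. apply hb. }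
destruct (i1 0%nat) as [n0 [_ hn0]].
(* [u, v] lies in every [x n, x' n] of the subsequence: left endpoints are within [r1 / 8] of
   [x n0], and lengths are at least [r1]. The smaller [u', v'] leaves a margin [r1 / 8] for
   displacements. *)
set (u := x n0 + r1 / 8). set (v := x n0 + r1 * 7 / 8).
assert (huv : forall n, S1 n -> x n <= u /\ v <= x' n).
{ intros n hn. assert (hc := c1 0%nat n n0 ltac:(lia) hn hn0).
  apply Rabs_le_between in hc. generalize (hb n). unfold u, v. intros; lra. }
set (u' := u + r1 / 8). set (v' := v - r1 / 8).
assert (hu'v' : u' < v') by (unfold u', v', u, v; lra).
destruct (not_nondiscrete u' v' hu'v') as [eta [heta hdisc]].
set (M := exp Q * r2 / r1).
assert (eQ := exp_pos Q).
assert (eQ1 : 1 <= exp Q) by (generalize (exp_ineq1_le Q); lra).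
assert (hM : 1 <= M).
{ unfold M. apply Rle_div_r; nra. }
(* The distortion of [bi o b m], where [bi] inverts [b n]: [Q * exp Q] for the inverse by
   [distortion_inv], combined with [Q] by [distortion_comp]. *)
set (Q' := Q + Q * exp Q * exp Q).
assert (hQe : 0 <= Q * exp Q) by nra.
assert (hQ' : 0 <= Q') by (unfold Q'; nra).
destruct (distortion_interp ids ids ids_line_homeo Q' (ids v' - ids u') eta hQ'
  ltac:(unfold ids; lra) heta) as [e1 [he1 int1]].
destruct (distortion_interp H Hi LH Q' (H v' - H u') eta hQ'
  ltac:(apply (K_pos H Hi LH); auto) heta) as [e2 [he2 int2]].
destruct (line_homeo_unif H Hi LH e2 he2) as [d [hd hunif]].
set (e0 := Rmin (Rmin eta e1) (Rmin d (r1 / 8))).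
assert (he0 : 0 < e0) by (unfold e0; repeat apply Rmin_pos; lra).
assert (e0a : e0 <= eta) by (unfold e0; eapply Rle_trans; [apply Rmin_l|apply Rmin_l]).
assert (e0b : e0 <= e1) by (unfold e0; eapply Rle_trans; [apply Rmin_l|apply Rmin_r]).
assert (e0c : e0 <= d) by (unfold e0; eapply Rle_trans; [apply Rmin_r|apply Rmin_l]).
assert (e0d : e0 <= r1 / 8) by (unfold e0; eapply Rle_trans; [apply Rmin_r|apply Rmin_r]).
(* The inverse of [b n] is [M]-Lipschitz, so a distance [w] between [b n] and [b m] becomes a
   displacement of the quotient by at most [e0]. *)
set (w := e0 / M).
assert (hw : 0 < w) by (unfold w; apply Rdiv_lt_0_compat; lra).
destruct (nfloor_ex (2 * M * (v - u) / w)) as [N0 [_ hN0]].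
{ apply Rdiv_le_0_compat; auto. unfold u, v; nra. }
set (N := S N0).
assert (hN : 0 < INR N) by (unfold N; rewrite S_INR; generalize (pos_INR N0); lra).
set (h := (v - u) / INR N).
assert (chart_H : 0 < h) by (unfold h; apply Rdiv_lt_0_compat; auto; unfold u, v; lra).
assert (hMh : M * h <= w / 2).
{ unfold h. replace (M * ((v - u) / INR N)) with (M * (v - u) / INR N) by (field; lra).
  apply Rle_div_l; auto.
  assert (2 * M * (v - u) / w < INR N) by (unfold N; rewrite S_INR; lra).
  apply Rlt_div_l in H0; auto. lra. }
assert (hNh : u + INR N * h = v) by (unfold h; field; lra).
assert (lip : forall n, S1 n -> forall y z, u <= y -> y <= z -> z <= v ->
  b n z - b n y <= M * (z - y) /\ z - y <= M * (b n z - b n y)).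
{ intros n hn y z h1 h2 h3. destruct (hb n) as (a1 & a2 & a3 & a4 & _).
  destruct (huv n hn). apply (bilip Q r1 r2 (b n) (x n) (x' n)); auto; try lra.
  apply a4. }
(* Closeness at the grid points is enough: between two neighbours each map increases by at most
   [M * h <= w / 2]. *)
destruct (infinite_close_finite (fun j n => b n (u + INR j * h)) (w / 2) 0 (1 + r2)
  ltac:(lra) (S N) S1 i1) as [S2 [i2 [sub2 c2]]].
{ intros j n hj hn. destruct (hb n) as (a1 & a2 & a3 & a4 & _ & a5 & a6).
  destruct (huv n hn) as [q1 q2]. assert (db := lg_deg _ GG _ a1).
  assert (INR j * h <= INR N * h).
  { apply Rmult_le_compat_r; [lra|]. apply le_INR; lia. }
  assert (0 <= INR j * h) by (apply Rmult_le_pos; [apply pos_INR|lra]).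
  assert (b n (x n) <= b n (u + INR j * h)) by (apply deg1_le; auto; lra).
  assert (b n (u + INR j * h) <= b n (x' n)) by (apply deg1_le; auto; lra).
  lra. }
assert (close : forall n m, S2 n -> S2 m -> forall y, u <= y <= v -> b n y <= b m y + w).
{ intros n m hn hm y hy.
  destruct (grid_find u h y chart_H N) as [j [hj hy']]; [lra|unfold N; lia|].
  assert (db := lg_deg _ GG _ (proj1 (hb n))).
  assert (db' := lg_deg _ GG _ (proj1 (hb m))).
  assert (INR (S j) * h <= INR N * h).
  { apply Rmult_le_compat_r; [lra|]. apply le_INR; lia. }
  assert (0 <= INR j * h) by (apply Rmult_le_pos; [apply pos_INR|lra]).
  assert (q1 : b n y <= b n (u + INR (S j) * h)) by (apply deg1_le; auto; lra).
  assert (q2 : b m (u + INR j * h) <= b m y) by (apply deg1_le; auto; lra).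
  destruct (lip n (sub2 n hn) (u + INR j * h) (u + INR (S j) * h)) as [q3 _];
    try rewrite S_INR; try lra.
  { rewrite S_INR in *; lra. }
  assert (q4 := c2 j n m ltac:(lia) hn hm). simpl in q4. apply Rabs_le_between in q4.
  replace (u + INR (S j) * h - (u + INR j * h)) with h in q3 by (rewrite S_INR; ring).
  lra. }
destruct (i2 0%nat) as [n [_ hn]].
(* The order matters: [n] first, then a word length [L0] of [b n], then [m >= L0], for which [b m]
   is not a word of length [m]. *)
destruct (gn_all _ _ GA (b n) (proj1 (hb n))) as [L0 hL0].
destruct (i2 L0) as [m [hm0 hm]].
destruct (hb n) as (Hn & an & an' & BDn & _).
destruct (hb m) as (Hm & am & am' & BDm & nWm & _).
destruct (lg_inv _ GG (b n) Hn) as (bi & Hbi & ei & ei').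
assert (dn := lg_deg _ GG _ Hn). assert (dm := lg_deg _ GG _ Hm).
assert (di := lg_deg _ GG _ Hbi).
assert (disp : forall y, u' <= y <= v' -> Rabs (bi (b m y) - y) <= e0).
{ intros y hy. unfold u', v' in hy.
  assert (q1 := close n m hn hm y ltac:(lra)).
  assert (q2 := close m n hm hn y ltac:(lra)).
  destruct (lip n (sub2 n hn) y (y + e0)) as [_ q3]; try lra.
  destruct (lip n (sub2 n hn) (y - e0) y) as [_ q4]; try lra.
  assert (hwM : w * M = e0) by (unfold w; field; lra).
  assert (q5 : w <= b n (y + e0) - b n y) by nra.
  assert (q6 : w <= b n y - b n (y - e0)) by nra.
  assert (bi (b m y) <= y + e0) by (apply (deg1_le_inv (b n) dn); rewrite ei; lra).
  assert (y - e0 <= bi (b m y)) by (apply (deg1_le_inv (b n) dn); rewrite ei; lra).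
  apply Rabs_le; lra. }
set (g := fun y => bi (b m y)).
assert (Hg : Gm g) by (apply (lg_comp _ GG bi); auto).
destruct (huv n (sub2 n hn)) as [w1 w2]. destruct (huv m (sub2 m hm)) as [w3 w4].
assert (im1 : b n u <= b m u').
{ assert (q := disp u' ltac:(lra)). apply Rabs_le_between in q.
  apply (deg1_le_inv bi di). rewrite ei'. unfold u' in *; lra. }
assert (im2 : b m v' <= b n v).
{ assert (q := disp v' ltac:(lra)). apply Rabs_le_between in q.
  apply (deg1_le_inv bi di). rewrite ei'. unfold v' in *; lra. }
assert (hbm : b m u' < b m v') by now apply dm.
assert (BDg : forall K Ki, line_homeo K Ki -> log_lipschitz K Ki (b n) -> log_lipschitz K Ki (b m) ->
  log_lipschitz K Ki bi -> distortion K Ki Q (b n) (x n) (x' n) -> distortion K Ki Q (b m) (x m) (x' m) ->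
  distortion K Ki Q' g u' v').
{ intros K Ki LK sn sm' si B1 B2. unfold g, Q'.
  apply (distortion_comp K Ki LK Q (Q * exp Q) bi (b m) u' v'); auto.
  - apply (distortion_sub K Ki LK Q (b m) (x m) (x' m)); auto; unfold u', v' in *; lra.
  - apply (distortion_sub K Ki LK (Q * exp Q) bi (b n u) (b n v)); auto.
    apply (distortion_inv K Ki LK Q (b n) bi u v); auto; try (unfold u, v; lra).
    apply (distortion_sub K Ki LK Q (b n) (x n) (x' n)); auto; unfold u, v in *; lra. }
destruct (SM _ Hn) as [sn1 sn2]. destruct (SM _ Hm) as [sm1 sm2].
destruct (SM _ Hbi) as [si1 si2]. destruct (SM _ Hg) as [sg1 sg2].
apply nWm. apply (word_le Gm A GA L0 m); auto.
apply (word_eqZ A L0 (b m) (b n)); auto.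
destruct (hdisc g Hg) as [k hk].
{ intros y hy. split; [|split].
  - unfold g. specialize (disp y hy). lra.
  - apply (int1 g u' v'); auto; try lra.
    + apply BDg; auto; [apply ids_line_homeo|apply BDn|apply BDm].
    + intros z hz. unfold ids. specialize (disp z hz). unfold g; lra.
  - apply (int2 g u' v'); auto; try lra.
    + apply BDg; auto; [apply BDn|apply BDm].
    + intros z hz. apply hunif. specialize (disp z hz). unfold g; lra. }
exists k. intro y. rewrite <- (deg1_Z (b n) dn). rewrite <- (ei (b m y)).
f_equal. apply hk.
Qed.
End Finiteness.

(** * Expansion and blow-ups *)

Lemma list_uniform {T : Type} (P : T -> R -> Prop) (l : list T) :
  (forall s N N', N <= N' -> P s N -> P s N') ->
  (forall s, In s l -> exists N, P s N) ->
  exists N, 1 <= N /\ forall s, In s l -> P s N.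
Proof.
intros hm. induction l as [|s l IH]; intro h.
- exists 1; split; [lra|]. intros s [].
- destruct IH as [N [hN hP]]. { intros; apply h; now right. }
  destruct (h s (or_introl eq_refl)) as [N' hN'].
  exists (Rmax N N'). split.
  + apply Rle_trans with N; auto. apply Rmax_l.
  + intros t [<-|ht].
    * apply (hm s N'); auto. apply Rmax_r.
    * apply (hm t N); auto. apply Rmax_l.
Qed.

Lemma pow_lt_any (q eps : R) : 0 < q < 1 -> 0 < eps -> exists n, q ^ n < eps.
Proof.
intros hq he.
destruct (pow_lt_1_zero q ltac:(rewrite Rabs_pos_eq; lra) eps he) as [n hn].
exists n. specialize (hn n (le_n n)).
now rewrite Rabs_pos_eq in hn by (apply pow_le; lra).
Qed.

Lemma pow_gt_any (q B : R) : 1 < q -> exists n, B < q ^ n.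
Proof.
intros hq. destruct (Pow_x_infinity q ltac:(rewrite Rabs_pos_eq; lra) (B + 1)) as [n hn].
exists n. specialize (hn n (le_n n)).
rewrite Rabs_pos_eq in hn by (apply pow_le; lra). lra.
Qed.

Lemma pow_antitone (q : R) (m n : nat) : 0 < q < 1 -> (m <= n)%nat -> q ^ n <= q ^ m.
Proof.
intros hq h. replace n with (m + (n - m))%nat by lia. rewrite pow_add.
rewrite <- (Rmult_1_r (q ^ m)) at 2. apply Rmult_le_compat_l.
- apply pow_le; lra.
- rewrite <- (pow1 (n - m)). apply pow_incr; lra.
Qed.

Lemma root_exists (q : R) (L : nat) : 0 < q < 1 -> (0 < L)%nat ->
  exists u, 0 < u < 1 /\ u ^ L = q.
Proof.
intros hq hL. assert (hL' : 0 < INR L) by (apply lt_0_INR; lia).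
assert (hln : ln q < 0) by (rewrite <- ln_1; apply ln_increasing; lra).
exists (exp (ln q / INR L)). split; [split|].
- apply exp_pos.
- rewrite <- exp_0. apply exp_increasing. apply Rlt_div_l; lra.
- assert (e : forall n, exp (ln q / INR L) ^ n = exp (INR n * (ln q / INR L))).
  { induction n as [|n IH]; [simpl; rewrite Rmult_0_l, exp_0; easy|].
    rewrite <- tech_pow_Rmult, IH, <- exp_plus, S_INR. f_equal; ring. }
  rewrite e. replace (INR L * (ln q / INR L)) with (ln q) by (field; lra).
  apply exp_ln; lra.
Qed.

Fixpoint psum (f : nat -> R) (n : nat) : R :=
  match n with O => 0 | S n => psum f n + f n end.

Lemma psum_le (f g : nat -> R) (n : nat) :
  (forall k, (k < n)%nat -> f k <= g k) -> psum f n <= psum g n.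
Proof.
induction n as [|n IH]; intro h; simpl; [lra|].
apply Rplus_le_compat; [apply IH; intros; apply h; lia | apply h; lia].
Qed.

Lemma psum_scal (c : R) (f : nat -> R) (n : nat) :
  psum (fun k => c * f k) n = c * psum f n.
Proof. induction n as [|n IH]; simpl; [ring|]. rewrite IH; ring. Qed.

Lemma psum_pos (f : nat -> R) (n : nat) : (forall k, 0 <= f k) -> 0 <= psum f n.
Proof. intro h; induction n as [|n IH]; simpl; [lra|]. generalize (h n); lra. Qed.

Lemma psum_mono (f : nat -> R) (m n : nat) : (forall k, 0 <= f k) -> (m <= n)%nat ->
  psum f m <= psum f n.
Proof. intros h hmn. induction hmn; simpl; [lra|]. generalize (h m0); lra. Qed.

Lemma psum_term (f : nat -> R) (n k : nat) : (forall k, 0 <= f k) -> (k < n)%nat ->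
  f k <= psum f n.
Proof.
intros h hk. apply Rle_trans with (psum f (S k)).
- simpl. generalize (psum_pos f k h); lra.
- now apply psum_mono.
Qed.

Lemma psum_geom (q : R) (n : nat) : 0 < q < 1 -> psum (fun k => q ^ k) n <= / (1 - q).
Proof.
intro hq. assert (e : psum (fun k => q ^ k) n * (1 - q) = 1 - q ^ n).
{ induction n as [|n IH]; simpl; [ring|]. rewrite Rmult_plus_distr_r, IH; ring. }
assert (p := pow_lt q n ltac:(lra)).
apply (Rmult_le_reg_r (1 - q)); [lra|]. rewrite e, Rinv_l; lra.
Qed.

(** With truncated subtraction, [(k - k0) + (k0 - k)] is the distance from [k] to [k0]; two
    geometric series meet there. *)
Lemma psum_dist (q : R) (k0 n : nat) : 0 < q < 1 ->
  psum (fun k => q ^ ((k - k0) + (k0 - k))) n <= 2 / (1 - q).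
Proof.
intro hq.
assert (e1 : forall n, (n <= k0)%nat ->
  psum (fun k => q ^ ((k - k0) + (k0 - k))) n * (1 - q) <= q ^ (k0 - n)).
{ induction n0 as [|n0 IH]; intro h; simpl.
  - rewrite Rmult_0_l. apply pow_le; lra.
  - specialize (IH ltac:(lia)).
    replace (n0 - k0 + (k0 - n0))%nat with (k0 - n0)%nat by lia.
    replace (k0 - n0)%nat with (S (k0 - S n0)) in * by lia. simpl in *.
    assert (p := pow_lt q (k0 - S n0) ltac:(lra)).
    assert (0 <= q ^ (k0 - S n0) * ((1 - q) * (1 - q))) by (apply Rmult_le_pos; nra).
    nra. }
assert (e2 : forall j, psum (fun k => q ^ ((k - k0) + (k0 - k))) (k0 + j) * (1 - q)
   <= 2 - q ^ j).
{ induction j as [|j IH].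
  - rewrite Nat.add_0_r. apply Rle_trans with (1 := e1 k0 (le_n _)).
    rewrite Nat.sub_diag; simpl; lra.
  - rewrite Nat.add_succ_r. simpl.
    replace (k0 + j - k0 + (k0 - (k0 + j)))%nat with j by lia. nra. }
apply (Rmult_le_reg_r (1 - q)); [lra|].
replace (2 / (1 - q) * (1 - q)) with 2 by (field; lra).
destruct (le_lt_dec n k0) as [c|c].
- apply Rle_trans with (1 := e1 n c).
  assert (q ^ (k0 - n) <= 1) by (rewrite <- (pow1 (k0 - n)); apply pow_incr; lra). lra.
- replace n with (k0 + (n - k0))%nat by lia. apply Rle_trans with (1 := e2 _).
  assert (p := pow_lt q (n - k0) ltac:(lra)). lra.
Qed.

Lemma argmin_exists (m : nat -> nat) (n : nat) :
  exists k0, (k0 <= n)%nat /\ forall k, (k <= n)%nat -> (m k0 <= m k)%nat.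
Proof.
induction n as [|n [k0 [h1 h2]]].
- exists 0%nat; split; auto. intros k hk. replace k with 0%nat by lia. lia.
- destruct (le_lt_dec (m k0) (m (S n))) as [c|c].
  + exists k0; split; [lia|]. intros k hk. destruct (Nat.eq_dec k (S n)) as [->|]; auto.
    apply h2; lia.
  + exists (S n); split; auto. intros k hk.
    destruct (Nat.eq_dec k (S n)) as [->|]; auto.
    specialize (h2 k ltac:(lia)). lia.
Qed.

Lemma argmax_exists (f : nat -> R) (n : nat) :
  exists k0, (k0 <= n)%nat /\ forall k, (k <= n)%nat -> f k <= f k0.
Proof.
induction n as [|n [k0 [h1 h2]]].
- exists 0%nat; split; auto. intros k hk. replace k with 0%nat by lia. lra.
- destruct (Rle_lt_dec (f (S n)) (f k0)) as [c|c].
  + exists k0; split; [lia|]. intros k hk. destruct (Nat.eq_dec k (S n)) as [->|]; auto.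
    apply h2; lia.
  + exists (S n); split; auto. intros k hk.
    destruct (Nat.eq_dec k (S n)) as [->|]; [lra|].
    specialize (h2 k ltac:(lia)). lra.
Qed.

(* Few indices k have a small depth m k, because depths grow linearly with the
   distance to the index of minimal depth. *)
Lemma psum_depth (u : R) (L ms n : nat) (m : nat -> nat) : 0 < u < 1 -> (1 <= L)%nat ->
  (forall i j, (i <= j < n)%nat -> (j <= i + L * (m i + m j + 1))%nat) ->
  (forall i, (i < n)%nat -> (ms <= m i)%nat) ->
  psum (fun k => (u ^ (4 * L)) ^ m k) n <= u ^ (2 * L * ms) * (2 / (u ^ L * (1 - u))).
Proof.
intros hu hL hm hms. destruct n as [|n].
- simpl psum. apply Rmult_le_pos; [apply pow_le; lra|].
  apply Rlt_le, Rdiv_lt_0_compat; [lra|]. apply Rmult_lt_0_compat; [apply pow_lt|]; lra.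
- destruct (argmin_exists m n) as [k0 [h1 h2]].
  apply Rle_trans with (psum (fun k => u ^ (2 * L * ms) / u ^ L *
    u ^ ((k - k0) + (k0 - k))) (S n)).
  + apply psum_le. intros k hk. rewrite <- pow_mult.
    (* Holds because [m k0 <= m k]. Half of the exponent [4 * L * m k] pays for this distance, up to
       the division by [u ^ L], and the other half yields [2 * L * ms]. *)
    assert (hd : ((k - k0) + (k0 - k) <= L * (2 * m k + 1))%nat).
    { specialize (h2 k ltac:(lia)).
      assert (L * (m k + m k0 + 1) <= L * (2 * m k + 1))%nat by (apply Nat.mul_le_mono_l; lia).
      destruct (le_lt_dec k k0) as [c|c].
      - specialize (hm k k0 ltac:(lia)). lia.
      - specialize (hm k0 k ltac:(lia)).
        replace (m k0 + m k + 1)%nat with (m k + m k0 + 1)%nat in hm by lia. lia. }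
    specialize (hms k hk).
    assert (pL := pow_lt u L ltac:(lra)).
    replace (u ^ (2 * L * ms) / u ^ L * u ^ (k - k0 + (k0 - k))) with
      (u ^ (2 * L * ms + (k - k0 + (k0 - k))) / u ^ L) by (rewrite pow_add; field; lra).
    apply Rle_div_r; auto. rewrite <- pow_add. apply pow_antitone; auto.
    assert (2 * L * ms <= 2 * L * m k)%nat by (apply Nat.mul_le_mono_l; lia).
    lia.
  + rewrite psum_scal. assert (pL := pow_lt u L ltac:(lra)).
    replace (u ^ (2 * L * ms) * (2 / (u ^ L * (1 - u)))) with
      (u ^ (2 * L * ms) / u ^ L * (2 / (1 - u))) by (field; lra).
    apply Rmult_le_compat_l.
    * apply Rdiv_le_0_compat; auto. apply pow_le; lra.
    * now apply psum_dist.
Qed.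

(** [rho] is a Lebesgue number: one element expands on a whole window. The window starts at [y]
    because intervals are followed from their left endpoint. *)
Definition expanding (X : list (R -> R)) (K Ki : R -> R) (mu rho : R) : Prop :=
  1 < mu /\ 0 < rho /\ forall y, exists e, In e X /\
    forall z, y <= z <= y + rho -> mu <= dv K Ki e z.

(* Equivalent to Hoelder continuity of K. *)
Definition geometric_modulus (K : R -> R) : Prop :=
  forall q C, 0 < q < 1 -> 0 < C -> exists q' C', 0 < q' < 1 /\ 0 < C' /\
    forall m a b, a <= b -> b - a <= C * q ^ m -> K b - K a <= C' * q' ^ m.

(** * Blow-ups of short intervals with bounded distortion on both lines *)

Section Telescoping.
Variables (Gm : (R -> R) -> Prop) (A X : list (R -> R)) (H Hi : R -> R) (mu rho : R).
Hypothesis GG : lift_group Gm.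
Hypothesis GA : generating Gm A.
Hypothesis LH : line_homeo H Hi.
Hypothesis SM : forall g, Gm g -> log_lipschitz ids ids g /\ log_lipschitz H Hi g.
Hypothesis GX : forall e, In e X -> Gm e.
Hypothesis EX : expanding X ids ids mu rho.
Hypothesis HOL : geometric_modulus H.

Lemma ln_dv_lipschitz (l : list (R -> R)) : (forall g, In g l -> Gm g) ->
  exists N, 1 <= N /\ forall g, In g l -> forall x y,
    Rabs (ln (dv ids ids g x) - ln (dv ids ids g y)) <= N * Rabs (ids x - ids y) /\
    Rabs (ln (dv H Hi g x) - ln (dv H Hi g y)) <= N * Rabs (H x - H y).
Proof.
intro hl. apply (list_uniform (fun g N => forall x y,
    Rabs (ln (dv ids ids g x) - ln (dv ids ids g y)) <= N * Rabs (ids x - ids y) /\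
    Rabs (ln (dv H Hi g x) - ln (dv H Hi g y)) <= N * Rabs (H x - H y))).
- intros g N N' hN h x y. destruct (h x y) as [h1 h2]. split.
  + apply Rle_trans with (1 := h1). apply Rmult_le_compat_r; auto. apply Rabs_pos.
  + apply Rle_trans with (1 := h2). apply Rmult_le_compat_r; auto. apply Rabs_pos.
- intros g hg. destruct (SM g (hl g hg)) as [(_ & _ & N1 & s1) (_ & _ & N2 & s2)].
  exists (Rmax N1 N2). intros x y. split.
  + apply Rle_trans with (1 := s1 x y). apply Rmult_le_compat_r; [apply Rabs_pos|].
    apply Rmax_l.
  + apply Rle_trans with (1 := s2 x y). apply Rmult_le_compat_r; [apply Rabs_pos|].
    apply Rmax_r.
Qed.

Lemma words_bounded (l : list (R -> R)) : (forall g, In g l -> Gm g) ->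
  exists L, forall g, In g l -> word A L g.
Proof.
induction l as [|g l IH]; intro h.
- exists 0%nat. intros g [].
- destruct IH as [L hL]. { intros; apply h; now right. }
  destruct (gn_all _ _ GA g (h g (or_introl eq_refl))) as [L' hL'].
  exists (max L L'). intros g' [<-|hg].
  + apply (word_le Gm A GA L'); auto; lia.
  + apply (word_le Gm A GA L); auto; lia.
Qed.

Lemma distortion_single (K Ki : R -> R) (N s : R) (g : R -> R) (a b : R) :
  line_homeo K Ki -> a < b -> N * (K b - K a) <= s ->
  (forall x y, Rabs (ln (dv K Ki g x) - ln (dv K Ki g y)) <= N * Rabs (K x - K y)) ->
  distortion K Ki s g a b.
Proof.
intros LK hab hs h x y hx hy. apply Rle_trans with (1 := h x y).
assert (p := K_pos K Ki LK a b hab).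
replace (N * Rabs (K x - K y)) with
  (N * (K b - K a) * (Rabs (K x - K y) / (K b - K a))) by (field; lra).
apply Rmult_le_compat_r; auto. apply Rdiv_le_0_compat; auto. apply Rabs_pos.
Qed.

(** [m] is the depth of [a, b]. The word length relates depth to distances along a geodesic, the
    bounds by [C * q ^ m] serve to sum lengths, and the last inequality forces short intervals to be
    deep. *)
Definition blowup (Q r1 r2 : R) (Lw : nat) (C q M a b : R) (m : nat) (E : R -> R) : Prop :=
  Gm E /\ word A (Lw * m) E /\ r1 <= E b - E a <= r2 /\ distortion2 H Hi Q E a b /\
  b - a <= C * q ^ m /\ H b - H a <= C * q ^ m /\ r1 <= M ^ m * (b - a).

(** Apply expanding elements until the length exceeds [r1]. Read backwards from the end, the lengths
    decrease geometrically, on the conjugate line thanks to [geometric_modulus]; the distortions of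
    the steps therefore have a bounded sum. *)
Lemma blowup_exists : exists Q r1 r2 Lw C q M, 0 <= Q /\ 0 < r1 <= r2 /\
  0 < C /\ 0 < q < 1 /\ 1 <= M /\
  forall a b, a < b -> b - a <= r1 -> exists m E, blowup Q r1 r2 Lw C q M a b m E.
Proof.
destruct EX as (hmu & hrho & hexp).
destruct (ln_dv_lipschitz X GX) as [N [hN hlip]].
destruct (words_bounded X GX) as [Lw hLw].
set (M := exp N). assert (hM : 1 < M) by (unfold M; rewrite <- exp_0; apply exp_increasing; lra).
assert (hbd : forall e, In e X -> forall y, dv ids ids e y <= M).
{ intros e he. apply (dv_le_exp ids ids ids_line_homeo); try lra.
  - apply (lg_deg _ GG); auto.
  - apply (SM e (GX e he)).
  - intros x y; apply hlip; auto. }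
(* One step multiplies lengths by at most [M]: an interval of length at most [r1] has an image of
   length at most [rho]. *)
set (r1 := rho / M).
assert (hr1 : 0 < r1) by (apply Rdiv_lt_0_compat; lra).
assert (hr1' : M * r1 = rho) by (unfold r1; field; lra).
assert (hmui : 0 < / mu < 1).
{ split; [apply Rinv_0_lt_compat; lra|]. rewrite <- Rinv_1. apply Rinv_lt_contravar; lra. }
destruct (HOL (/ mu) rho hmui hrho) as (q1 & C1 & hq1 & hC1 & hol).
set (q := Rmax (/ mu) q1). set (C := Rmax rho C1).
assert (hq : 0 < q < 1).
{ unfold q. split; [apply Rlt_le_trans with (/ mu); [lra|apply Rmax_l]|].
  apply Rmax_lub_lt; lra. }
assert (hC : 0 < C) by (apply Rlt_le_trans with rho; [lra|apply Rmax_l]).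
assert (hlen : forall m a b, a <= b -> mu ^ m * (b - a) <= rho ->
  b - a <= C * q ^ m /\ H b - H a <= C * q ^ m).
{ intros m a b hab h.
  assert (pm := pow_lt mu m ltac:(lra)).
  assert (h' : b - a <= rho * (/ mu) ^ m).
  { rewrite pow_inv. apply Rle_div_r; auto. lra. }
  assert (g1 : (/ mu) ^ m <= q ^ m) by (apply pow_incr; split; [lra|apply Rmax_l]).
  assert (g2 : q1 ^ m <= q ^ m) by (apply pow_incr; split; [lra|apply Rmax_r]).
  assert (g3 := pow_lt (/ mu) m ltac:(lra)). assert (g4 := pow_lt q1 m ltac:(lra)).
  assert (rho <= C) by apply Rmax_l. assert (C1 <= C) by apply Rmax_r.
  split.
  - apply Rle_trans with (1 := h'). apply Rmult_le_compat; lra.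
  - apply Rle_trans with (1 := hol m a b hab h'). apply Rmult_le_compat; lra. }
set (T := N * C / (1 - q)).
assert (hT : 0 < T) by (unfold T; apply Rdiv_lt_0_compat; nra).
(* The sum of [N * C * q ^ j] over j <= m. The form [S_ m * exp (S_ m)] of the distortion bound is
   stable under one more step of distortion [s], as [s + S * exp S * exp s <= (S + s) * exp (S +
   s)]. *)
set (S_ := fun m => T * (1 - q ^ S m)).
assert (hS : forall m, 0 <= S_ m <= T).
{ intro m. unfold S_. assert (p := pow_lt q (S m) ltac:(lra)).
  assert (q ^ S m <= 1) by (rewrite <- (pow1 (S m)); apply pow_incr; lra). nra. }
assert (hSS : forall m, S_ (S m) = S_ m + N * (C * q ^ S m)).
{ intro m. unfold S_, T. simpl. field; lra. }
assert (hS1 : N * (C * q ^ 1) <= S_ 1%nat).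
{ rewrite hSS. generalize (hS 0%nat); lra. }
assert (step : forall n a b, a < b -> b - a <= r1 -> r1 < mu ^ n * (b - a) ->
  exists m E, Gm E /\ word A (Lw * m) E /\ r1 <= E b - E a <= rho /\
   mu ^ m * (b - a) <= rho /\ r1 <= M ^ m * (b - a) /\
   distortion2 H Hi (S_ m * exp (S_ m)) E a b).
{ induction n as [|n IH]; intros a b hab hr hn; [simpl in hn; lra|].
  destruct (hexp a) as [e [he hme]].
  assert (Ge := GX e he). destruct (SM e Ge) as [se sh].
  destruct (dv_mvt ids ids ids_line_homeo e a b se ltac:(lra)) as [c [hc ec]].
  change (e b - e a = dv ids ids e c * (b - a)) in ec.
  assert (r1 <= rho) by nra.
  assert (b1 := hme c ltac:(lra)). assert (b2 := hbd e he c).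
  set (D := dv ids ids e c) in *.
  assert (hDpos : mu * (b - a) <= D * (b - a)) by (apply Rmult_le_compat_r; lra).
  assert (hDM : D * (b - a) <= M * (b - a)) by (apply Rmult_le_compat_r; lra).
  destruct (Rlt_le_dec r1 (e b - e a)) as [hbig|hsm].
  - exists 1%nat, e. rewrite Nat.mul_1_r, !pow_1.
    assert (hmm : mu * (b - a) <= rho) by nra.
    destruct (hlen 1%nat a b ltac:(lra) ltac:(rewrite pow_1; lra)) as [l1 l2].
    assert (hE := exp_ineq1_le (S_ 1%nat)). assert (hS1' := hS 1%nat).
    assert (hfin : N * (C * q ^ 1) <= S_ 1%nat * exp (S_ 1%nat)) by nra.
    repeat split; auto; try lra; try nra.
    + apply (distortion_single ids ids N); auto; [apply ids_line_homeo| |apply hlip; auto].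
      apply Rle_trans with (N * (C * q ^ 1)); auto.
      apply Rmult_le_compat_l; [lra|]. exact l1.
    + apply (distortion_single H Hi N); auto; [|apply hlip; auto].
      apply Rle_trans with (N * (C * q ^ 1)); auto.
      apply Rmult_le_compat_l; [lra|]. exact l2.
  - assert (de := lg_deg _ GG e Ge).
    destruct (IH (e a) (e b)) as (m & E & GE & WE & rE & mE & ME & BE1 & BE2); auto.
    { now apply de. }
    { rewrite ec. apply Rlt_le_trans with (1 := hn). simpl.
      assert (p := pow_lt mu n ltac:(lra)).
      replace (mu * mu ^ n * (b - a)) with (mu ^ n * (mu * (b - a))) by ring.
      apply Rmult_le_compat_l; lra. }
    exists (S m), (fun x => E (e x)).
    assert (pm := pow_lt mu m ltac:(lra)). assert (pM := pow_lt M m ltac:(lra)).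
    assert (hmu' : mu ^ S m * (b - a) <= rho).
    { simpl. replace (mu * mu ^ m * (b - a)) with (mu ^ m * (mu * (b - a))) by ring.
      apply Rle_trans with (2 := mE). apply Rmult_le_compat_l; lra. }
    destruct (hlen (S m) a b ltac:(lra) hmu') as [l1 l2].
    set (s := N * (C * q ^ S m)).
    assert (hs : 0 <= s).
    { unfold s. assert (p := pow_lt q (S m) ltac:(lra)). apply Rmult_le_pos; nra. }
    assert (hSm := hS m).
    assert (hexps := exp_pos (S_ m)).
    assert (fin : s + S_ m * exp (S_ m) * exp s <= S_ (S m) * exp (S_ (S m))).
    { rewrite hSS. fold s. rewrite exp_plus. assert (1 <= exp s) by (generalize (exp_ineq1_le s); lra).
      assert (1 <= exp (S_ m)) by (generalize (exp_ineq1_le (S_ m)); lra).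
      assert (1 <= exp (S_ m) * exp s) by nra. nra. }
    destruct (SM E GE) as [sE shE].
    split; [|split; [|split; [|split; [|split]]]]; auto.
    + apply (lg_comp _ GG E e); auto.
    + replace (Lw * S m)%nat with (Lw + Lw * m)%nat by lia.
      apply (word_comp A (Lw * m) Lw E e); auto. now apply (lg_deg _ GG).
    + simpl. replace (M * M ^ m * (b - a)) with (M ^ m * (M * (b - a))) by ring.
      apply Rle_trans with (1 := ME). apply Rmult_le_compat_l; lra.
    + assert (hQ' : 0 <= S_ m * exp (S_ m)) by nra. split.
      * apply (distortion_weaken ids ids ids_line_homeo (s + S_ m * exp (S_ m) * exp s)); auto.
        apply (distortion_comp ids ids ids_line_homeo s (S_ m * exp (S_ m)) E e); auto.
        apply (distortion_single ids ids N); auto; [apply ids_line_homeo| |apply hlip; auto].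
        apply Rmult_le_compat_l; [lra|exact l1].
      * apply (distortion_weaken H Hi LH (s + S_ m * exp (S_ m) * exp s)); auto.
        apply (distortion_comp H Hi LH s (S_ m * exp (S_ m)) E e); auto.
        apply (distortion_single H Hi N); auto; [|apply hlip; auto].
        apply Rmult_le_compat_l; [lra|exact l2]. }
exists (T * exp T), r1, rho, Lw, C, q, M.
assert (eT := exp_pos T).
split; [nra|]. split; [nra|]. do 3 (split; [lra|]).
intros a b hab hr.
destruct (pow_gt_any mu (r1 / (b - a)) hmu) as [n hn].
destruct (step n a b hab hr) as (m & E & GE & WE & rE & mE & ME & BE1 & BE2).
{ apply Rlt_div_l in hn; lra. }
exists m, E. destruct (hlen m a b ltac:(lra) mE) as [l1 l2].
assert (hw : S_ m * exp (S_ m) <= T * exp T).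
{ destruct (hS m) as [z1 z2]. apply Rmult_le_compat; auto.
  - apply Rlt_le, exp_pos.
  - destruct (Req_dec (S_ m) T) as [->|]; [lra|]. apply Rlt_le, exp_increasing; lra. }
repeat split; auto; try lra.
- now apply (distortion_weaken ids ids ids_line_homeo (S_ m * exp (S_ m))).
- now apply (distortion_weaken H Hi LH (S_ m * exp (S_ m))).
Qed.
End Telescoping.

(** * From C^0- to bilateral C^1-non-discreteness *)

(* The constant of [distortion_quotient] with both arguments equal to the distortion of
   a blow-up (Q) after a prefix (1). *)
Definition quotient_bound (Q : R) : R :=
  let Z := 1 + Q * exp 1 in Z * exp Z + Z * exp (Z * exp Z).

Section Nondiscreteness.
Variables (Gm : (R -> R) -> Prop) (A X : list (R -> R)) (H Hi : R -> R) (mu rho : R).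
Hypothesis GG : lift_group Gm.
Hypothesis GA : generating Gm A.
Hypothesis LH : line_homeo H Hi.
Hypothesis SM : forall g, Gm g -> log_lipschitz ids ids g /\ log_lipschitz H Hi g.
Hypothesis GX : forall e, In e X -> Gm e.
Hypothesis EX : expanding X ids ids mu rho.
Hypothesis HOL : geometric_modulus H.

Lemma distortion_eqZ (K Ki : R -> R) (Q : R) (f g : R -> R) (a b : R) : line_homeo K Ki ->
  eqZ f g -> distortion K Ki Q g a b -> distortion K Ki Q f a b.
Proof.
intros LK [k e] h x y hx hy.
assert (ed : forall z, dv K Ki f z = dv K Ki g z).
{ intro z.
  replace f with (fun t => g (t + IZR 0) + IZR k).
  - rewrite dv_shift by exact LK. f_equal. simpl; ring.
  - apply functional_extensionality; intro t. rewrite Rplus_0_r. now rewrite e. }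
rewrite !ed. now apply h.
Qed.

Section Pieces.
Variables (N Q r1 r2 C q M : R) (Lw : nat).
Hypothesis hN : 1 <= N.
Hypothesis hlip : forall g, In g A -> forall x y,
    Rabs (ln (dv ids ids g x) - ln (dv ids ids g y)) <= N * Rabs (ids x - ids y) /\
    Rabs (ln (dv H Hi g x) - ln (dv H Hi g y)) <= N * Rabs (H x - H y).
Hypothesis hQ : 0 <= Q.
Hypothesis hr : 0 < r1 <= r2.
Hypothesis hC : 0 < C.
Hypothesis hq : 0 < q < 1.
Hypothesis hM : 1 <= M.
Hypothesis hblow : forall a b, a < b -> b - a <= r1 ->
  exists m E, blowup Gm A H Hi Q r1 r2 Lw C q M a b m E.
Variable LB : nat.
Hypothesis hLB : forall b x x', Gm b -> r1 <= x' - x <= r2 -> r1 <= b x' - b x <= r2 ->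
  distortion2 H Hi (quotient_bound Q)
    b x x' -> word A LB b.

Variable s : nat -> R -> R.
Hypothesis hs : forall i, In (s i) A.

Lemma traj_Gm (i : nat) : Gm (traj s i).
Proof. apply (traj_in Gm A GG GA); auto. Qed.

(** Denjoy's argument: each letter adds at most [N] times the length of the interval on which it
    acts. While the total stays at most 1, the exponential factor of [distortion_comp] is at most
    [exp 1 <= 3], the 3 of the statement. *)
Lemma traj_sum_distortion (K Ki : R -> R) (a b : R) : line_homeo K Ki -> a < b ->
  (forall g, Gm g -> log_lipschitz K Ki g) ->
  (forall g, In g A -> forall x y,
     Rabs (ln (dv K Ki g x) - ln (dv K Ki g y)) <= N * Rabs (K x - K y)) ->
  forall i, 3 * N * psum (fun k => K (traj s k b) - K (traj s k a)) i <= 1 ->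
  distortion K Ki (3 * N * psum (fun k => K (traj s k b) - K (traj s k a)) i) (traj s i) a b.
Proof.
intros LK hab SK lK.
set (f := fun k => K (traj s k b) - K (traj s k a)).
assert (hf : forall k, 0 <= f k).
{ intro k. apply Rlt_le, (K_pos K Ki LK). now apply (lg_deg _ GG _ (traj_Gm k)). }
induction i as [|i IH]; intro h.
- simpl psum. rewrite Rmult_0_r. intros x y hx hy.
  change (traj s 0) with (fun x : R => x). rewrite !(dv_id K Ki LK).
  rewrite Rminus_diag, Rabs_R0; lra.
- simpl psum in *.
  assert (hp := psum_pos f i hf). assert (hfi := hf i).
  assert (hV : 3 * N * psum f i <= 1) by nra.
  specialize (IH hV).
  apply (distortion_weaken K Ki LK (3 * N * psum f i + N * f i * exp (3 * N * psum f i))); auto.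
  { assert (exp (3 * N * psum f i) <= 3).
    { apply Rle_trans with (exp 1); [|apply exp_le_3].
      destruct (Req_dec (3 * N * psum f i) 1) as [->|]; [lra|].
      apply Rlt_le, exp_increasing; lra. }
    assert (0 <= N * f i) by nra. nra. }
  apply (distortion_comp K Ki LK (3 * N * psum f i) (N * f i) (s i) (traj s i)); auto; try nra.
  + apply (lg_deg _ GG), traj_Gm.
  + apply SK, (gn_in _ _ GA), hs.
  + apply SK, traj_Gm.
  + apply (distortion_single K Ki N); auto.
    * apply (lg_deg _ GG _ (traj_Gm i)); auto.
    * unfold f; lra.
Qed.

Lemma distortion_quotient (K Ki Pi Pj Pii t b0 : R -> R) (Q1 Q2 : R) (a b : R) :
  line_homeo K Ki -> 0 <= Q1 -> 0 <= Q2 -> a < b ->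
  deg1 Pi -> deg1 Pii -> log_lipschitz K Ki Pi -> log_lipschitz K Ki Pj -> log_lipschitz K Ki Pii ->
  (forall x, Pii (Pi x) = x) -> (forall x, Pi (Pii x) = x) ->
  (forall x, b0 x = Pj (Pii x)) ->
  distortion K Ki Q1 Pi a b -> distortion K Ki Q2 Pj a b ->
  distortion K Ki (Q1 * exp Q1 + Q2 * exp (Q1 * exp Q1)) b0 (Pi a) (Pi b).
Proof.
intros LK h1 h2 hab dPi dPii si sj sii e e' eb B1 B2.
replace b0 with (fun x => Pj (Pii x)).
2:{ apply functional_extensionality; intro; now rewrite eb. }
assert (hp := exp_pos Q1).
apply (distortion_comp K Ki LK (Q1 * exp Q1) Q2 Pj Pii); auto; try nra.
- now apply dPi.
- apply (distortion_inv K Ki LK Q1 Pi Pii a b); auto.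
- now rewrite !e.
Qed.

(* Two prefixes of a geodesic word that both have small distortion on [a, b]
   differ, up to the two blow-ups, by an element of bounded distortion at
   macroscopic scale; its word length is bounded by assumption. *)
Lemma traj_link (n : nat) (a b : R) :
  (forall i j k t, (i <= j <= n)%nat -> Gm t -> word A k t ->
    (forall x, traj s j x = t (traj s i x)) -> (j <= i + k)%nat) ->
  a < b -> forall i j mi mj Ei Ej, (i <= j <= n)%nat ->
  distortion2 H Hi 1 (traj s i) a b -> distortion2 H Hi 1 (traj s j) a b ->
  blowup Gm A H Hi Q r1 r2 Lw C q M (traj s i a) (traj s i b) mi Ei ->
  blowup Gm A H Hi Q r1 r2 Lw C q M (traj s j a) (traj s j b) mj Ej ->
  (j <= i + (Lw * mi + LB + Lw * mj))%nat.
Proof.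
intros hgeo hab i j mi mj Ei Ej hij Bi Bj
  (GEi & WEi & rEi & BEi & _) (GEj & WEj & rEj & BEj & _).
set (t := traj (fun k => s (i + k)%nat) (j - i)).
assert (et : forall x, traj s j x = t (traj s i x)).
{ intro x. replace j with (i + (j - i))%nat at 1 by lia. now rewrite traj_add. }
assert (Gt : Gm t) by (apply (traj_in Gm A GG GA); auto).
destruct (lg_inv _ GG Ei GEi) as (Eii & GEii & e1 & e2).
destruct (lg_inv _ GG Ej GEj) as (Eji & GEji & f1 & f2).
assert (Gi := traj_Gm i). assert (Gj := traj_Gm j).
destruct (lg_inv _ GG _ Gi) as (ti & Gti & g1 & g2).
set (b0 := fun x => Ej (t (Eii x))).
assert (Gtc : Gm (fun x => t (Eii x))) by (apply (lg_comp _ GG t); auto).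
assert (Gb0 : Gm b0) by (apply (lg_comp _ GG Ej (fun x => t (Eii x))); auto).
set (Pi := fun x => Ei (traj s i x)). set (Pj := fun x => Ej (traj s j x)).
set (Pii := fun x => ti (Eii x)).
assert (GPi : Gm Pi) by (apply (lg_comp _ GG Ei); auto).
assert (GPj : Gm Pj) by (apply (lg_comp _ GG Ej); auto).
assert (GPii : Gm Pii) by (apply (lg_comp _ GG ti); auto).
assert (p1 : forall x, Pii (Pi x) = x) by (intro x; unfold Pii, Pi; now rewrite e2, g2).
assert (p2 : forall x, Pi (Pii x) = x) by (intro x; unfold Pii, Pi; now rewrite g1, e1).
assert (eb : forall x, b0 x = Pj (Pii x)).
{ intro x. unfold b0, Pj, Pii. now rewrite et, g1. }
assert (hQ1 : 0 <= 1 + Q * exp 1) by (generalize (exp_pos 1); nra).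
assert (hW : word A LB b0).
{ apply (hLB b0 (Pi a) (Pi b)); auto.
  - rewrite !eb, !p1. exact rEj.
  - destruct Bi as [Bi1 Bi2]. destruct Bj as [Bj1 Bj2].
    destruct BEi as [BEi1 BEi2]. destruct BEj as [BEj1 BEj2].
    assert (main : forall K Ki, line_homeo K Ki -> (forall g, Gm g -> log_lipschitz K Ki g) ->
      distortion K Ki 1 (traj s i) a b -> distortion K Ki 1 (traj s j) a b ->
      distortion K Ki Q Ei (traj s i a) (traj s i b) -> distortion K Ki Q Ej (traj s j a) (traj s j b) ->
      distortion K Ki (quotient_bound Q) b0 (Pi a) (Pi b)).
    { intros K Ki LK SK c1 c2 c3 c4.
      apply (distortion_quotient K Ki Pi Pj Pii t b0 (1 + Q * exp 1) (1 + Q * exp 1)); auto.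
      - apply (lg_deg _ GG), GPi.
      - apply (lg_deg _ GG), GPii.
      - apply (distortion_comp K Ki LK 1 Q Ei (traj s i)); auto; try lra. apply (lg_deg _ GG), Gi.
      - apply (distortion_comp K Ki LK 1 Q Ej (traj s j)); auto; try lra. apply (lg_deg _ GG), Gj. }
    split; apply main; auto; try apply ids_line_homeo; intros g Hg; apply (SM g Hg). }
(* [t] is [Eji o b0 o Ei], where [Eji] inverts [Ej]; the three factors have word lengths [Lw * mj],
   [LB] and [Lw * mi]. *)
apply (hgeo i j _ t hij Gt); auto.
assert (Gbe : Gm (fun x => b0 (Ei x))) by (apply (lg_comp _ GG b0); auto).
replace t with (fun x => Eji (b0 (Ei x))).
2:{ apply functional_extensionality; intro x. unfold b0. now rewrite e2, f2. }
apply (word_comp A (Lw * mj) (Lw * mi + LB) Eji (fun x => b0 (Ei x))).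
- now apply (lg_deg _ GG).
- apply (word_inv Gm A GG GA (Lw * mj) Ej Eji); auto.
- apply (word_comp A LB (Lw * mi) b0 Ei); auto. now apply (lg_deg _ GG).
Qed.

(** [u] converts decay in the depth into decay in the word distance. Depth at least [ms] makes the
    sum of all lengths so small that the total distortion is at most 1, and intervals of length at
    most [6 * rs] have such a depth. *)
Variables (u : R) (L ms : nat) (rs : R).
Hypothesis hu : 0 < u < 1.
Hypothesis hL : (1 <= L)%nat.
Hypothesis hLL : (Lw <= L)%nat /\ (LB <= L)%nat.
Hypothesis huq : u ^ (4 * L) = q.
Hypothesis hms : 3 * N * (C * (u ^ (2 * L * ms) * (2 / (u ^ L * (1 - u))))) <= 1.
Hypothesis hrs : 0 < rs.
Hypothesis hrs1 : 6 * rs * M ^ ms < r1.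

(** A bootstrap along the prefixes. While the distortion is at most 1, the images of the interval
    are short, hence of depth at least [ms], and [traj_link] separates their indices; [psum_depth]
    then bounds the sum of lengths, next term included, by a constant independent of [i], which
    keeps the distortion at most 1. *)
Lemma telescoping (n : nat) (y r : R) :
  (forall i j k t, (i <= j <= n)%nat -> Gm t -> word A k t ->
    (forall x, traj s j x = t (traj s i x)) -> (j <= i + k)%nat) ->
  0 < r -> (forall i, (i <= n)%nat -> dv ids ids (traj s i) y * r <= rs) ->
  forall i, (i <= n)%nat -> distortion2 H Hi 1 (traj s i) (y - r) (y + r).
Proof.
intros hgeo hr0 hd.
set (a := y - r) in *. set (b := y + r) in *. assert (hab : a < b) by (unfold a, b; lra).
set (V := fun (K : R -> R) i => 3 * N * psum (fun k => K (traj s k b) - K (traj s k a)) i).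
assert (posV : forall K Ki, line_homeo K Ki -> forall k, 0 <= K (traj s k b) - K (traj s k a)).
{ intros K Ki LK k. apply Rlt_le, (K_pos K Ki LK). now apply (lg_deg _ GG _ (traj_Gm k)). }
assert (VBD : forall i, V ids i <= 1 -> V H i <= 1 -> forall k, (k <= i)%nat ->
  distortion2 H Hi 1 (traj s k) a b).
{ intros i h1 h2 k hk.
  assert (w1 : V ids k <= 1).
  { apply Rle_trans with (2 := h1). apply Rmult_le_compat_l; [lra|].
    apply psum_mono; auto. apply (posV ids ids ids_line_homeo). }
  assert (w2 : V H k <= 1).
  { apply Rle_trans with (2 := h2). apply Rmult_le_compat_l; [lra|].
    apply psum_mono; auto. apply (posV H Hi LH). }
  split.
  - apply (distortion_weaken ids ids ids_line_homeo (V ids k)); auto.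
    apply (traj_sum_distortion ids ids); auto; [apply ids_line_homeo|intros g Hg; apply (SM g Hg)|].
    intros g hg x z. apply (hlip g hg).
  - apply (distortion_weaken H Hi LH (V H k)); auto.
    apply (traj_sum_distortion H Hi); auto; [intros g Hg; apply (SM g Hg)|].
    intros g hg x z. apply (hlip g hg). }
assert (main : forall i, (i <= n)%nat -> V ids i <= 1 /\ V H i <= 1).
{ induction i as [|i IH]; intro hi.
  - unfold V; simpl; lra.
  - destruct (IH ltac:(lia)) as [v1 v2].
    assert (B := VBD i v1 v2).
    (* 6 is twice the bound 3 of [exp 1], as the interval has length [2 * r]. *)
    assert (hlen : forall k, (k <= i)%nat -> traj s k b - traj s k a <= 6 * rs).
    { intros k hk. destruct (SM _ (traj_Gm k)) as [sk _].
      destruct (distortion_len ids ids ids_line_homeo 1 (traj s k) a b y ltac:(lra) hab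
        ltac:(unfold a, b; lra) sk (proj1 (B k hk))) as [l1 _].
      change (traj s k b - traj s k a <= exp 1 * dv ids ids (traj s k) y * (b - a)) in l1.
      apply Rle_trans with (1 := l1).
      specialize (hd k ltac:(lia)).
      assert (p := proj1 (proj2 sk) y). assert (e3 := exp_le_3). assert (e0 := exp_pos 1).
      replace (exp 1 * dv ids ids (traj s k) y * (b - a)) with
        (2 * (exp 1 * (dv ids ids (traj s k) y * r))) by (unfold a, b; ring).
      assert (0 <= dv ids ids (traj s k) y * r) by nra. nra. }
    assert (pM : 1 <= M ^ ms) by (apply pow_R1_Rle; lra).
    assert (hbl : forall k, exists mE, (k <= i)%nat ->
      blowup Gm A H Hi Q r1 r2 Lw C q M (traj s k a) (traj s k b) (fst mE) (snd mE)).
    { intro k. destruct (le_lt_dec k i) as [c|c].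
      - destruct (hblow (traj s k a) (traj s k b)) as (m & E & hb).
        + now apply (lg_deg _ GG _ (traj_Gm k)).
        + specialize (hlen k c). nra.
        + exists (m, E); auto.
      - exists (0%nat, ids). lia. }
    apply choice_fun in hbl. destruct hbl as [mE hmE].
    set (m := fun k => fst (mE k)).
    assert (hlink : forall k l, (k <= l < S i)%nat -> (l <= k + L * (m k + m l + 1))%nat).
    { intros k l hkl.
      assert (z := traj_link n a b hgeo hab k l (m k) (m l) (snd (mE k)) (snd (mE l))
        ltac:(lia) (B k ltac:(lia)) (B l ltac:(lia)) (hmE k ltac:(lia)) (hmE l ltac:(lia))).
      destruct hLL as [z1 z2].
      assert (Lw * m k <= L * m k)%nat by (apply Nat.mul_le_mono_r; auto).
      assert (Lw * m l <= L * m l)%nat by (apply Nat.mul_le_mono_r; auto).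
      lia. }
    assert (hmin : forall k, (k < S i)%nat -> (ms <= m k)%nat).
    { intros k hk. destruct (hmE k ltac:(lia)) as (_ & _ & _ & _ & _ & _ & hz).
      specialize (hlen k ltac:(lia)).
      destruct (le_lt_dec ms (m k)) as [c|c]; auto. exfalso.
      assert (M ^ m k <= M ^ ms) by (apply Rle_pow; [lra|lia]).
      assert (0 < M ^ m k) by (apply pow_lt; lra).
      fold (m k) in hz.
      assert (M ^ m k * (traj s k b - traj s k a) <= M ^ ms * (6 * rs)).
      { assert (z := posV ids ids ids_line_homeo k). unfold ids in z.
        apply Rmult_le_compat; lra. }
      nra. }
    assert (hsum := psum_depth u L ms (S i) m hu hL hlink hmin).
    rewrite huq in hsum.
    assert (final : forall K, (forall k, (k < S i)%nat ->
       K (traj s k b) - K (traj s k a) <= C * q ^ m k) -> V K (S i) <= 1).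
    { intros K hK. unfold V. apply Rle_trans with (2 := hms).
      apply Rmult_le_compat_l; [lra|].
      apply Rle_trans with (psum (fun k => C * q ^ m k) (S i)).
      - now apply psum_le.
      - rewrite psum_scal. apply Rmult_le_compat_l; lra. }
    split; apply final; intros k hk; destruct (hmE k ltac:(lia)) as (_ & _ & _ & _ & z1 & z2 & _);
      assumption. }
intros i hi. destruct (main i hi) as [v1 v2]. now apply (VBD i).
Qed.
End Pieces.

(** The mean value theorem is applied to the weighted sum, so that one point [y] serves all the maps
    at once. *)
Lemma psum_mvt (g : nat -> R -> R) (w : nat -> R) (n : nat) (a b : R) : a < b ->
  (forall k, log_lipschitz ids ids (g k)) -> exists y, a <= y <= b /\
  psum (fun k => w k * (g k b - g k a)) n =
  psum (fun k => w k * dv ids ids (g k) y) n * (b - a).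
Proof.
intros hab hg.
assert (hder : forall n x, is_derive (fun y => psum (fun k => w k * g k y) n) x
  (psum (fun k => w k * dv ids ids (g k) x) n)).
{ induction n0 as [|n0 IH]; intro x; simpl.
  - apply (is_derive_const 0 x).
  - apply (is_derive_plus (fun y => psum (fun k => w k * g k y) n0)
      (fun y => w n0 * g n0 y)); auto.
    apply is_derive_scal. apply (Derive_correct (g n0)). apply (proj1 (hg n0)). }
destruct (MVT_gen (fun y => psum (fun k => w k * g k y) n) a b
  (fun x => psum (fun k => w k * dv ids ids (g k) x) n)) as [y [hy e]].
- intros; apply hder.
- intros x _. apply continuity_pt_filterlim.
  apply (ex_derive_continuous (fun y => psum (fun k => w k * g k y) n)).
  eexists; apply hder.
- rewrite Rmin_left, Rmax_right in hy by lra.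
  exists y. split; auto. rewrite <- e.
  clear. induction n as [|n IH]; simpl; [ring|]. rewrite IH; ring.
Qed.

Lemma traj_dv_bound (s : nat -> R -> R) (MA : R) (y : R) : 1 <= MA ->
  (forall i, In (s i) A) -> (forall g, In g A -> forall y, dv ids ids g y <= MA) ->
  forall i, 0 < dv ids ids (traj s i) y <= MA ^ i.
Proof.
intros h1 hs hb. induction i as [|i IH].
- change (traj s 0) with (fun x : R => x). rewrite (dv_id ids ids ids_line_homeo). simpl; lra.
- simpl traj.
  assert (G1 := gn_in _ _ GA (s i) (hs i)).
  assert (G2 : Gm (traj s i)) by (apply (traj_in Gm A GG GA); auto).
  destruct (SM _ G1) as [s1 _]. destruct (SM _ G2) as [s2 _].
  rewrite (dv_comp ids ids ids_line_homeo (s i) (traj s i)) by auto.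
  assert (p := proj1 (proj2 s1) (traj s i y)).
  assert (q := hb (s i) (hs i) (traj s i y)). simpl.
  split; [apply Rmult_lt_0_compat; lra|]. apply Rmult_le_compat; lra.
Qed.

(* The point y is chosen so that no long prefix of a geodesic word for g
   expands more at y than all shorter ones: in a discrete group an expansion
   maximal at the j-th prefix is exponentially large in j, while the mean over
   an interval of each derivative is bounded. *)
Lemma uniform_distortion (a1 w : R) : ~ C1_nondiscrete Gm H Hi -> 0 < w <= 1 ->
  exists R0, 0 < R0 <= w /\ forall g, Gm g ->
    exists y, a1 <= y <= a1 + w /\ distortion2 H Hi 1 g (y - R0) (y + R0).
Proof.
intros ND hw.
destruct (ln_dv_lipschitz Gm H Hi SM A (gn_in _ _ GA)) as [N [hN hlip]].
destruct (blowup_exists Gm A X H Hi mu rho GG GA LH SM GX EX HOL)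
  as (Q & r1 & r2 & Lw & C & q & M & hQ & hr & hC & hq & hM & hblow).
assert (hqb : 0 <= quotient_bound Q).
{ unfold quotient_bound. set (Z := 1 + Q * exp 1).
  assert (0 <= Z) by (unfold Z; generalize (exp_pos 1); nra).
  assert (z1 := exp_pos Z). assert (z2 := exp_pos (Z * exp Z)). nra. }
destruct (bounded_family_word Gm A H Hi GG GA LH SM ND (quotient_bound Q) r1 r2 hqb
  (proj1 hr)) as [LB hLB].
set (MA := exp N). assert (hMA : 1 <= MA) by (unfold MA; generalize (exp_ineq1_le N); lra).
assert (hbA : forall g, In g A -> forall y, dv ids ids g y <= MA).
{ intros g hg. assert (Gg := gn_in _ _ GA g hg).
  apply (dv_le_exp ids ids ids_line_homeo); try lra.
  - now apply (lg_deg _ GG).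
  - apply (SM g Gg).
  - intros x y; apply hlip; auto. }
set (L := (1 + Lw + LB)%nat).
destruct (root_exists q (4 * L) hq ltac:(unfold L; lia)) as [u [hu huq]].
set (T := 3 * N * (C * (2 / (u ^ L * (1 - u))))).
assert (hT : 0 < T).
{ unfold T. assert (p := pow_lt u L ltac:(lra)).
  assert (0 < u ^ L * (1 - u)) by (apply Rmult_lt_0_compat; lra).
  repeat apply Rmult_lt_0_compat; try lra. now apply Rinv_0_lt_compat. }
destruct (pow_lt_any u (/ T) hu ltac:(now apply Rinv_0_lt_compat)) as [ms hms0].
assert (hms : 3 * N * (C * (u ^ (2 * L * ms) * (2 / (u ^ L * (1 - u))))) <= 1).
{ replace (3 * N * (C * (u ^ (2 * L * ms) * (2 / (u ^ L * (1 - u))))))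
    with (u ^ (2 * L * ms) * T) by (unfold T; ring).
  assert (u ^ (2 * L * ms) <= u ^ ms).
  { apply pow_antitone; auto. unfold L; nia. }
  assert (u ^ (2 * L * ms) * T <= / T * T) by (apply Rmult_le_compat_r; lra).
  rewrite Rinv_l in *; lra. }
assert (pMs := pow_lt M ms ltac:(lra)).
set (rs := r1 / (7 * M ^ ms)).
assert (hrs : 0 < rs) by (apply Rdiv_lt_0_compat; lra).
assert (hrs1 : 6 * rs * M ^ ms < r1).
{ unfold rs. replace (6 * (r1 / (7 * M ^ ms)) * M ^ ms) with (6 / 7 * r1) by (field; lra). lra. }
assert (TEL := fun s hs => telescoping N Q r1 r2 C q M Lw hN hlip
  hQ hC hq hM hblow LB hLB s hs u L ms rs hu ltac:(unfold L; lia)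
  ltac:(unfold L; lia) huq hms hrs hrs1).
assert (LINK := fun s hs => traj_link Q r1 r2 C q M Lw hQ hq LB hLB s hs).
(* An interval of length more than [rs / 2] has depth at most [mmax]. *)
destruct (pow_lt_any q (rs / 2 / C) hq ltac:(apply Rdiv_lt_0_compat; lra)) as [mmax hmmax].
set (B0 := (LB + Lw * mmax)%nat).
set (c0 := 2 * rs * u ^ B0 / C).
assert (pB0 := pow_lt u B0 ltac:(lra)).
assert (hc0 : 0 < c0) by (unfold c0; apply Rdiv_lt_0_compat; nra).
(* With this [j1], the weights [u ^ (j1 + k) / c0] used below have sum less than [w]. *)
destruct (pow_lt_any u (w * c0 * (1 - u)) hu) as [j1 hj1].
{ apply Rmult_lt_0_compat; nra. }
assert (pMA := pow_R1_Rle MA j1 hMA).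
(* At the chosen point the largest derivative of a prefix will occur before [j1], hence be at most
   [MA ^ j1]; this radius then meets the condition of [telescoping]. *)
exists (Rmin (rs / MA ^ j1) w).
assert (hR0 : 0 < Rmin (rs / MA ^ j1) w).
{ apply Rmin_pos; [apply Rdiv_lt_0_compat; lra|lra]. }
split; [split; auto; apply Rmin_r|].
intros g Hg.
destruct (geodesic Gm A GG GA (gn_all _ _ GA) g Hg) as (n & s & hs & eg & hgeo).
assert (hdv := fun y => traj_dv_bound s MA y hMA hs hbA).
assert (Gt : forall i, Gm (traj s i)) by (intro; apply (traj_in Gm A GG GA); auto).
(* At radius [r = rs / D] the j-th image is macroscopic, of depth at most [mmax], while the initial
   interval has a depth [m0] with [2 * r <= C * q ^ m0]. Linking the prefixes 0 and [j] gives
   [j <= Lw * m0 + B0], so that [D] is at least [c0 / u ^ j]. *)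
assert (big : forall y j, (j <= n)%nat ->
  (forall k, (k <= n)%nat -> dv ids ids (traj s k) y <= dv ids ids (traj s j) y) ->
  c0 <= u ^ j * dv ids ids (traj s j) y).
{ intros y j hj hmax.
  set (D := dv ids ids (traj s j) y) in *. assert (hD : 0 < D) by apply hdv.
  set (r := rs / D). assert (hr0 : 0 < r) by (apply Rdiv_lt_0_compat; auto).
  assert (hDr : D * r = rs) by (unfold r; field; lra).
  assert (Bd := TEL s hs n y r hgeo hr0).
  assert (Bd' : forall i, (i <= n)%nat -> distortion2 H Hi 1 (traj s i) (y - r) (y + r)).
  { apply Bd. intros i hi. rewrite <- hDr. apply Rmult_le_compat_r; [lra|auto]. }
  clear Bd.
  assert (hab : y - r < y + r) by lra.
  destruct (SM _ (Gt j)) as [sj _].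
  assert (e3 := exp_le_3). assert (e0 := exp_pos 1).
  destruct (distortion_len ids ids ids_line_homeo 1 (traj s j) (y - r) (y + r) y ltac:(lra) hab
        ltac:(lra) sj (proj1 (Bd' j hj))) as [l1 l2].
  change (traj s j (y + r) - traj s j (y - r) <= exp 1 * D * (y + r - (y - r))) in l1.
  change (D * (y + r - (y - r)) <= exp 1 * (traj s j (y + r) - traj s j (y - r))) in l2.
  replace (y + r - (y - r)) with (2 * r) in * by ring.
  assert (pM1 : 1 <= M ^ ms) by (apply pow_R1_Rle; lra).
  destruct (hblow (traj s j (y - r)) (traj s j (y + r))) as (mj & Ej & bj).
  { now apply (lg_deg _ GG _ (Gt j)). } { nra. }
  assert (hrr1 : 2 * r <= r1).
  { assert (z := hmax 0%nat ltac:(lia)). change (traj s 0) with (fun x : R => x) in z.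
    rewrite (dv_id ids ids ids_line_homeo) in z. nra. }
  destruct (hblow (y - r) (y + r)) as (m0 & E0 & b0); [lra|lra|].
  assert (hlink := LINK s hs n (y - r) (y + r) hgeo hab 0%nat j m0 mj E0 Ej ltac:(lia)
    (Bd' 0%nat ltac:(lia)) (Bd' j hj) b0 bj).
  destruct bj as (_ & _ & _ & _ & z1 & _). destruct b0 as (_ & _ & _ & _ & z2 & _).
  assert (hmj : (mj <= mmax)%nat).
  { destruct (le_lt_dec mj mmax) as [c|c]; auto. exfalso.
    assert (q ^ mj <= q ^ mmax) by (apply pow_antitone; auto; lia).
    apply (Rmult_lt_compat_r C) in hmmax; [|lra].
    replace (rs / 2 / C * C) with (rs / 2) in hmmax by (field; lra).
    assert (C * q ^ mj <= rs / 2) by nra. nra. }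
  assert (hj0 : (j <= Lw * m0 + B0)%nat).
  { unfold B0. assert (Lw * mj <= Lw * mmax)%nat by (apply Nat.mul_le_mono_l; auto). lia. }
  assert (hu1 : q ^ m0 * u ^ B0 <= u ^ j).
  { rewrite <- huq, <- pow_mult, <- pow_add. apply pow_antitone; auto.
    assert (Lw * m0 <= 4 * L * m0)%nat by (apply Nat.mul_le_mono_r; unfold L; lia). lia. }
  unfold c0. apply Rle_div_l; auto.
  assert (z3 : y + r - (y - r) <= C * q ^ m0) by exact z2.
  assert (z4 : 2 * rs <= C * q ^ m0 * D) by nra.
  apply Rle_trans with (C * q ^ m0 * D * u ^ B0).
  - apply Rmult_le_compat_r; lra.
  - replace (C * q ^ m0 * D * u ^ B0) with (q ^ m0 * u ^ B0 * (D * C)) by ring.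
    replace (u ^ j * D * C) with (u ^ j * (D * C)) by ring.
    apply Rmult_le_compat_r; nra. }
(* Each prefix maps an interval of length [w <= 1] to one of length at most 1. By the choice of [j1]
   the weighted sum of lengths is below [w], so the weighted sum of derivatives at [y] is below
   1. *)
destruct (psum_mvt (fun k => traj s (j1 + k)) (fun k => u ^ (j1 + k) / c0) (S n) a1 (a1 + w)
  ltac:(lra) (fun k => proj1 (SM _ (Gt (j1 + k)%nat)))) as [y [hy ey]].
exists y. split; auto.
assert (small : forall j, (j1 <= j <= n)%nat -> u ^ j * dv ids ids (traj s j) y < c0).
{ intros j hj.
  assert (t1 : psum (fun k => u ^ (j1 + k) / c0 * (traj s (j1 + k) (a1 + w) - traj s (j1 + k) a1)) (S n)
    <= u ^ j1 / c0 * / (1 - u)).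
  { apply Rle_trans with (psum (fun k => u ^ j1 / c0 * u ^ k) (S n)).
    - apply psum_le. intros k _. rewrite pow_add.
      assert (dk := lg_deg _ GG _ (Gt (j1 + k)%nat)).
      assert (traj s (j1 + k) (a1 + w) <= traj s (j1 + k) (a1 + 1)) by (apply deg1_le; auto; lra).
      rewrite (proj2 dk) in H0.
      assert (0 < u ^ j1 * u ^ k / c0).
      { apply Rdiv_lt_0_compat; auto. apply Rmult_lt_0_compat; apply pow_lt; lra. }
      replace (u ^ j1 / c0 * u ^ k) with (u ^ j1 * u ^ k / c0 * 1) by (field; lra).
      apply Rmult_le_compat_l; lra.
    - rewrite psum_scal. apply Rmult_le_compat_l; [|now apply psum_geom].
      apply Rlt_le, Rdiv_lt_0_compat; auto. apply pow_lt; lra. }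
  assert (t2 : u ^ j1 / c0 * / (1 - u) < w).
  { replace (u ^ j1 / c0 * / (1 - u)) with (u ^ j1 / (c0 * (1 - u))) by (field; lra).
    apply Rlt_div_l; nra. }
  rewrite ey in t1. replace (a1 + w - a1) with w in t1 by ring.
  set (F := fun k => u ^ (j1 + k) / c0 * dv ids ids (traj s (j1 + k)) y) in *.
  assert (hF : forall k, 0 <= F k).
  { intro k. unfold F. apply Rmult_le_pos.
    - apply Rlt_le, Rdiv_lt_0_compat; auto. apply pow_lt; lra.
    - apply Rlt_le, hdv. }
  assert (t3 := psum_term F (S n) (j - j1) hF ltac:(lia)).
  assert (t4 : psum F (S n) < 1) by nra.
  unfold F in t3 at 1. replace (j1 + (j - j1))%nat with j in t3 by lia.
  replace (u ^ j / c0 * dv ids ids (traj s j) y) with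
    (u ^ j * dv ids ids (traj s j) y / c0) in t3 by (field; lra).
  assert (t5 : u ^ j * dv ids ids (traj s j) y / c0 < 1) by lra.
  apply Rlt_div_l in t5; lra. }
destruct (argmax_exists (fun k => dv ids ids (traj s k) y) n) as [j [hj hmax]].
destruct (le_lt_dec j1 j) as [c|c].
{ exfalso. specialize (small j ltac:(lia)). specialize (big y j hj hmax). lra. }
assert (fin : distortion2 H Hi 1 (traj s n) (y - Rmin (rs / MA ^ j1) w) (y + Rmin (rs / MA ^ j1) w)).
{ apply (TEL s hs n y (Rmin (rs / MA ^ j1) w) hgeo hR0); auto.
  intros i hi. apply Rle_trans with (MA ^ j1 * (rs / MA ^ j1)).
  - apply Rmult_le_compat; try lra.
    + apply Rlt_le, hdv.
    + apply Rle_trans with (1 := hmax i hi). apply Rle_trans with (MA ^ j).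
      * apply hdv.
      * apply Rle_pow; auto; lia.
    + apply Rmin_l.
  - right; field; lra. }
split; [apply (distortion_eqZ ids ids 1 g (traj s n))|apply (distortion_eqZ H Hi 1 g (traj s n))];
  auto; try apply ids_line_homeo; apply fin.
Qed.

(** In a discrete group, each element has bounded distortion on an interval of fixed length, whose
    position depends on the element. It contains one of finitely many fixed pieces, on which
    C^0-smallness becomes C^1-smallness by interpolation. *)
Theorem C0_to_C1_nondiscrete (a0 b0 : R) : a0 < b0 ->
  (forall eta, 0 < eta -> exists g, Gm g /\ ~ eqZ g ids /\
    forall y, a0 <= y <= b0 -> Rabs (g y - y) <= eta) ->
  C1_nondiscrete Gm H Hi.
Proof.
intros hab hC0. apply NNPP. intro ND.
(* The centres will lie in [a0 + w, a0 + 2w], at distance at least [w >= R0] from [a0] and [b0]. *)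
set (w := Rmin ((b0 - a0) / 3) 1).
assert (hw : 0 < w <= 1) by (unfold w; split; [apply Rmin_pos; lra|apply Rmin_r]).
assert (hw3 : w <= (b0 - a0) / 3) by apply Rmin_l.
destruct (uniform_distortion (a0 + w) w ND hw) as (R0 & hR0 & hU).
set (p := fun k : nat => a0 + w + (INR k - 1) * (R0 / 2)).
assert (hp : forall k, p (S k) = p k + R0 / 2).
{ intro k. unfold p. rewrite S_INR. field. }
assert (each : forall k, exists eps, 0 < eps /\ forall g, Gm g -> ~ eqZ g ids ->
  distortion2 H Hi 1 g (p k) (p (S k)) ->
  ~ (forall y, p k <= y <= p (S k) -> Rabs (g y - y) <= eps)).
{ intro k. assert (hk : p k < p (S k)) by (rewrite hp; lra).
  destruct (not_nondiscrete Gm H Hi ND (p k) (p (S k)) hk) as [eta [heta hdisc]].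
  destruct (distortion_interp ids ids ids_line_homeo 1 (ids (p (S k)) - ids (p k)) eta ltac:(lra)
    ltac:(unfold ids; lra) heta) as [e1 [he1 int1]].
  destruct (distortion_interp H Hi LH 1 (H (p (S k)) - H (p k)) eta ltac:(lra)
    ltac:(apply (K_pos H Hi LH); auto) heta) as [e2 [he2 int2]].
  destruct (line_homeo_unif H Hi LH e2 he2) as [d [hd hunif]].
  exists (Rmin (Rmin eta e1) d). split; [repeat apply Rmin_pos; auto|].
  intros g Hg nt [B1 B2] hdisp. apply nt, hdisc; auto.
  destruct (SM g Hg) as [s1 s2].
  assert (m1 := Rmin_l (Rmin eta e1) d). assert (m2 := Rmin_r (Rmin eta e1) d).
  assert (m3 := Rmin_l eta e1). assert (m4 := Rmin_r eta e1).
  intros y hy. split; [|split].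
  - specialize (hdisp y hy). lra.
  - apply (int1 g (p k) (p (S k))); auto; try lra.
    intros z hz. specialize (hdisp z hz). unfold ids; lra.
  - apply (int2 g (p k) (p (S k))); auto; try lra.
    intros z hz. apply hunif. specialize (hdisp z hz). lra. }
(* The bound on the displacement has to be chosen before [g], which decides the piece; hence a
   minimum over all pieces. *)
assert (all : forall n, exists eps, 0 < eps /\ forall k, (k < n)%nat ->
  forall g, Gm g -> ~ eqZ g ids -> distortion2 H Hi 1 g (p k) (p (S k)) ->
  ~ (forall y, p k <= y <= p (S k) -> Rabs (g y - y) <= eps)).
{ induction n as [|n [e1 [he1 IH]]].
  - exists 1; split; [lra|]. intros; lia.
  - destruct (each n) as [e2 [he2 h2]]. exists (Rmin e1 e2).
    split; [now apply Rmin_pos|]. intros k hk g Hg nt B hd.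
    destruct (Nat.eq_dec k n) as [->|ne].
    + apply (h2 g); auto. intros y hy. apply Rle_trans with (1 := hd y hy). apply Rmin_r.
    + apply (IH k ltac:(lia) g); auto. intros y hy. apply Rle_trans with (1 := hd y hy).
      apply Rmin_l. }
destruct (nfloor_ex (w / (R0 / 2))) as [n0 [_ hn0]].
{ apply Rdiv_le_0_compat; lra. }
set (n := S n0).
destruct (all n) as [eps [heps hall]].
destruct (hC0 eps heps) as (g & Hg & nt & hd).
destruct (hU g Hg) as [y [hy [B1 B2]]].
(* [p k, p (S k)] is the left neighbour of the grid cell that contains [y], hence lies in
   [y - R0, y]. *)
destruct (grid_find (a0 + w) (R0 / 2) y ltac:(lra) n) as [k [hk hk']].
{ split; [lra|]. unfold n. rewrite S_INR.
  apply Rlt_div_l in hn0; lra. }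
{ unfold n; lia. }
assert (q1 : p (S k) = a0 + w + INR k * (R0 / 2)) by (unfold p; rewrite S_INR; ring).
assert (q2 := hp k). rewrite S_INR in hk'.
assert (q3 : INR k * (R0 / 2) <= w).
{ lra. }
assert (0 <= INR k * (R0 / 2)) by (apply Rmult_le_pos; [apply pos_INR|lra]).
apply (hall k hk g Hg nt).
- split.
  + apply (distortion_sub ids ids ids_line_homeo 1 g (y - R0) (y + R0)); auto; lra.
  + apply (distortion_sub H Hi LH 1 g (y - R0) (y + R0)); auto; lra.
- intros z hz. apply hd. lra.
Qed.
End Nondiscreteness.

(** * Normed power series *)

(* Coquelicot states equalities in the carrier of a structure, where [ring] fails. *)
Ltac toR := match goal with |- @eq _ ?a ?b => change (@eq R a b) end.

Lemma ex_series_pos_bounded (f : nat -> R) (B : R) : (forall n, 0 <= f n) ->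
  (forall n, sum_n f n <= B) -> exists l, is_series f l /\ l <= B.
Proof.
intros hf hB.
destruct (ex_finite_lim_seq_incr (sum_n f) B) as [l hl]; auto.
{ intro n. rewrite sum_Sn. unfold plus; simpl. generalize (hf (S n)); lra. }
exists l. split; auto.
apply (is_lim_seq_le (sum_n f) (fun _ => B) l B); auto. apply is_lim_seq_const.
Qed.

Lemma is_series_sum_le (f : nat -> R) (l : R) : (forall n, 0 <= f n) -> is_series f l ->
  forall n, sum_n f n <= l.
Proof.
intros hf h n. apply (is_lim_seq_incr_compare (sum_n f)); auto.
intro k. rewrite sum_Sn. unfold plus; simpl. generalize (hf (S k)); lra.
Qed.

Lemma sum_n_R_le (f g : nat -> R) : (forall n, f n <= g n) -> forall n, sum_n f n <= sum_n g n.
Proof.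
intros h n. induction n as [|n IH]; [rewrite !sum_O; auto|].
rewrite !sum_Sn. now apply Rplus_le_compat.
Qed.

Lemma sum_n_R_abs (f : nat -> R) (n : nat) : Rabs (sum_n f n) <= sum_n (fun k => Rabs (f k)) n.
Proof.
induction n as [|n IH]; [rewrite !sum_O; lra|]. rewrite !sum_Sn.
unfold plus; simpl. apply Rle_trans with (1 := Rabs_triang _ _). lra.
Qed.

Lemma is_lim_seq_finite_sum (v : nat -> nat -> R) (w : nat -> R) (K : nat) :
  (forall k, is_lim_seq (fun N => v N k) (w k)) ->
  is_lim_seq (fun N => sum_n (v N) K) (sum_n w K).
Proof.
intro h. induction K as [|K IH].
- rewrite sum_O. apply (is_lim_seq_ext (fun N => v N 0%nat)); auto.
  intro; now rewrite sum_O.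
- rewrite sum_Sn.
  apply (is_lim_seq_ext (fun N => sum_n (v N) K + v N (S K))).
  { intro; now rewrite sum_Sn. }
  now apply is_lim_seq_plus'.
Qed.

(** Dominated convergence: beyond a rank [K] all series are controlled by the tail of [m], and the
    first terms form a finite sum. *)
Lemma tannery (v : nat -> nat -> R) (w m : nat -> R) :
  (forall N k, Rabs (v N k) <= m k) -> ex_series m ->
  (forall k, is_lim_seq (fun N => v N k) (w k)) ->
  is_lim_seq (fun N => Series (v N)) (Series w).
Proof.
intros hv [S hS] hlim.
assert (hm : forall k, 0 <= m k) by (intro k; apply Rle_trans with (2 := hv 0%nat k); apply Rabs_pos).
assert (hw : forall k, Rabs (w k) <= m k).
{ intro k. apply (is_lim_seq_le (fun N => Rabs (v N k)) (fun _ => m k) (Rabs (w k)) (m k)); auto.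
  - apply (is_lim_seq_abs _ (w k)); auto.
  - apply is_lim_seq_const. }
assert (tail : forall f K, (forall k, Rabs (f k) <= m k) ->
  Rabs (Series f - sum_n f K) <= S - sum_n m K).
{ intros f K hf.
  assert (ef : ex_series f).
  { apply (ex_series_le f m); auto. now exists S. }
  apply (is_lim_seq_le (fun n => Rabs (sum_n f (n + K) - sum_n f K))
    (fun n => sum_n m (n + K) - sum_n m K)
    (Rabs (Series f - sum_n f K)) (S - sum_n m K)).
  - intro n. induction n as [|n IH].
    + simpl. rewrite !Rminus_diag, Rabs_R0; lra.
    + simpl. rewrite !sum_Sn. unfold plus; simpl.
      replace (sum_n f (n + K) + f (Datatypes.S (n + K)) - sum_n f K) with
        (sum_n f (n + K) - sum_n f K + f (Datatypes.S (n + K))) by ring.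
      apply Rle_trans with (1 := Rabs_triang _ _).
      generalize (hf (Datatypes.S (n + K))); lra.
  - apply (is_lim_seq_abs _ (Series f - sum_n f K)).
    apply is_lim_seq_minus'; [|apply is_lim_seq_const].
    apply (is_lim_seq_incr_n (sum_n f) K). apply (Series_correct f ef).
  - apply is_lim_seq_minus'; [|apply is_lim_seq_const].
    now apply (is_lim_seq_incr_n (sum_n m) K). }
apply is_lim_seq_spec. intro eps.
assert (he := cond_pos eps).
assert (hK : exists K, S - sum_n m K < eps / 3).
{ change (is_lim_seq (sum_n m) S) in hS. apply is_lim_seq_spec in hS. destruct (hS (mkposreal (eps / 3) ltac:(lra))) as [K hK].
  exists K. specialize (hK K (le_n K)). simpl in hK. apply Rabs_def2 in hK. lra. }
destruct hK as [K hK].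
assert (h := is_lim_seq_finite_sum v w K hlim).
apply is_lim_seq_spec in h. destruct (h (mkposreal (eps / 3) ltac:(lra))) as [N0 hN0].
exists N0. intros N hN. specialize (hN0 N hN). simpl in hN0.
assert (t1 := tail (v N) K (hv N)). assert (t2 := tail w K hw).
apply Rabs_le_between in t1. apply Rabs_le_between in t2. apply Rabs_def2 in hN0.
apply Rabs_def1; lra.
Qed.

Lemma sum_n_Series (u : nat -> nat -> R) (N : nat) :
  (forall n, ex_series (fun k => u k n)) ->
  sum_n (fun n => Series (fun k => u k n)) N = Series (fun k => sum_n (u k) N) /\
  ex_series (fun k => sum_n (u k) N).
Proof.
intro h. induction N as [|N [IH IH']].
- split.
  + rewrite sum_O. apply Series_ext. intro; now rewrite sum_O.
  + apply (ex_series_ext (fun k => u k 0%nat)); auto. intro; now rewrite sum_O.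
- split.
  + rewrite sum_Sn, IH. unfold plus; simpl.
    rewrite <- Series_plus by auto. apply Series_ext. intro; now rewrite sum_Sn.
  + apply (ex_series_ext (fun k => plus (sum_n (u k) N) (u k (S N)))).
    * intro; now rewrite sum_Sn.
    * now apply (ex_series_plus (fun k => sum_n (u k) N) (fun k => u k (S N))).
Qed.

(** Exchange of summations under domination by [m]; the last conclusion becomes the norm bound in
    [ana_series]. *)
Lemma double_series (u : nat -> nat -> R) (m : nat -> R) :
  (forall k, exists l, is_series (fun n => Rabs (u k n)) l /\ l <= m k) -> ex_series m ->
  (forall n, ex_series (fun k => u k n)) /\
  is_series (fun n => Series (fun k => u k n)) (Series (fun k => Series (u k))) /\
  exists l, is_series (fun n => Rabs (Series (fun k => u k n))) l /\ l <= Series m.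
Proof.
intros hu hm.
assert (hsum : forall k N, sum_n (fun n => Rabs (u k n)) N <= m k).
{ intros k N. destruct (hu k) as [l [h1 h2]]. apply Rle_trans with (2 := h2).
  apply is_series_sum_le; auto. intro; apply Rabs_pos. }
assert (hterm : forall k n, Rabs (u k n) <= m k).
{ intros k n. apply Rle_trans with (2 := hsum k n). destruct n.
  - rewrite sum_O; lra.
  - rewrite sum_Sn. unfold plus; simpl.
    assert (0 <= sum_n (fun n => Rabs (u k n)) n); [|lra].
    apply Rle_trans with (sum_n (fun _ => 0) n).
    + rewrite sum_n_const; lra.
    + apply sum_n_R_le. intro; apply Rabs_pos. }
assert (hex : forall n, ex_series (fun k => Rabs (u k n))).
{ intro n. apply (ex_series_le (fun k => Rabs (u k n)) m); auto.
  intro k. unfold norm; simpl; unfold abs; simpl. rewrite Rabs_Rabsolu. auto. }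
assert (hex' : forall n, ex_series (fun k => u k n)).
{ intro n. now apply ex_series_Rabs. }
split; auto. split.
- assert (hT := tannery (fun N k => sum_n (u k) N) (fun k => Series (u k)) m).
  change (is_lim_seq (sum_n (fun n => Series (fun k => u k n)))
    (Series (fun k => Series (u k)))).
  apply (is_lim_seq_ext (fun N => Series (fun k => sum_n (u k) N))).
  { intro N. now rewrite <- (proj1 (sum_n_Series u N hex')). }
  apply hT; auto.
  + intros N k. apply Rle_trans with (2 := hsum k N). apply sum_n_R_abs.
  + intro k. apply (Series_correct (u k)). apply ex_series_Rabs.
    destruct (hu k) as [l [h1 _]]. now exists l.
- apply ex_series_pos_bounded; [intro; apply Rabs_pos|].
  intro N.
  apply Rle_trans with (sum_n (fun n => Series (fun k => Rabs (u k n))) N).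
  + apply sum_n_R_le. intro n. now apply Series_Rabs.
  + rewrite (proj1 (sum_n_Series (fun k n => Rabs (u k n)) N hex)).
    apply Series_le; auto. intro k. split; auto.
    apply Rle_trans with (2 := sum_n_R_abs (u k) N). apply Rabs_pos.
Qed.

(* The norm sum |a_n| r^n is submultiplicative. *)
Definition ana (f : R -> R) (r M : R) : Prop := exists a : nat -> R,
  (exists l, is_series (fun n => Rabs (a n) * r ^ n) l /\ l <= M) /\
  forall t, Rabs t <= r -> is_series (fun n => a n * t ^ n) (f t).

Section Ana.
Variable r : R.
Hypothesis hr : 0 < r.

Lemma pow_abs_le (t : R) (n : nat) : Rabs t <= r -> Rabs (t ^ n) <= r ^ n.
Proof. intro h. rewrite <- RPow_abs. apply pow_incr. split; auto. apply Rabs_pos. Qed.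

Lemma ana_ext (f g : R -> R) (M : R) : (forall t, Rabs t <= r -> f t = g t) ->
  ana f r M -> ana g r M.
Proof.
intros h [a [h1 h2]]. exists a; split; auto. intros t ht. rewrite <- h; auto.
Qed.

Lemma ana_le (f : R -> R) (M M' : R) : M <= M' -> ana f r M -> ana f r M'.
Proof. intros h [a [[l [h1 h1']] h2]]. exists a; split; auto. exists l; split; auto; lra. Qed.

Lemma ana_bound (f : R -> R) (M : R) : ana f r M -> forall t, Rabs t <= r -> Rabs (f t) <= M.
Proof.
intros [a [[l [h1 h1']] h2]] t ht.
rewrite <- (is_series_unique _ _ (h2 t ht)).
assert (hle : forall n, 0 <= Rabs (a n * t ^ n) <= Rabs (a n) * r ^ n).
{ intro n. split; [apply Rabs_pos|]. rewrite Rabs_mult.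
  apply Rmult_le_compat_l; [apply Rabs_pos|]. now apply pow_abs_le. }
apply Rle_trans with (Series (fun n => Rabs (a n * t ^ n))).
- apply Series_Rabs.
  apply (ex_series_le (fun n => Rabs (a n * t ^ n)) (fun n => Rabs (a n) * r ^ n)).
  + intro n. unfold norm; simpl; unfold abs; simpl. rewrite Rabs_Rabsolu. apply hle.
  + now exists l.
- apply Rle_trans with (Series (fun n => Rabs (a n) * r ^ n)).
  + apply Series_le; auto. now exists l.
  + rewrite (is_series_unique _ _ h1). auto.
Qed.

Lemma ana_pos (f : R -> R) (M : R) : ana f r M -> 0 <= M.
Proof.
intro h. apply Rle_trans with (2 := ana_bound f M h 0 ltac:(rewrite Rabs_R0; lra)).
apply Rabs_pos.
Qed.

Lemma ana_monomial (c : R) (k : nat) : ana (fun t => c * t ^ k) r (Rabs c * r ^ k).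
Proof.
assert (key : forall d x, is_series (fun n => (if Nat.eq_dec n k then d else 0) * x ^ n) (d * x ^ k)).
{ intros d x. assert (e : forall N, @eq R (sum_n (fun n => (if Nat.eq_dec n k then d else 0) * x ^ n) N)
    (if le_lt_dec k N then d * x ^ k else 0)).
  { induction N as [|N IH].
    - rewrite sum_O. destruct (le_lt_dec k 0) as [c1|c1]; destruct (Nat.eq_dec 0 k) as [c2|c2];
        try lia; [now rewrite c2 | exact (Rmult_0_l _)].
    - rewrite sum_Sn, IH.
      destruct (le_lt_dec k N) as [c1|c1]; destruct (le_lt_dec k (S N)) as [c2|c2];
        destruct (Nat.eq_dec (S N) k) as [c3|c3]; try lia; rewrite ?c3;
        unfold plus; simpl; ring. }
  change (is_lim_seq (sum_n (fun n => (if Nat.eq_dec n k then d else 0) * x ^ n)) (d * x ^ k)).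
  apply (is_lim_seq_incr_n _ k).
  apply (is_lim_seq_ext (fun _ => d * x ^ k)); [|apply is_lim_seq_const].
  intro n. rewrite e. destruct (le_lt_dec k (n + k)); auto; lia. }
exists (fun n => if Nat.eq_dec n k then c else 0). split.
- exists (Rabs c * r ^ k). split; [|lra].
  apply (is_series_ext (fun n => (if Nat.eq_dec n k then Rabs c else 0) * r ^ n)); auto.
  intro n. destruct (Nat.eq_dec n k); auto. now rewrite Rabs_R0.
- intros t _. apply key.
Qed.

Lemma ana_const (c : R) : ana (fun _ => c) r (Rabs c).
Proof.
apply (ana_le _ (Rabs c * r ^ 0)); [simpl; lra|].
apply (ana_ext (fun t => c * t ^ 0)); [intros; simpl; ring|]. apply ana_monomial.
Qed.

Lemma ana_id : ana (fun t => t) r r.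
Proof.
apply (ana_le _ (Rabs 1 * r ^ 1)); [rewrite Rabs_R1; simpl; lra|].
apply (ana_ext (fun t => 1 * t ^ 1)); [intros; simpl; ring|]. apply ana_monomial.
Qed.

Lemma ana_scal (c : R) (f : R -> R) (M : R) : ana f r M -> ana (fun t => c * f t) r (Rabs c * M).
Proof.
intros [a [[l [h1 h1']] h2]]. exists (fun n => c * a n). split.
- exists (Rabs c * l). split.
  + apply (is_series_ext (fun n => Rabs c * (Rabs (a n) * r ^ n))).
    { intro n. toR. rewrite Rabs_mult. ring. }
    apply (is_series_scal_l (Rabs c) _ _ h1).
  + apply Rmult_le_compat_l; auto. apply Rabs_pos.
- intros t ht. apply (is_series_ext (fun n => c * (a n * t ^ n))).
  { intro n. toR. ring. }
  apply (is_series_scal_l c _ _ (h2 t ht)).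
Qed.

(** The coefficients are summed degree by degree. [double_series] is applied twice: at radius [r]
    for the norm, and at each [t] for the value. *)
Lemma ana_series (f : nat -> R -> R) (M : nat -> R) (g : R -> R) :
  (forall k, ana (f k) r (M k)) -> ex_series M ->
  (forall t, Rabs t <= r -> Series (fun k => f k t) = g t) ->
  ana g r (Series M).
Proof.
intros hf hM hg.
apply choice_fun in hf. destruct hf as [a ha].
assert (rn : forall n, 0 < r ^ n) by (intro; now apply pow_lt).
assert (abs_r : forall k n, Rabs (a k n * r ^ n) = Rabs (a k n) * r ^ n).
{ intros k n. rewrite Rabs_mult, (Rabs_pos_eq (r ^ n)); auto. now apply Rlt_le. }
assert (h0 : forall k, exists l, is_series (fun n => Rabs (a k n * r ^ n)) l /\ l <= M k).
{ intro k. destruct (proj1 (ha k)) as [l [h1 h2]]. exists l; split; auto.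
  apply (is_series_ext _ _ _ (fun n => eq_sym (abs_r k n)) h1). }
destruct (double_series (fun k n => a k n * r ^ n) M h0 hM) as [e1 [_ e3]].
assert (exa : forall n, ex_series (fun k => a k n)).
{ intro n. apply (ex_series_ext (fun k => a k n * r ^ n * / r ^ n)).
  - intro k. toR. field. generalize (rn n); lra.
  - apply (ex_series_scal_r (/ r ^ n)). apply e1. }
exists (fun n => Series (fun k => a k n)). split.
- destruct e3 as [l [h1 h2]]. exists l; split; auto.
  apply (is_series_ext (fun n => Rabs (Series (fun k => a k n * r ^ n)))); auto.
  intro n. rewrite Series_scal_r, Rabs_mult, (Rabs_pos_eq (r ^ n)); auto. now apply Rlt_le.
- intros t ht.
  assert (h3 : forall k, exists l, is_series (fun n => Rabs (a k n * t ^ n)) l /\ l <= M k).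
  { intro k. destruct (proj1 (ha k)) as [l [h1 h2]].
    apply ex_series_pos_bounded; [intro; apply Rabs_pos|].
    intro N. apply Rle_trans with (2 := h2).
    apply Rle_trans with (sum_n (fun n => Rabs (a k n) * r ^ n) N).
    - apply sum_n_R_le. intro n. rewrite Rabs_mult.
      apply Rmult_le_compat_l; [apply Rabs_pos|]. now apply pow_abs_le.
    - apply is_series_sum_le; auto. intro n.
      apply Rmult_le_pos; [apply Rabs_pos|now apply Rlt_le]. }
  destruct (double_series (fun k n => a k n * t ^ n) M h3 hM) as [_ [d2 _]].
  rewrite <- (hg t ht).
  replace (Series (fun k => f k t)) with (Series (fun k => Series (fun n => a k n * t ^ n))).
  + apply (is_series_ext (fun n => Series (fun k => a k n * t ^ n))); auto.
    intro n. apply Series_scal_r.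
  + apply Series_ext. intro k. apply is_series_unique. now apply ha.
Qed.

Lemma ana_plus (f g : R -> R) (M M' : R) : ana f r M -> ana g r M' ->
  ana (fun t => f t + g t) r (M + M').
Proof.
intros [a [[l [h1 h1']] h2]] [b [[l' [g1 g1']] g2]].
exists (fun n => a n + b n). split.
- apply ex_series_pos_bounded.
  + intro n. apply Rmult_le_pos; [apply Rabs_pos|apply pow_le; lra].
  + intro N. apply Rle_trans with (sum_n (fun n => plus (Rabs (a n) * r ^ n) (Rabs (b n) * r ^ n)) N).
    * apply sum_n_R_le. intro n. unfold plus; simpl. rewrite <- Rmult_plus_distr_r.
      apply Rmult_le_compat_r; [apply pow_le; lra|apply Rabs_triang].
    * rewrite sum_n_plus. apply Rplus_le_compat.
      -- apply Rle_trans with (2 := h1'). apply is_series_sum_le; auto. intro n.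
         apply Rmult_le_pos; [apply Rabs_pos|apply pow_le; lra].
      -- apply Rle_trans with (2 := g1'). apply is_series_sum_le; auto. intro n.
         apply Rmult_le_pos; [apply Rabs_pos|apply pow_le; lra].
- intros t ht. apply (is_series_ext (fun n => plus (a n * t ^ n) (b n * t ^ n))).
  { intro n. toR. unfold plus; simpl. ring. }
  apply (is_series_plus _ _ _ _ (h2 t ht) (g2 t ht)).
Qed.

Lemma ana_mult (f g : R -> R) (M M' : R) : ana f r M -> ana g r M' ->
  ana (fun t => f t * g t) r (M * M').
Proof.
intros [a [[l [h1 h1']] h2]] [b [[l' [g1 g1']] g2]].
assert (hl : forall n, 0 <= Rabs (a n) * r ^ n).
{ intro; apply Rmult_le_pos; [apply Rabs_pos|apply pow_le; lra]. }
assert (hl' : forall n, 0 <= Rabs (b n) * r ^ n).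
{ intro; apply Rmult_le_pos; [apply Rabs_pos|apply pow_le; lra]. }
assert (pl : 0 <= l) by (apply Rle_trans with (2 := is_series_sum_le _ l hl h1 0%nat); rewrite sum_O; auto).
assert (pl' : 0 <= l') by (apply Rle_trans with (2 := is_series_sum_le _ l' hl' g1 0%nat); rewrite sum_O; auto).
set (c := fun n => sum_f_R0 (fun k => a k * b (n - k)%nat) n).
assert (ec : forall t n, c n * t ^ n =
  sum_f_R0 (fun k => (a k * t ^ k) * (b (n - k)%nat * t ^ (n - k))) n).
{ intros t n. unfold c. rewrite Rmult_comm, scal_sum. apply sum_eq. intros i hi.
  replace (t ^ n) with (t ^ i * t ^ (n - i)); [ring|]. rewrite <- pow_add. f_equal; lia. }
exists c. split.
- assert (hm := is_series_mult_pos _ _ _ _ h1 g1 hl hl').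
  destruct (ex_series_pos_bounded (fun n => Rabs (c n) * r ^ n) (l * l')) as [L [e1 e2]].
  + intro n. apply Rmult_le_pos; [apply Rabs_pos|apply pow_le; lra].
  + intro N. apply Rle_trans with (sum_n (fun n => sum_f_R0 (fun k =>
      Rabs (a k) * r ^ k * (Rabs (b (n - k)%nat) * r ^ (n - k))) n) N).
    * apply sum_n_R_le. intro n.
      rewrite <- (Rabs_pos_eq (r ^ n)) by (apply pow_le; lra).
      rewrite <- Rabs_mult, ec.
      apply Rle_trans with (1 := Rsum_abs _ _). right. apply sum_eq. intros i hi.
      rewrite !Rabs_mult, !(Rabs_pos_eq (r ^ _)) by (apply pow_le; lra). ring.
    * apply is_series_sum_le; auto. intro n. apply cond_pos_sum. intro k.
      now apply Rmult_le_pos.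
  + exists L; split; auto. apply Rle_trans with (1 := e2). apply Rmult_le_compat; auto.
- intros t ht.
  apply (is_series_ext (fun n => sum_f_R0 (fun k => (a k * t ^ k) * (b (n - k)%nat * t ^ (n - k))) n)).
  { intro n. now rewrite <- ec. }
  assert (hab : forall d : nat -> R, forall m, is_series (fun n => Rabs (d n) * r ^ n) m ->
    ex_series (fun n => Rabs (d n * t ^ n))).
  { intros d m hd.
    apply (ex_series_le (fun n => Rabs (d n * t ^ n)) (fun n => Rabs (d n) * r ^ n)).
    - intro n. unfold norm; simpl; unfold abs; simpl. rewrite Rabs_Rabsolu, Rabs_mult.
      apply Rmult_le_compat_l; [apply Rabs_pos|]. now apply pow_abs_le.
    - now exists m. }
  apply (is_series_mult (fun k => a k * t ^ k) (fun k => b k * t ^ k)); auto;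
    eapply hab; eauto.
Qed.

Lemma ana_pow (f : R -> R) (M : R) (n : nat) : ana f r M -> ana (fun t => f t ^ n) r (M ^ n).
Proof.
intro h. induction n as [|n IH].
- simpl. apply (ana_le _ (Rabs 1)); [rewrite Rabs_R1; lra|]. apply ana_const.
- simpl. now apply ana_mult.
Qed.

(** By submultiplicativity [g ^ k] has norm at most [rho ^ k], so the series of [f] evaluated at [g]
    converges in norm. *)
Lemma ana_comp (f g : R -> R) (rho M : R) : 0 < rho -> ana f rho M -> ana g r rho ->
  ana (fun t => f (g t)) r M.
Proof.
intros hrho [a [[l [h1 h1']] h2]] hg.
apply (ana_le _ (Series (fun k => Rabs (a k) * rho ^ k))).
{ rewrite (is_series_unique _ _ h1); auto. }
apply (ana_series (fun k t => a k * g t ^ k)).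
- intro k. apply ana_scal. now apply ana_pow.
- now exists l.
- intros t ht. apply is_series_unique. apply h2. now apply (ana_bound g).
Qed.
End Ana.

Lemma ana_radius (a : nat -> R) (r l : R) : 0 < r ->
  is_series (fun n => Rabs (a n) * r ^ n) l ->
  forall t, Rabs t < r -> Rbar_lt (Rabs t) (CV_radius a).
Proof.
intros hr h t ht. destruct (CV_radius_bounded a) as [ub _].
apply Rbar_lt_le_trans with r; auto.
apply ub. exists l. intro n. rewrite Rabs_mult, (Rabs_pos_eq (r ^ n)) by (apply pow_le; lra).
apply Rle_trans with (sum_n (fun n => Rabs (a n) * r ^ n) n).
- assert (hp : forall k, 0 <= Rabs (a k) * r ^ k).
  { intro k; apply Rmult_le_pos; [apply Rabs_pos|apply pow_le; lra]. }
  destruct n; [rewrite sum_O; lra|]. rewrite sum_Sn. unfold plus; simpl.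
  assert (0 <= sum_n (fun n => Rabs (a n) * r ^ n) n); [|simpl; lra].
  apply Rle_trans with (sum_n (fun _ => 0) n).
  + rewrite sum_n_const; lra.
  + apply sum_n_R_le; auto.
- apply is_series_sum_le; auto.
  intro k; apply Rmult_le_pos; [apply Rabs_pos|apply pow_le; lra].
Qed.

Lemma locally_Rabs (x e : R) (P : R -> Prop) : 0 < e ->
  (forall y, Rabs (y - x) < e -> P y) -> locally x P.
Proof. intros he h. exists (mkposreal e he). intros y hy. apply h. exact hy. Qed.

Lemma locally_Rabs_inv (x : R) (P : R -> Prop) : locally x P ->
  exists e, 0 < e /\ forall y, Rabs (y - x) < e -> P y.
Proof. intros [e h]. exists e. split; [apply cond_pos|]. intros y hy. now apply h. Qed.

Lemma ana_coef (f : R -> R) (r : R) (a : nat -> R) (l : R) : 0 < r ->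
  is_series (fun n => Rabs (a n) * r ^ n) l ->
  (forall t, Rabs t <= r -> is_series (fun n => a n * t ^ n) (f t)) ->
  a 0%nat = f 0 /\ is_derive f 0 (a 1%nat).
Proof.
intros hr hl hf.
assert (e : forall t, Rabs t <= r -> f t = PSeries a t).
{ intros t ht. symmetry. now apply is_series_unique, hf. }
split.
- rewrite (e 0), PSeries_0; auto. rewrite Rabs_R0; lra.
- apply (is_derive_ext_loc (PSeries a)).
  { apply (locally_Rabs 0 r); auto. intros y hy. rewrite Rminus_0_r in hy.
    symmetry; apply e; lra. }
  replace (a 1%nat) with (PSeries (PS_derive a) 0).
  + apply is_derive_PSeries. apply (ana_radius a r l); auto. rewrite Rabs_R0; lra.
  + rewrite PSeries_0. unfold PS_derive. simpl; ring.
Qed.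

(** A Schwarz lemma for this norm: without constant term, each term gains at least a factor
    [s / r]. *)
Lemma ana_small (f : R -> R) (r M : R) : 0 < r -> ana f r M -> f 0 = 0 ->
  forall s, 0 < s <= r -> ana f s (M * (s / r)).
Proof.
intros hr [a [[l [h1 h1']] h2]] h0 s hs.
destruct (ana_coef f r a l hr h1 h2) as [c0 _]. rewrite h0 in c0.
assert (hsr : 0 < s / r <= 1).
{ split; [apply Rdiv_lt_0_compat; lra|]. apply Rle_div_l; lra. }
exists a; split.
- apply ex_series_pos_bounded.
  + intro n; apply Rmult_le_pos; [apply Rabs_pos|apply pow_le; lra].
  + intro N. apply Rle_trans with (sum_n (fun n => scal (s / r) (Rabs (a n) * r ^ n)) N).
    * apply sum_n_R_le. intro n. unfold scal; simpl; unfold mult; simpl.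
      destruct n as [|n]; [rewrite c0, Rabs_R0; lra|].
      replace s with (s / r * r) at 1 by (field; lra). rewrite Rpow_mult_distr.
      assert ((s / r) ^ S n <= s / r).
      { simpl. assert ((s / r) ^ n <= 1) by (rewrite <- (pow1 n); apply pow_incr; lra). nra. }
      assert (0 <= Rabs (a (S n)) * r ^ S n) by (apply Rmult_le_pos; [apply Rabs_pos|apply pow_le; lra]).
      nra.
    * rewrite sum_n_scal_l. unfold scal; simpl; unfold mult; simpl. rewrite Rmult_comm.
      apply Rmult_le_compat_r; [lra|]. apply Rle_trans with (2 := h1').
      apply is_series_sum_le; auto.
      intro k; apply Rmult_le_pos; [apply Rabs_pos|apply pow_le; lra].
- intros t ht. apply h2; lra.
Qed.

Lemma ana_small2 (f : R -> R) (r M : R) : 0 < r -> ana f r M -> f 0 = 0 -> is_derive f 0 0 ->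
  forall s, 0 < s <= r -> ana f s (M * (s / r) ^ 2).
Proof.
intros hr [a [[l [h1 h1']] h2]] h0 hd s hs.
destruct (ana_coef f r a l hr h1 h2) as [c0 c1]. rewrite h0 in c0.
assert (c1' : a 1%nat = 0).
{ rewrite <- (is_derive_unique _ _ _ c1). now apply is_derive_unique. }
assert (hsr : 0 < s / r <= 1).
{ split; [apply Rdiv_lt_0_compat; lra|]. apply Rle_div_l; lra. }
exists a; split.
- apply ex_series_pos_bounded.
  + intro n; apply Rmult_le_pos; [apply Rabs_pos|apply pow_le; lra].
  + intro N. apply Rle_trans with (sum_n (fun n => scal ((s / r) ^ 2) (Rabs (a n) * r ^ n)) N).
    * apply sum_n_R_le. intro n. unfold scal; simpl; unfold mult; simpl.
      destruct n as [|[|n]]; [rewrite c0, Rabs_R0; lra|rewrite c1', Rabs_R0; lra|].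
      replace s with (s / r * r) at 1 by (field; lra).
      replace (s / r * r * (s / r * r * (s / r * r) ^ n)) with
        ((s / r * r) ^ S (S n)) by (simpl; ring).
      rewrite Rpow_mult_distr.
      assert ((s / r) ^ S (S n) <= s / r * (s / r * 1)).
      { simpl. assert ((s / r) ^ n <= 1) by (rewrite <- (pow1 n); apply pow_incr; lra).
        assert (0 <= s / r * (s / r)) by nra. nra. }
      assert (0 <= Rabs (a (S (S n))) * r ^ S (S n)) by (apply Rmult_le_pos; [apply Rabs_pos|apply pow_le; lra]).
      change (r * (r * r ^ n)) with (r ^ S (S n)). nra.
    * rewrite sum_n_scal_l. unfold scal; simpl; unfold mult; simpl. rewrite (Rmult_comm M).
      apply Rmult_le_compat_l; [nra|]. apply Rle_trans with (2 := h1').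
      apply is_series_sum_le; auto.
      intro k; apply Rmult_le_pos; [apply Rabs_pos|apply pow_le; lra].
- intros t ht. apply h2; lra.
Qed.

(** * Local inversion and the Koenigs coordinate of normed series *)

Lemma ana_pow_diff (s rho d : R) (u w : R -> R) : 0 < s -> 0 <= rho ->
  ana u s rho -> ana w s rho -> ana (fun t => u t - w t) s d ->
  forall k, ana (fun t => u t ^ k - w t ^ k) s (INR k * rho ^ (pred k) * d).
Proof.
intros hs hrho hu hw hd. assert (pd := ana_pos s hs _ _ hd).
induction k as [|k IH].
- apply (ana_le s _ (Rabs 0)); [rewrite Rabs_R0; simpl; lra|].
  apply (ana_ext s (fun _ => 0)); [intros; simpl; ring|]. now apply ana_const.
- apply (ana_le s _ (rho * (INR k * rho ^ pred k * d) + d * rho ^ k)).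
  { rewrite S_INR. simpl pred. destruct k as [|k]; simpl pred; [simpl; lra|].
    simpl pow. right; ring. }
  apply (ana_ext s (fun t => u t * (u t ^ k - w t ^ k) + (u t - w t) * w t ^ k)).
  { intros; simpl; ring. }
  apply ana_plus; auto.
  + now apply ana_mult.
  + apply ana_mult; auto. now apply ana_pow.
Qed.

(** The series of [V] starts at order two, so composition with [V] contracts on a small ball.
    Contraction of norms, and not only of values, keeps limits analytic. *)
Lemma ana_contract (V : R -> R) (r M : R) : 0 < r -> ana V r M -> V 0 = 0 ->
  is_derive V 0 0 -> exists rho, 0 < rho <= r /\
  forall s u w d, 0 < s -> ana u s rho -> ana w s rho -> ana (fun t => u t - w t) s d ->
    ana (fun t => V (u t) - V (w t)) s (d / 2).
Proof.
intros hr [a [[l [h1 h1']] h2]] h0 hd.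
destruct (ana_coef V r a l hr h1 h2) as [c0 c1]. rewrite h0 in c0.
assert (c1' : a 1%nat = 0).
{ rewrite <- (is_derive_unique _ _ _ c1). now apply is_derive_unique. }
assert (pa : forall n, 0 <= Rabs (a n) * r ^ n).
{ intro n; apply Rmult_le_pos; [apply Rabs_pos|apply pow_le; lra]. }
assert (pl : 0 <= l).
{ apply Rle_trans with (2 := is_series_sum_le _ l pa h1 0%nat). rewrite sum_O; auto. }
(* For k >= 2, [k * rho ^ (k - 1) <= (2 * rho / r ^ 2) * r ^ k], from [k <= 2 ^ (k - 1)] and
   [2 * rho <= r]; the second bound on [rho] makes the total at most [d / 2]. *)
set (rho := Rmin (r / 2) (r * r / (4 * (l + 1)))).
assert (hrho : 0 < rho) by (apply Rmin_pos; [lra|apply Rdiv_lt_0_compat; nra]).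
assert (hrho1 : rho <= r / 2) by apply Rmin_l.
assert (hrho2 : rho * (4 * (l + 1)) <= r * r).
{ apply Rle_trans with (r * r / (4 * (l + 1)) * (4 * (l + 1))).
  - apply Rmult_le_compat_r; [lra|apply Rmin_r].
  - right; field; lra. }
exists rho. split; [lra|].
intros s u w d hs hu hw hdd. assert (pd := ana_pos s hs _ _ hdd).
set (x := 2 * rho / r).
assert (hx : 0 < x <= 1).
{ unfold x; split; [apply Rdiv_lt_0_compat; lra|apply Rle_div_l; lra]. }
assert (key : forall k, Rabs (a k) * (INR k * rho ^ pred k * d) <=
   (2 * rho / (r * r) * d) * (Rabs (a k) * r ^ k)).
{ intro k. destruct k as [|[|k]].
  - rewrite c0, Rabs_R0; lra.
  - rewrite c1', Rabs_R0; lra.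
  - replace (2 * rho / (r * r) * d * (Rabs (a (S (S k))) * r ^ S (S k))) with
      (Rabs (a (S (S k))) * (x * r ^ S k * d)) by (unfold x; simpl; field; lra).
    apply Rmult_le_compat_l; [apply Rabs_pos|]. apply Rmult_le_compat_r; auto.
    simpl pred.
    assert (hk : INR (S (S k)) <= 2 ^ S k).
    { clear. induction k as [|k IH]; [simpl; lra|].
      rewrite S_INR. change (2 ^ S (S k)) with (2 * 2 ^ S k).
      assert (1 <= 2 ^ S k) by (apply pow_R1_Rle; lra). lra. }
    replace rho with (x / 2 * r) at 1 by (unfold x; field; lra).
    rewrite Rpow_mult_distr, <- Rmult_assoc.
    apply Rmult_le_compat_r; [apply pow_le; lra|].
    apply Rle_trans with (2 ^ S k * (x / 2) ^ S k).
    + apply Rmult_le_compat_r; auto. apply pow_le; lra.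
    + rewrite <- Rpow_mult_distr. replace (2 * (x / 2)) with x by field.
      simpl. assert (x ^ k <= 1) by (rewrite <- (pow1 k); apply pow_incr; lra).
      nra. }
assert (hex : ex_series (fun k => (2 * rho / (r * r) * d) * (Rabs (a k) * r ^ k))).
{ apply (ex_series_scal_l (2 * rho / (r * r) * d) (fun k => Rabs (a k) * r ^ k)).
  now exists l. }
assert (kpos : forall k, 0 <= Rabs (a k) * (INR k * rho ^ pred k * d)).
{ intro k. apply Rmult_le_pos; [apply Rabs_pos|]. apply Rmult_le_pos; auto.
  apply Rmult_le_pos; [apply pos_INR|apply pow_le; lra]. }
assert (hex' : ex_series (fun k => Rabs (a k) * (INR k * rho ^ pred k * d))).
{ apply (ex_series_le (fun k => Rabs (a k) * (INR k * rho ^ pred k * d))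
    (fun k => (2 * rho / (r * r) * d) * (Rabs (a k) * r ^ k))); [|apply hex].
  intro k. unfold norm; simpl; unfold abs; simpl. rewrite Rabs_pos_eq; auto. }
apply (ana_le s _ (Series (fun k => Rabs (a k) * (INR k * rho ^ pred k * d)))).
{ apply Rle_trans with (Series (fun k => (2 * rho / (r * r) * d) * (Rabs (a k) * r ^ k))).
  - apply Series_le; auto.
  - rewrite Series_scal_l, (is_series_unique _ _ h1).
    replace (2 * rho / (r * r) * d * l) with (d * (2 * rho * l / (r * r))) by (field; lra).
    apply Rmult_le_compat_l; auto. apply Rle_div_l; nra. }
apply (ana_series s hs (fun k t => a k * (u t ^ k - w t ^ k))); auto.
- intro k. apply ana_scal. apply ana_pow_diff; auto; lra.
- intros t ht.
  assert (b1 := ana_bound s u rho hu t ht). assert (b2 := ana_bound s w rho hw t ht).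
  apply is_series_unique.
  apply (is_series_ext (fun k => plus (a k * u t ^ k) (opp (a k * w t ^ k)))).
  { intro k. toR. unfold plus, opp; simpl. ring. }
  apply (is_series_minus _ _ _ _ (h2 (u t) ltac:(lra)) (h2 (w t) ltac:(lra))).
Qed.

Fixpoint picard (V : R -> R) (n : nat) (y : R) : R :=
  match n with O => 0 | S n => y - V (picard V n y) end.

(** [P] inverts id + V near 0. It is the limit of the iterates [picard] of the equation P = id - V o
    P, whose successive differences are halved in norm at each step. *)
Lemma ana_inverse (V : R -> R) (r M : R) : 0 < r -> ana V r M -> V 0 = 0 ->
  is_derive V 0 0 -> exists rho s P, 0 < rho <= r /\ 0 < s /\ ana P s rho /\
  (forall y, Rabs y <= s -> P y + V (P y) = y) /\
  (forall x y, Rabs x <= rho -> Rabs y <= s -> x + V x = y -> P y = x) /\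
  forall x x', Rabs x <= rho -> Rabs x' <= rho -> Rabs (V x - V x') <= Rabs (x - x') / 2.
Proof.
intros hr hV h0 hd.
destruct (ana_contract V r M hr hV h0 hd) as (rho & hrho & hC).
assert (lip : forall x x', Rabs x <= rho -> Rabs x' <= rho ->
  Rabs (V x - V x') <= Rabs (x - x') / 2).
{ intros x x' hx hx'.
  (* Applied to constant functions, the contraction of norms gives a pointwise Lipschitz bound. *)
  assert (z := hC 1 (fun _ => x) (fun _ => x') (Rabs (x - x')) ltac:(lra)
    (ana_le 1 _ _ _ hx (ana_const 1 x))
    (ana_le 1 _ _ _ hx' (ana_const 1 x'))
    (ana_const 1 (x - x'))).
  apply (ana_bound 1 _ _ z 0). rewrite Rabs_R0; lra. }
(* The first difference is the identity, of norm [s]; the halved differences sum to [2 * s = rho],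
   so the iterates stay in the ball of contraction. *)
set (s := rho / 2). assert (hs : 0 < s) by (unfold s; lra).
assert (half : forall n, 0 < (1 / 2) ^ n <= 1).
{ intro n; split; [apply pow_lt; lra|]. rewrite <- (pow1 n) at 2. apply pow_incr; lra. }
assert (main : forall n, ana (picard V n) s (rho * (1 - (1 / 2) ^ n)) /\
  ana (fun y => picard V (S n) y - picard V n y) s (s * (1 / 2) ^ n)).
{ induction n as [|n [IH1 IH2]].
  - split.
    + apply (ana_le s _ (Rabs 0)); [rewrite Rabs_R0; simpl; lra|]. now apply ana_const.
    + apply (ana_le s _ s); [simpl; lra|].
      apply (ana_ext s (fun y => y)); [intros; simpl; rewrite h0; ring|]. now apply ana_id.
  - assert (IH3 : ana (picard V (S n)) s (rho * (1 - (1 / 2) ^ S n))).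
    { apply (ana_le s _ (rho * (1 - (1 / 2) ^ n) + s * (1 / 2) ^ n)).
      - unfold s. simpl. right; field.
      - apply (ana_ext s (fun y => picard V n y + (picard V (S n) y - picard V n y))).
        { intros; ring. }
        now apply ana_plus. }
    split; auto.
    apply (ana_le s _ (Rabs (-1) * (s * (1 / 2) ^ n / 2))).
    { rewrite Rabs_left by lra. simpl. right; field. }
    apply (ana_ext s (fun y => -1 * (V (picard V (S n) y) - V (picard V n y)))).
    { intros; simpl; ring. }
    apply ana_scal. apply hC; auto.
    + apply (ana_le s _ (rho * (1 - (1 / 2) ^ S n))); auto. generalize (half (S n)); nra.
    + apply (ana_le s _ (rho * (1 - (1 / 2) ^ n))); auto. generalize (half n); nra. }
set (D := fun n y => picard V (S n) y - picard V n y).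
set (P := fun y => Series (fun n => D n y)).
assert (hgeom : is_series (fun n => s * (1 / 2) ^ n) rho).
{ replace rho with (s * / (1 - 1 / 2)) by (unfold s; field).
  apply (is_series_scal_l s (fun n => (1 / 2) ^ n)). apply is_series_geom. rewrite Rabs_pos_eq; lra. }
assert (hP : ana P s rho).
{ rewrite <- (is_series_unique _ _ hgeom).
  apply (ana_series s hs D); auto.
  - intro k. apply main.
  - now exists rho. }
assert (hcv : forall y, Rabs y <= s -> is_lim_seq (fun n => picard V n y) (P y)).
{ intros y hy. apply is_lim_seq_incr_1.
  apply (is_lim_seq_ext (sum_n (fun n => D n y))).
  { induction n as [|n IH].
    - rewrite sum_O. unfold D. simpl. toR. ring.
    - rewrite sum_Sn, IH. unfold D, plus. simpl. toR. ring. }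
  apply (Series_correct (fun n => D n y)).
  apply ex_series_Rabs.
  apply (ex_series_le (fun n => Rabs (D n y)) (fun n => s * (1 / 2) ^ n)).
  - intro n. unfold norm; simpl; unfold abs; simpl. rewrite Rabs_Rabsolu.
    apply (ana_bound s (D n)); auto. apply main.
  - now exists rho. }
exists rho, s, P. split; [lra|]. split; auto. split; auto.
assert (eqP : forall y, Rabs y <= s -> P y + V (P y) = y).
{ intros y hy.
  assert (hc := hcv y hy).
  assert (l1 : is_lim_seq (fun n => picard V (S n) y) (P y)) by now apply (is_lim_seq_incr_1 (fun n => picard V n y)).
  assert (l2 : is_lim_seq (fun n => picard V (S n) y) (y - V (P y))).
  { simpl. apply is_lim_seq_minus'; [apply is_lim_seq_const|].
    apply is_lim_seq_spec. intro eps. apply is_lim_seq_spec in hc.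
    destruct (hc eps) as [N hN]. exists N. intros n hn. specialize (hN n hn).
    assert (b1 : Rabs (picard V n y) <= rho).
    { apply (ana_bound s (picard V n)); auto.
      apply (ana_le s _ (rho * (1 - (1 / 2) ^ n))); [generalize (half n); nra|apply main]. }
    assert (b2 := ana_bound s P rho hP y hy).
    specialize (lip _ _ b1 b2). generalize (Rabs_pos (picard V n y - P y)); lra. }
  assert (e := is_lim_seq_unique _ _ l1). rewrite (is_lim_seq_unique _ _ l2) in e.
  injection e; lra. }
split; auto. split; auto.
intros x y hx hy e. assert (e' := eqP y hy). assert (b2 := ana_bound s P rho hP y hy).
specialize (lip (P y) x b2 hx).
assert (P y - x = - (V (P y) - V x)) by lra.
assert (Rabs (P y - x) = Rabs (V (P y) - V x)) by (rewrite H, Rabs_Ropp; auto).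
assert (hz : Rabs (P y - x) = 0) by (generalize (Rabs_pos (P y - x)); lra).
destruct (Req_dec (P y - x) 0) as [c|c]; [lra|].
apply Rabs_no_R0 in c; lra.
Qed.

(** The Koenigs coordinate id + W is the limit of F^k / q^k, written as a telescoping series with
    terms T(F^k) / q^(k+1), where T = F - q id. As [T] is quadratic at 0, these terms are of order
    (p^2 / q)^k if F^k decreases like p^k. *)
Lemma ana_koenigs (F : R -> R) (r M q : R) : 0 < r -> ana F r M -> F 0 = 0 ->
  0 < q < 1 -> is_derive F 0 q -> exists r0 W M', 0 < r0 <= r /\ ana W r0 M' /\
  W 0 = 0 /\ is_derive W 0 0 /\
  forall t, Rabs t <= r0 -> Rabs (F t) <= r0 /\ F t + W (F t) = q * (t + W t).
Proof.
intros hr hF h0 hq hd.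
set (T := fun t => F t - q * t).
assert (hT : ana T r (M + Rabs (- q) * r)).
{ apply (ana_ext r (fun t => F t + (- q) * t)); [intros; unfold T; ring|].
  apply ana_plus; auto. apply ana_scal; auto. now apply ana_id. }
set (MT := M + Rabs (- q) * r) in *.
assert (pMT := ana_pos r hr _ _ hT).
assert (T0 : T 0 = 0) by (unfold T; rewrite h0; ring).
assert (dT : is_derive T 0 0).
{ replace 0 with (q - q * 1) at 2 by ring.
  apply (is_derive_minus F (fun t => q * t) 0 q (q * 1)); auto.
  apply is_derive_scal. apply (is_derive_id 0). }
set (B := MT / (r * r)). assert (hB : 0 <= B) by (apply Rdiv_le_0_compat; nra).
assert (T2 : forall G g s, 0 < s -> 0 < G <= r -> ana g s G -> ana (fun t => T (g t)) s (B * (G * G))).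
{ intros G g s hs hG hg. apply (ana_comp s hs T g G); auto; [lra|].
  apply (ana_le G _ (MT * (G / r) ^ 2)).
  - unfold B. right. simpl. field. lra.
  - apply ana_small2; auto. }
(* [F] contracts norms near 0 at a rate [p] slightly larger than [q]; [p * p < q] is what makes the
   quadratic error beat the division by [q ^ k]. *)
set (p := (q + sqrt q) / 2).
assert (hsq : sqrt q * sqrt q = q) by (apply sqrt_sqrt; lra).
assert (hsq0 : 0 < sqrt q) by (apply sqrt_lt_R0; lra).
assert (hsq1 : q < sqrt q) by nra.
assert (hp : q < p < 1 /\ p * p < q) by (unfold p; split; nra).
set (r0 := Rmin r ((p - q) / (B + 1))).
assert (hr0 : 0 < r0) by (apply Rmin_pos; auto; apply Rdiv_lt_0_compat; lra).
assert (hr0r : r0 <= r) by apply Rmin_l.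
assert (hr0B : B * r0 <= p - q).
{ apply Rle_trans with ((B + 1) * r0); [nra|].
  apply Rle_trans with ((B + 1) * ((p - q) / (B + 1))).
  - apply Rmult_le_compat_l; [lra|apply Rmin_r].
  - right; field; lra. }
assert (Fstep : forall G g, 0 < G <= r0 -> ana g r0 G -> ana (fun t => F (g t)) r0 (p * G)).
{ intros G g hG hg.
  apply (ana_le r0 _ (Rabs q * G + B * (G * G))).
  - rewrite Rabs_pos_eq by lra. assert (B * G <= p - q) by nra. nra.
  - apply (ana_ext r0 (fun t => q * g t + T (g t))); [intros; unfold T; ring|].
    apply ana_plus; auto.
    + now apply ana_scal.
    + apply T2; auto; lra. }
assert (pk : forall k, 0 < p ^ k <= 1).
{ intro k; split; [apply pow_lt; lra|]. rewrite <- (pow1 k); apply pow_incr; lra. }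
assert (iter : forall k, ana (fun t => Nat.iter k F t) r0 (p ^ k * r0)).
{ induction k as [|k IH].
  - simpl. rewrite Rmult_1_l. now apply ana_id.
  - simpl. rewrite Rmult_assoc. apply (Fstep (p ^ k * r0)); auto. generalize (pk k); nra. }
set (U := fun k t => / q ^ S k * T (Nat.iter k F t)).
set (m := fun s k => / q ^ S k * (B * (p ^ k * s * (p ^ k * s)))).
assert (hpq : 0 < p * p / q < 1).
{ split; [apply Rdiv_lt_0_compat; nra|apply Rlt_div_l; lra]. }
assert (em : forall s k, m s k = B * (s * s) / q * (p * p / q) ^ k).
{ intros s k. unfold m. unfold Rdiv at 2. rewrite Rpow_mult_distr, pow_inv, Rpow_mult_distr.
  simpl. field. split; [apply pow_nonzero|]; lra. }
assert (hm : forall s, is_series (m s) (B * (s * s) / q * / (1 - p * p / q))).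
{ intro s. apply (is_series_ext (fun k => B * (s * s) / q * (p * p / q) ^ k)).
  { intro; now rewrite em. }
  apply (is_series_scal_l (B * (s * s) / q) (fun k => (p * p / q) ^ k)). apply is_series_geom. rewrite Rabs_pos_eq; lra. }
set (W := fun t => Series (fun k => U k t)).
assert (iters : forall s, 0 < s <= r0 -> forall k, ana (fun t => Nat.iter k F t) s (p ^ k * s)).
{ intros s hs k. apply (ana_le s _ (p ^ k * r0 * (s / r0))); [right; field; lra|].
  apply ana_small; auto.
  induction k as [|k IH]; simpl; auto. rewrite IH; auto. }
assert (hU : forall s, 0 < s <= r0 -> forall k, ana (U k) s (m s k)).
{ intros s hs k. unfold U, m.
  assert (pq := pow_lt q (S k) ltac:(lra)).
  apply (ana_le s _ (Rabs (/ q ^ S k) * (B * (p ^ k * s * (p ^ k * s))))).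
  { right. rewrite Rabs_pos_eq; auto. now apply Rlt_le, Rinv_0_lt_compat. }
  apply ana_scal. apply (T2 (p ^ k * s) (fun t => Nat.iter k F t)); auto; try lra.
  generalize (pk k); nra. }
assert (hW : forall s, 0 < s <= r0 -> ana W s (B * (s * s) / q * / (1 - p * p / q))).
{ intros s hs. rewrite <- (is_series_unique _ _ (hm s)).
  apply (ana_series s ltac:(lra) U); auto. eexists; apply hm. }
exists r0, W, (B * (r0 * r0) / q * / (1 - p * p / q)).
set (c := B / q * / (1 - p * p / q)).
assert (hc : 0 <= c).
{ unfold c. apply Rmult_le_pos; [apply Rdiv_le_0_compat; lra|].
  apply Rlt_le, Rinv_0_lt_compat; lra. }
assert (Wb : forall t, 0 < Rabs t <= r0 -> Rabs (W t) <= c * (t * t)).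
{ intros t ht. apply Rle_trans with (1 := ana_bound (Rabs t) W _ (hW (Rabs t) ht) t (Rle_refl _)).
  rewrite <- Rabs_mult, (Rabs_pos_eq (t * t)) by nra. right; unfold c; field; lra. }
assert (F0 : forall k, Nat.iter k F 0 = 0).
{ induction k as [|k IH]; simpl; auto. now rewrite IH. }
assert (W0 : W 0 = 0).
{ unfold W. rewrite (Series_ext _ (fun _ => 0 * 0)).
  - rewrite Series_scal_l; ring.
  - intro k. unfold U. rewrite F0, T0; ring. }
split; [lra|]. split; [apply hW; lra|]. split; auto. split.
(* The bound of [W t] by [c * (t * t)] excludes a nonzero linear coefficient. *)
- destruct (hW r0 ltac:(lra)) as [a [[l [h1 h1']] h2]].
  destruct (ana_coef W r0 a l hr0 h1 h2) as [_ d1].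
  assert (a 1%nat = 0); [|congruence].
  apply NNPP. intro hne.
  assert (ha : 0 < Rabs (a 1%nat)) by now apply Rabs_pos_lt.
  apply is_derive_Reals in d1.
  destruct (d1 (Rabs (a 1%nat) / 2) ltac:(lra)) as [e he].
  set (t := Rmin (Rmin (e / 2) r0) (Rabs (a 1%nat) / (4 * (c + 1)))).
  assert (pe := cond_pos e).
  assert (ht : 0 < t) by (unfold t; repeat apply Rmin_pos; try lra; apply Rdiv_lt_0_compat; lra).
  assert (t1 : t <= e / 2) by (unfold t; eapply Rle_trans; [apply Rmin_l|apply Rmin_l]).
  assert (t2 : t <= r0) by (unfold t; eapply Rle_trans; [apply Rmin_l|apply Rmin_r]).
  assert (t3 : t * (4 * (c + 1)) <= Rabs (a 1%nat)).
  { apply Rle_trans with (Rabs (a 1%nat) / (4 * (c + 1)) * (4 * (c + 1))).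
    - apply Rmult_le_compat_r; [lra|apply Rmin_r].
    - right; field; lra. }
  specialize (he t ltac:(lra) ltac:(rewrite Rabs_pos_eq; lra)).
  rewrite Rplus_0_l, W0, Rminus_0_r in he.
  assert (wb := Wb t ltac:(rewrite Rabs_pos_eq; lra)).
  assert (wb' : Rabs (W t / t) <= c * t).
  { unfold Rdiv. rewrite Rabs_mult, Rabs_inv, (Rabs_pos_eq t) by lra.
    apply Rle_div_l; nra. }
  assert (tri : Rabs (a 1%nat) <= Rabs (W t / t) + Rabs (W t / t - a 1%nat)).
  { replace (a 1%nat) with (W t / t - (W t / t - a 1%nat)) at 1 by ring.
    unfold Rminus at 1. apply Rle_trans with (1 := Rabs_triang _ _). rewrite Rabs_Ropp; lra. }
  nra.
- intros t ht.
  assert (hFt : Rabs (F t) <= r0).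
  { apply Rle_trans with (p * r0); [|nra].
    apply (ana_bound r0 F (p * r0)); auto.
    apply (Fstep r0 (fun t => t)); [lra|now apply ana_id]. }
  split; auto.
  assert (ex : ex_series (fun k => U k t)).
  { apply ex_series_Rabs.
    apply (ex_series_le (fun k => Rabs (U k t)) (m r0)).
    - intro k. unfold norm; simpl; unfold abs; simpl. rewrite Rabs_Rabsolu.
      apply (ana_bound r0 (U k)); auto. apply hU; lra.
    - eexists; apply hm. }
  unfold W. rewrite (Series_incr_1 (fun k => U k t)) by auto.
  rewrite (Series_ext (fun k => U k (F t)) (fun k => q * U (S k) t)).
  + rewrite Series_scal_l. unfold U at 2, T. simpl. field. lra.
  + intro k. unfold U. rewrite Nat.iter_succ_r. simpl. field. split; [apply pow_nonzero|]; lra.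
Qed.

(** * Real analytic functions and linearization *)

Lemma ana_analytic_at (f : R -> R) (x r M : R) : 0 < r ->
  ana (fun t => f (x + t)) r M -> analytic_at f x.
Proof.
intros hr [a [_ h]]. exists a. apply (locally_Rabs x r); auto.
intros y hy. apply is_pseries_R.
replace (f y) with (f (x + (y - x))) by (f_equal; ring). apply h; lra.
Qed.

(** Convergence at [t0] bounds the terms there by some [B]; at half that radius the norm is
    dominated by a geometric series. *)
Lemma analytic_at_ana (f : R -> R) (x : R) : analytic_at f x ->
  exists r M, 0 < r /\ ana (fun t => f (x + t)) r M.
Proof.
intros [a h]. apply locally_Rabs_inv in h. destruct h as [e [he h]].
assert (hs : forall t, Rabs t < e -> is_series (fun n => a n * t ^ n) (f (x + t))).
{ intros t ht. apply is_pseries_R. specialize (h (x + t)).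
  replace (x + t - x) with t in h by ring. auto. }
set (t0 := e / 2). assert (ht0 : 0 < t0 < e) by (unfold t0; lra).
assert (hb : exists B, forall n, Rabs (a n * t0 ^ n) <= B).
{ assert (l0 : is_lim_seq (fun n => a n * t0 ^ n) 0).
  { apply ex_series_lim_0. eexists; apply hs. rewrite Rabs_pos_eq; lra. }
  apply is_lim_seq_spec in l0. destruct (l0 (mkposreal 1 ltac:(lra))) as [N hN].
  assert (hfin : forall N, exists B, forall n, (n < N)%nat -> Rabs (a n * t0 ^ n) <= B).
  { induction N0 as [|N0 [B IH]]; [exists 0; lia|].
    exists (Rmax B (Rabs (a N0 * t0 ^ N0))). intros n hn.
    destruct (Nat.eq_dec n N0) as [->|]; [apply Rmax_r|].
    apply Rle_trans with B; [apply IH; lia|apply Rmax_l]. }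
  destruct (hfin N) as [B hB]. exists (Rmax B 1). intro n.
  destruct (le_lt_dec N n) as [c|c].
  - specialize (hN n c). simpl in hN. rewrite Rminus_0_r in hN.
    apply Rle_trans with 1; [lra|apply Rmax_r].
  - apply Rle_trans with B; [auto|apply Rmax_l]. }
destruct hb as [B hB].
set (r := t0 / 2). assert (hr : 0 < r) by (unfold r; lra).
assert (hB0 : 0 <= B) by (apply Rle_trans with (2 := hB 0%nat); apply Rabs_pos).
exists r, (B * / (1 - 1 / 2)). split; auto. exists a. split.
- apply ex_series_pos_bounded.
  + intro n; apply Rmult_le_pos; [apply Rabs_pos|apply pow_le; lra].
  + assert (hg : is_series (fun n => B * (1 / 2) ^ n) (B * / (1 - 1 / 2))).
    { apply (is_series_scal_l B (fun n => (1 / 2) ^ n)). apply is_series_geom.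
      rewrite Rabs_pos_eq; lra. }
    intro N. apply Rle_trans with (sum_n (fun n => B * (1 / 2) ^ n) N).
    * apply sum_n_R_le. intro n.
      replace (Rabs (a n) * r ^ n) with (Rabs (a n * t0 ^ n) * (1 / 2) ^ n).
      -- apply Rmult_le_compat_r; auto. apply pow_le; lra.
      -- rewrite Rabs_mult, (Rabs_pos_eq (t0 ^ n)) by (apply pow_le; lra).
         unfold r. replace (t0 / 2) with (t0 * (1 / 2)) by field.
         rewrite Rpow_mult_distr. ring.
    * apply is_series_sum_le; auto. intro n. apply Rmult_le_pos; auto. apply pow_le; lra.
- intros t ht. apply hs. unfold r in ht; lra.
Qed.

Lemma analytic_at_ext (f g : R -> R) (x : R) : locally x (fun y => f y = g y) ->
  analytic_at f x -> analytic_at g x.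
Proof.
intros h [a ha]. exists a. generalize (filter_and _ _ h ha).
apply filter_imp. intros y [e hy]. now rewrite <- e.
Qed.

(* Shrinking the interval makes the norm of the inner series, whose constant
   term vanishes, smaller than the radius of the outer one. *)
Lemma analytic_at_comp (f g : R -> R) (x : R) : analytic_at f (g x) -> analytic_at g x ->
  analytic_at (fun t => f (g t)) x.
Proof.
intros hf hg.
destruct (analytic_at_ana f _ hf) as (rho & M & hrho & af).
destruct (analytic_at_ana g _ hg) as (r & M' & hr & ag).
set (g0 := fun t => g (x + t) - g x).
assert (ag0 : ana g0 r (M' + Rabs (- g x))).
{ apply ana_plus; auto. apply ana_const. }
set (M0 := M' + Rabs (- g x)) in *. assert (pM := ana_pos r hr _ _ ag0).
set (s := Rmin r (rho * r / (M0 + 1))).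
assert (hs : 0 < s) by (apply Rmin_pos; auto; apply Rdiv_lt_0_compat; nra).
assert (hsr : s <= r) by apply Rmin_l.
assert (hsM : s * (M0 + 1) <= rho * r).
{ apply Rle_trans with (rho * r / (M0 + 1) * (M0 + 1)).
  - apply Rmult_le_compat_r; [lra|apply Rmin_r].
  - right; field; lra. }
apply (ana_analytic_at _ x s M hs).
apply (ana_ext s (fun t => (fun u => f (g x + u)) (g0 t))).
{ intros t _. unfold g0. f_equal. ring. }
apply (ana_comp s hs (fun u => f (g x + u)) g0 rho); auto.
apply (ana_le s _ (M0 * (s / r))).
{ replace (M0 * (s / r)) with (s * M0 / r) by (field; lra). apply Rle_div_l; nra. }
apply ana_small; auto. unfold g0. rewrite Rplus_0_r; ring.
Qed.

(** Re-expansion around [x]: the translation by [x] has norm at most [Rabs x + s = r] at radius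
    [s]. *)
Lemma ana_analytic_inside (f : R -> R) (r M x : R) : ana f r M -> Rabs x < r -> analytic_at f x.
Proof.
intros h hx. set (s := r - Rabs x).
assert (hs : 0 < s) by (unfold s; lra). assert (px := Rabs_pos x).
apply (ana_analytic_at f x s M hs).
apply (ana_comp s hs f (fun t => x + t) r); auto; [unfold s in hs; lra|].
apply (ana_le s _ (Rabs x + s)); [unfold s; lra|].
apply ana_plus; auto; [apply ana_const|apply ana_id].
Qed.

Lemma analytic_at_affine (c d x : R) : analytic_at (fun t => c * t + d) x.
Proof.
apply (ana_analytic_at _ x 1 (Rabs c * 1 + Rabs (c * x + d)) ltac:(lra)).
apply (ana_ext 1 (fun t => c * t + (c * x + d))); [intros; ring|].
apply ana_plus; [lra| |apply ana_const]. apply ana_scal, ana_id.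
Qed.

Lemma analytic_at_minus_id (f : R -> R) (x : R) : analytic_at f x ->
  analytic_at (fun t => f t - t) x.
Proof.
intro h. destruct (analytic_at_ana f x h) as (r & M & hr & a).
apply (ana_analytic_at _ x r (M + (Rabs (-1) * r + Rabs (- x))) hr).
apply (ana_ext r (fun t => f (x + t) + (-1 * t + - x))); [intros; ring|].
apply ana_plus; auto. apply ana_plus; auto; [apply ana_scal, ana_id|apply ana_const].
Qed.

Lemma analytic_ex_derive_n (f : R -> R) (x : R) : analytic_at f x ->
  forall n, ex_derive_n f n x.
Proof.
intros h n. destruct (analytic_at_ana f x h) as (r & M & hr & [a [[l [h1 _]] h2]]).
apply (ex_derive_n_ext_loc (fun y => PSeries a (y + - x))).
- apply (locally_Rabs x r); auto. intros y hy.
  replace (f y) with (f (x + (y + - x))) by (f_equal; ring).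
  apply is_series_unique, h2. unfold Rminus in hy; lra.
- apply (ex_derive_n_comp_trans (PSeries a) n x (- x)).
  apply ex_derive_n_PSeries. apply (ana_radius a r l); auto.
  rewrite Rplus_opp_r, Rabs_R0; auto.
Qed.

Lemma analytic_ex_derive (f : R -> R) (x : R) : analytic_at f x -> ex_derive f x.
Proof. intro h. apply (analytic_ex_derive_n f x h 1). Qed.

Lemma analytic_continuous (f : R -> R) (x : R) : analytic_at f x -> continuous f x.
Proof. intro h. apply (ex_derive_continuous f). now apply analytic_ex_derive. Qed.

(* Isolated zeros: if a_0, ..., a_(n-1) vanish, then f(t) = t^n (a_n + O(t)). *)
Lemma ana_zeros (f : R -> R) (r M : R) : 0 < r -> ana f r M ->
  (forall e, 0 < e -> exists t, 0 < Rabs t < e /\ f t = 0) ->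
  forall t, Rabs t <= r -> f t = 0.
Proof.
intros hr [a [[l [h1 h1']] h2]] hz.
assert (pa : forall k, 0 <= Rabs (a k) * r ^ k).
{ intro k; apply Rmult_le_pos; [apply Rabs_pos|apply pow_le; lra]. }
assert (ha : forall n, a n = 0).
{ induction n as [n IH] using (well_founded_induction lt_wf).
  set (g := PSeries (fun k => a (n + k)%nat)).
  assert (cg : continuous g 0).
  { apply continuity_pt_filterlim, PSeries_continuity.
    destruct (ex_series_pos_bounded (fun k => Rabs (a (n + k)%nat) * r ^ k) (l / r ^ n))
      as [l' [e1 _]].
    - intro k; apply Rmult_le_pos; [apply Rabs_pos|apply pow_le; lra].
    - intro N. assert (pn := pow_lt r n hr). apply Rle_div_r; auto.
      assert (hN : forall N, sum_n (fun k => Rabs (a (n + k)%nat) * r ^ k) N * r ^ n <=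
        sum_n (fun k => Rabs (a k) * r ^ k) (n + N)).
      { induction N0 as [|N0 IH0].
        - rewrite sum_O, Nat.add_0_r, pow_O, Rmult_1_r.
          destruct n as [|n]; [rewrite sum_O; simpl; lra|].
          rewrite sum_Sn. unfold plus; simpl.
          assert (0 <= sum_n (fun k => Rabs (a k) * r ^ k) n); [|simpl; lra].
          apply Rle_trans with (sum_n (fun _ => 0) n); [rewrite sum_n_const; lra|].
          now apply sum_n_R_le.
        - assert (e : Rabs (a (n + S N0)%nat) * r ^ S N0 * r ^ n =
            Rabs (a (S (n + N0))) * r ^ S (n + N0)).
          { rewrite Nat.add_succ_r, Rmult_assoc, <- pow_add. do 2 f_equal; lia. }
          rewrite (Nat.add_succ_r n N0), !sum_Sn.
          change (((sum_n (fun k => Rabs (a (n + k)%nat) * r ^ k) N0) +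
            Rabs (a (n + S N0)%nat) * r ^ S N0) * r ^ n <=
            sum_n (fun k => Rabs (a k) * r ^ k) (n + N0) +
              Rabs (a (S (n + N0))) * r ^ S (n + N0)).
          rewrite <- e. lra. }
      apply Rle_trans with (1 := hN N). apply is_series_sum_le; auto.
    - apply (ana_radius _ r l'); auto. rewrite Rabs_R0; auto. }
  assert (eg : forall t, Rabs t <= r -> f t = t ^ n * g t).
  { intros t ht. rewrite <- (is_series_unique _ _ (h2 t ht)).
    rewrite (Series_incr_n_aux _ n).
    2:{ intros k hk. rewrite (IH k hk); ring. }
    unfold g, PSeries. rewrite <- Series_scal_l. apply Series_ext. intro k.
    rewrite pow_add; ring. }
  apply NNPP. intro hne.
  assert (g0 : g 0 = a n) by (unfold g; rewrite PSeries_0, Nat.add_0_r; auto).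
  assert (hp : 0 < Rabs (a n)) by now apply Rabs_pos_lt.
  assert (cg' := proj1 (filterlim_locally _ _) cg (mkposreal _ hp)).
  apply locally_Rabs_inv in cg'. destruct cg' as [e [he hc]].
  destruct (hz (Rmin e r) ltac:(now apply Rmin_pos)) as [t [ht hft]].
  assert (m1 := Rmin_l e r). assert (m2 := Rmin_r e r).
  specialize (hc t ltac:(rewrite Rminus_0_r; lra)).
  rewrite eg in hft by lra. apply Rmult_integral in hft.
  destruct hft as [hft|hft].
  - revert hft. apply pow_nonzero. intro ht0. rewrite ht0, Rabs_R0 in ht; lra.
  - change (Rabs (g t - g 0) < Rabs (a n)) in hc.
    rewrite hft, g0, Rabs_minus_sym, Rminus_0_r in hc. lra. }
intros t ht. rewrite <- (is_series_unique _ _ (h2 t ht)).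
rewrite (Series_ext _ (fun _ => 0 * 0)).
- rewrite Series_scal_l; ring.
- intro k. rewrite ha; ring.
Qed.

Lemma identity_principle (f : R -> R) (p : R) : (forall x, analytic_at f x) ->
  (forall e, 0 < e -> exists x, 0 < Rabs (x - p) < e /\ f x = 0) -> forall x, f x = 0.
Proof.
intros hf hz.
assert (loc : forall q, (forall e, 0 < e -> exists x, 0 < Rabs (x - q) < e /\ f x = 0) ->
  exists e, 0 < e /\ forall x, Rabs (x - q) <= e -> f x = 0).
{ intros q hq. destruct (analytic_at_ana f q (hf q)) as (r & M & hr & a).
  exists r; split; auto. intros x hx.
  replace x with (q + (x - q)) by ring.
  apply (ana_zeros (fun t => f (q + t)) r M hr a); auto.
  intros e he. destruct (hq e he) as [y [hy ey]]. exists (y - q). split; auto.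
  replace (q + (y - q)) with y by ring; auto. }
(* zeros propagate to both sides by a supremum argument *)
assert (right : forall g q, (forall q, (forall e, 0 < e ->
    exists x, 0 < Rabs (x - q) < e /\ g x = 0) ->
    exists e, 0 < e /\ forall x, Rabs (x - q) <= e -> g x = 0) ->
  (forall e, 0 < e -> exists x, 0 < Rabs (x - q) < e /\ g x = 0) ->
  forall x, q <= x -> g x = 0).
{ intros g q hloc hq x hx. apply NNPP. intro hne.
  destruct (hloc q hq) as [e0 [he0 h0]].
  set (E := fun y => q <= y /\ forall z, q <= z <= y -> g z = 0).
  destruct (completeness E) as [m [ub lub]].
  - exists x. intros y [hy1 hy2]. destruct (Rle_lt_dec y x); auto.
    exfalso. apply hne, hy2; lra.
  - exists q. split; [lra|]. intros z hz'. apply h0. replace (z - q) with 0 by lra.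
    rewrite Rabs_R0; lra.
  - assert (hm0 : q + e0 <= m).
    { apply ub. split; [lra|]. intros z hz'. apply h0. rewrite Rabs_pos_eq; lra. }
    assert (below : forall z, q <= z < m -> g z = 0).
    { intros z hz'. apply NNPP. intro c. assert (m <= z); [|lra].
      apply lub. intros y [hy1 hy2]. destruct (Rle_lt_dec y z); auto.
      exfalso. apply c, hy2; lra. }
    destruct (hloc m) as [e1 [he1 h1]].
    { intros e he. exists (m - Rmin (e / 2) e0).
      assert (a1 := Rmin_l (e / 2) e0). assert (a2 := Rmin_r (e / 2) e0).
      assert (0 < Rmin (e / 2) e0) by (apply Rmin_pos; lra).
      split; [rewrite Rabs_left; lra|]. apply below; lra. }
    assert (m + e1 <= m); [|lra].
    apply ub. split; [lra|]. intros z hz'.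
    destruct (Rlt_le_dec z m); [apply below; lra|]. apply h1. rewrite Rabs_pos_eq; lra. }
intro x. destruct (Rle_lt_dec p x) as [c|c].
- now apply (right f p).
- replace x with (- (- x)) by ring. apply (right (fun t => f (- t)) (- p)); try lra.
  + intros q hq. destruct (loc (- q)) as [e [he h]].
    * intros e he. destruct (hq e he) as [y [hy ey]]. exists (- y). split; auto.
      replace (- y - - q) with (- (y - q)) by ring. now rewrite Rabs_Ropp.
    * exists e; split; auto. intros y hy. apply h.
      replace (- y - - q) with (- (y - q)) by ring. now rewrite Rabs_Ropp.
  + intros e he. destruct (hz e he) as [y [hy ey]]. exists (- y). split.
    * replace (- y - - p) with (- (y - p)) by ring. now rewrite Rabs_Ropp.
    * now rewrite Ropp_involutive.
Qed.

(* F is y |-> q y in the coordinate L = P^-1. *)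
Record linearizing (F : R -> R) (p q e : R) (P L : R -> R) : Prop := {
  lz_e : 0 < e;
  lz_0 : P 0 = p;
  lz_P : forall y, Rabs y <= e -> analytic_at P y;
  lz_D : forall y, Rabs y <= e -> is_derive P y (Derive P y) /\ / 2 <= Derive P y <= 2;
  lz_L : forall y, Rabs y <= e -> L (P y) = y /\ analytic_at L (P y) /\
    Derive L (P y) = / Derive P y;
  lz_F : forall y, Rabs y <= e -> F (P y) = P (q * y);
  lz_loc : exists d, 0 < d /\ forall x, Rabs (x - p) <= d ->
    Rabs (L x) <= e /\ P (L x) = x }.

(** [L] is the Koenigs coordinate id + W centred at [p], and [P] its inverse. Since [W] is
    1/2-Lipschitz near 0, L' lies in [1/2, 3/2], whence the bounds on P'. *)
Lemma linearization (F : R -> R) (p q : R) : analytic_at F p -> F p = p ->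
  is_derive F p q -> 0 < q < 1 -> exists e P L, linearizing F p q e P L.
Proof.
intros hF hp hd hq.
destruct (analytic_at_ana F p hF) as (r & M & hr & aF).
set (F0 := fun t => F (p + t) - p).
assert (aF0 : ana F0 r (M + Rabs (- p))).
{ apply ana_plus; auto. apply ana_const. }
assert (F00 : F0 0 = 0) by (unfold F0; rewrite Rplus_0_r, hp; ring).
assert (dF0 : is_derive F0 0 q).
{ replace q with (q - 0) by ring.
  apply (is_derive_minus (fun t => F (p + t)) (fun _ => p) 0 q 0).
  - replace q with (1 * q) by ring.
    apply (is_derive_comp F (fun t => p + t) 0 q 1).
    + now rewrite Rplus_0_r.
    + replace 1 with (0 + 1) by ring.
      apply (is_derive_plus (fun _ => p) (fun t => t) 0 0 1).
      * apply (is_derive_const p 0).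
      * apply (is_derive_id 0).
  - apply (is_derive_const p 0). }
destruct (ana_koenigs F0 r _ q hr aF0 F00 hq dF0) as (r0 & W & M' & hr0 & aW & W0 & dW & hW).
destruct (ana_inverse W r0 M' (proj1 hr0) aW W0 dW) as (rho & s & P0 & hrho & hs & aP & eP & uP & lipW).
assert (P00 : P0 0 = 0).
{ apply uP; rewrite ?Rabs_R0; try lra. }
(* [s / 2] leaves room for neighbourhoods in the domain of [P0]; [rho / 4] keeps the values [P0 y],
   of size at most [2 * e], well inside the ball where [W] is 1/2-Lipschitz. *)
set (e := Rmin (s / 2) (rho / 4)).
assert (he : 0 < e) by (apply Rmin_pos; lra).
assert (he1 : e <= s / 2) by apply Rmin_l.
assert (he2 : e <= rho / 4) by apply Rmin_r.
assert (bP : forall y, Rabs y <= s -> Rabs (P0 y) <= rho) by (apply (ana_bound s _ _ aP)).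
assert (b2 : forall y, Rabs y <= s -> Rabs (P0 y) <= 2 * Rabs y).
{ intros y hy. assert (z := lipW (P0 y) 0 (bP y hy) ltac:(rewrite Rabs_R0; lra)).
  rewrite W0, !Rminus_0_r in z. assert (z2 := eP y hy).
  assert (z3 : Rabs (P0 y) <= Rabs y + Rabs (W (P0 y))).
  { replace (P0 y) with (y + - W (P0 y)) at 1 by lra.
    apply Rle_trans with (1 := Rabs_triang _ _). rewrite Rabs_Ropp; lra. }
  lra. }
exists e, (fun y => p + P0 y), (fun x => (x - p) + W (x - p)).
assert (ananP : forall y, Rabs y <= e -> analytic_at (fun y => p + P0 y) y).
{ intros y hy. apply (analytic_at_ext (fun y => 1 * P0 y + p)).
  { exists (mkposreal 1 ltac:(lra)). intros; ring. }
  apply (analytic_at_comp (fun t => 1 * t + p) P0).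
  - apply analytic_at_affine.
  - apply (ana_analytic_inside P0 s rho); auto; lra. }
assert (aWi : forall x, Rabs x <= 2 * e -> analytic_at (fun x => x + W x) x).
{ intros x hx. apply (ana_analytic_inside _ r0 (r0 + M')); [|lra].
  apply ana_plus; auto; [lra|apply ana_id]. }
assert (ananL : forall y, Rabs y <= e ->
  analytic_at (fun x => (x - p) + W (x - p)) (p + P0 y)).
{ intros y hy. apply (analytic_at_comp (fun t => t + W t) (fun x => x - p)).
  - replace (p + P0 y - p) with (P0 y) by ring. apply aWi.
    specialize (b2 y ltac:(lra)); lra.
  - apply (analytic_at_ext (fun x => 1 * x + (- p))).
    { exists (mkposreal 1 ltac:(lra)). intros; ring. }
    apply analytic_at_affine. }
assert (LP : forall y, Rabs y <= s -> (p + P0 y - p) + W (p + P0 y - p) = y).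
{ intros y hy. replace (p + P0 y - p) with (P0 y) by ring. now apply eP. }
assert (derivs : forall y, Rabs y <= e ->
  Derive (fun x => (x - p) + W (x - p)) (p + P0 y) * Derive (fun y => p + P0 y) y = 1 /\
  1 / 2 <= Derive (fun x => (x - p) + W (x - p)) (p + P0 y) <= 3 / 2).
{ intros y hy.
  assert (dL := Derive_correct _ _ (analytic_ex_derive _ _ (ananL y hy))).
  assert (dP := Derive_correct _ _ (analytic_ex_derive _ _ (ananP y hy))).
  split.
  - assert (dc := is_derive_comp _ _ y _ _ dL dP).
    assert (di : is_derive (fun x => p + P0 x - p + W (p + P0 x - p)) y 1).
    { apply (is_derive_ext_loc (fun t => t)).
      - apply (locally_Rabs y e); auto. intros t ht. symmetry. apply LP.
        replace t with (t - y + y) by ring. apply Rle_trans with (1 := Rabs_triang _ _). lra.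
      - apply (is_derive_id y). }
    rewrite Rmult_comm. rewrite <- (is_derive_unique _ _ _ di).
    symmetry. exact (is_derive_unique _ _ _ dc).
  - set (D := Derive _ _) in *.
    destruct (Rle_lt_dec (Rabs (D - 1)) (1 / 2)) as [c|c].
    { apply Rabs_le_between in c; lra. }
    exfalso. apply is_derive_Reals in dL.
    destruct (dL (Rabs (D - 1) - 1 / 2) ltac:(lra)) as [dl hdl].
    set (h := Rmin (dl / 2) (rho / 4)). assert (pdl := cond_pos dl).
    assert (chart_H : 0 < h) by (apply Rmin_pos; lra).
    assert (hh1 : h <= dl / 2) by apply Rmin_l. assert (hh2 : h <= rho / 4) by apply Rmin_r.
    specialize (hdl h ltac:(lra) ltac:(rewrite Rabs_pos_eq; lra)).
    replace (p + P0 y + h - p) with (P0 y + h) in hdl by ring.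
    replace (p + P0 y - p) with (P0 y) in hdl by ring.
    specialize (b2 y ltac:(lra)).
    assert (z := lipW (P0 y + h) (P0 y)).
    assert (Rabs (P0 y + h) <= rho).
    { apply Rle_trans with (1 := Rabs_triang _ _). rewrite (Rabs_pos_eq h); lra. }
    specialize (z H ltac:(lra)). replace (P0 y + h - P0 y) with h in z by ring.
    rewrite (Rabs_pos_eq h) in z by lra.
    replace ((P0 y + h + W (P0 y + h) - (P0 y + W (P0 y))) / h - D) with
      ((W (P0 y + h) - W (P0 y)) / h - (D - 1)) in hdl by (field; lra).
    assert (z' : Rabs ((W (P0 y + h) - W (P0 y)) / h) <= 1 / 2).
    { unfold Rdiv at 1. rewrite Rabs_mult, Rabs_inv, (Rabs_pos_eq h) by lra.
      apply Rle_div_l; lra. }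
    assert (tri : Rabs (D - 1) <= Rabs ((W (P0 y + h) - W (P0 y)) / h) +
      Rabs ((W (P0 y + h) - W (P0 y)) / h - (D - 1))).
    { set (X := (W (P0 y + h) - W (P0 y)) / h) in *.
      replace (D - 1) with (X + - (X - (D - 1))) at 1 by ring.
      apply Rle_trans with (1 := Rabs_triang _ _). rewrite Rabs_Ropp; lra. }
    lra. }
constructor; auto.
- rewrite P00; ring.
- intros y hy. split.
  + apply Derive_correct. now apply analytic_ex_derive, ananP.
  + destruct (derivs y hy) as [d1 d2].
    set (D := Derive _ (p + P0 y)) in *. set (D' := Derive _ y) in *. nra.
- intros y hy. split; [apply LP; lra|]. split; [now apply ananL|].
  destruct (derivs y hy) as [d1 d2].
  set (D := Derive _ (p + P0 y)) in *. set (D' := Derive _ y) in *.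
  assert (D' <> 0) by nra. field_simplify_eq; lra.
- intros y hy.
  destruct (hW (P0 y)) as [w1 w2].
  { specialize (bP y ltac:(lra)); lra. }
  rewrite eP in w2 by lra.
  assert (hqy : Rabs (q * y) <= e) by (rewrite Rabs_mult, (Rabs_pos_eq q) by lra; generalize (Rabs_pos y); nra).
  (* The inverse is unique only in the ball of radius [rho], so [F0 (P0 y)] must be located there.
     Otherwise its size would equal [rho] at some point of the segment from 0 to [y], where the
     functional equation forces a size at most [2 * q * e < rho]. *)
  assert (hsmall : Rabs (F0 (P0 y)) <= rho).
  { destruct (Rle_lt_dec (Rabs (F0 (P0 y))) rho) as [c|c]; auto. exfalso.
    assert (z := bP y ltac:(lra)).
    assert (cont : forall t, Rabs t <= e -> continuity_pt (fun t => Rabs (F0 (P0 t)) - rho) t).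
    { intros t ht. apply continuity_pt_minus; [|apply continuity_pt_const; intros ? ?; auto].
      apply (continuity_pt_comp (fun t => F0 (P0 t)) Rabs); [|apply Rcontinuity_abs].
      apply (continuity_pt_comp P0 F0).
      - apply continuity_pt_filterlim, analytic_continuous.
        apply (ana_analytic_inside P0 s rho); auto; lra.
      - apply continuity_pt_filterlim, analytic_continuous.
        apply (ana_analytic_inside F0 r _ _ aF0).
        specialize (b2 t ltac:(lra)); lra. }
    destruct (Ranalysis5.IVT_interv (fun u => Rabs (F0 (P0 (u * y))) - rho) 0 1) as [u [hu eu]].
    - intros u hu. apply (continuity_pt_comp (fun u => u * y) (fun t => Rabs (F0 (P0 t)) - rho)).
      + apply continuity_pt_mult; [apply derivable_continuous_pt, derivable_pt_id|].
        apply continuity_pt_const; intros ? ?; auto.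
      + apply cont. rewrite Rabs_mult, (Rabs_pos_eq u) by lra. generalize (Rabs_pos y); nra.
    - lra.
    - rewrite Rmult_0_l, P00, F00, Rabs_R0; lra.
    - rewrite Rmult_1_l; lra.
    - assert (huy : Rabs (u * y) <= e).
      { rewrite Rabs_mult, (Rabs_pos_eq u) by lra. generalize (Rabs_pos y); nra. }
      assert (eu' : Rabs (F0 (P0 (u * y))) = rho) by lra.
      destruct (hW (P0 (u * y))) as [_ v2].
      { specialize (bP (u * y) ltac:(lra)); lra. }
      rewrite eP in v2 by lra.
      assert (v3 := lipW (F0 (P0 (u * y))) 0 ltac:(lra) ltac:(rewrite Rabs_R0; lra)).
      rewrite W0, !Rminus_0_r in v3.
      assert (v4 : Rabs (F0 (P0 (u * y))) <= Rabs (q * (u * y)) + Rabs (W (F0 (P0 (u * y))))).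
      { replace (F0 (P0 (u * y))) with (q * (u * y) + - W (F0 (P0 (u * y)))) at 1 by lra.
        apply Rle_trans with (1 := Rabs_triang _ _). rewrite Rabs_Ropp; lra. }
      rewrite Rabs_mult, (Rabs_pos_eq q) in v4 by lra.
      generalize (Rabs_pos (u * y)); nra. }
  assert (e1 := uP (F0 (P0 y)) (q * y) hsmall ltac:(lra) w2).
  rewrite e1. unfold F0. ring.
- exists (e / 2). split; [lra|]. intros x hx.
  assert (z := lipW (x - p) 0 ltac:(lra) ltac:(rewrite Rabs_R0; lra)).
  rewrite W0, !Rminus_0_r in z.
  assert (hL : Rabs (x - p + W (x - p)) <= e).
  { apply Rle_trans with (1 := Rabs_triang _ _); lra. }
  split; auto.
  rewrite (uP (x - p) (x - p + W (x - p))); try lra.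
Qed.

(** * Transfer of expansion through a conjugacy *)

(* An interval K [a, b] becomes macroscopic after about log (1 / (K b - K a))
   expanding steps, and meanwhile [a, b] grows at most exponentially. *)
Lemma geometric_modulus_of_expanding (K Ki : R -> R) (X : list (R -> R)) (mu rho : R) :
  line_homeo K Ki -> expanding X ids ids mu rho ->
  (forall e, In e X -> deg1 e /\ log_lipschitz ids ids e /\ log_lipschitz Ki K e) -> geometric_modulus K.
Proof.
intros LK (hmu & hrho & hexp) hX q C hq hC.
assert (LK' := line_homeo_sym K Ki LK).
destruct LK as (dK & dKi & KKi & KiK).
destruct (list_uniform (fun e M => forall y, dv ids ids e y <= M /\ dv Ki K e y <= M) X)
  as [M [hM1 hM]].
{ intros s N N' hN h y. specialize (h y). lra. }
{ intros e he. destruct (hX e he) as (de & s1 & s2).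
  destruct (dv_bounded ids ids ids_line_homeo e de s1) as [M1 [_ h1]].
  destruct (dv_bounded Ki K LK' e de s2) as [M2 [_ h2]].
  exists (Rmax M1 M2). intro y. split.
  - apply Rle_trans with (1 := h1 y), Rmax_l.
  - apply Rle_trans with (1 := h2 y), Rmax_r. }
assert (hM2 : 1 < M).
{ destruct (hexp 0) as [e [he h]]. generalize (h 0 ltac:(lra)) (proj1 (hM e he 0)); lra. }
set (r1 := rho / M).
assert (hr1 : 0 < r1) by (apply Rdiv_lt_0_compat; lra).
assert (hr1' : M * r1 = rho) by (unfold r1; field; lra).
destruct (line_homeo_unif K Ki (line_homeo_sym Ki K LK') r1 hr1) as [c [hc hunif]].
assert (hlong : forall a b, a < b -> r1 < K b - K a -> c <= b - a).
{ intros a b hab h. destruct (Rle_lt_dec c (b - a)); auto. exfalso.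
  assert (z := hunif b a ltac:(rewrite Rabs_pos_eq; lra)).
  rewrite Rabs_pos_eq in z; lra. }
set (B := Rmax rho (C + 2)).
assert (hBr : rho <= B) by apply Rmax_l. assert (hBC : C + 2 <= B) by apply Rmax_r.
assert (step : forall n a b, a < b -> K b - K a <= r1 -> r1 < mu ^ n * (K b - K a) ->
  exists k, mu ^ k * (K b - K a) <= rho /\ c <= M ^ k * (b - a)).
{ induction n as [|n IH]; intros a b hab h1 h2; [simpl in h2; lra|].
  assert (hK := proj1 dK a b hab).
  destruct (hexp (K a)) as [e [he hme]]. destruct (hX e he) as (de & s1 & s2).
  destruct (dv_mvt ids ids ids_line_homeo e (K a) (K b) s1 ltac:(lra)) as [t [ht et]].
  change (e (K b) - e (K a) = dv ids ids e t * (K b - K a)) in et.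
  assert (b1 := hme t ltac:(nra)). assert (b2 := proj1 (hM e he t)).
  destruct (dv_mvt Ki K LK' e (K a) (K b) s2 ltac:(lra)) as [t' [ht' et']].
  rewrite !KiK in et'.
  assert (b3 := proj2 (hM e he t')).
  set (a' := Ki (e (K a))) in *. set (b' := Ki (e (K b))) in *.
  assert (hab' : a' < b') by (apply dKi, de, dK; auto).
  assert (ea : K a' = e (K a)) by apply KKi. assert (eb : K b' = e (K b)) by apply KKi.
  assert (hA : b' - a' <= M * (b - a)) by nra.
  assert (hB1 : mu * (K b - K a) <= e (K b) - e (K a)) by nra.
  assert (hB2 : e (K b) - e (K a) <= rho) by nra.
  destruct (Rlt_le_dec r1 (e (K b) - e (K a))) as [g|g].
  - exists 1%nat. rewrite !pow_1. split; [lra|].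
    assert (z := hlong a' b' hab' ltac:(lra)). lra.
  - destruct (IH a' b' hab') as [k [k1 k2]]; [lra| |].
    { rewrite ea, eb. simpl in h2. assert (p := pow_lt mu n ltac:(lra)). nra. }
    exists (S k). simpl. assert (p := pow_lt mu k ltac:(lra)).
    assert (p' := pow_lt M k ltac:(lra)). rewrite ea, eb in k1. split; nra. }
assert (key : forall a b, a < b -> b - a <= C -> exists k,
  mu ^ k * (K b - K a) <= B /\ Rmin c 1 <= M ^ k * (b - a) \/
  K b - K a <= B /\ c <= b - a).
{ intros a b hab hba. destruct (Rle_lt_dec (K b - K a) r1) as [g|g].
  - assert (hK := proj1 dK a b hab).
    destruct (pow_gt_any mu (r1 / (K b - K a)) hmu) as [n hn].
    destruct (step n a b hab g) as [k [k1 k2]].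
    { apply Rlt_div_l in hn; lra. }
    exists k. left. assert (z := Rmin_l c 1). lra.
  - exists 0%nat. right. split; [|now apply hlong].
    assert (K b <= K (a + IZR (up C))).
    { apply deg1_le; auto. generalize (archimed C); lra. }
    rewrite deg1_Z in H by auto. generalize (archimed C); lra. }
set (c' := Rmin c 1). assert (hc' : 0 < c' <= 1) by (unfold c'; split; [apply Rmin_pos; lra|apply Rmin_r]).
assert (hcc : c' <= c) by apply Rmin_l.
(* The Hoelder exponent: in [k] steps one length is multiplied by at least [mu ^ k], the other by at
   most [M ^ k]. *)
set (al := ln mu / ln M).
assert (lmu : 0 < ln mu) by (rewrite <- ln_1; apply ln_increasing; lra).
assert (lM : 0 < ln M) by (rewrite <- ln_1; apply ln_increasing; lra).
assert (hal : 0 < al) by (apply Rdiv_lt_0_compat; lra).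
assert (lq : ln q < 0) by (rewrite <- ln_1; apply ln_increasing; lra).
assert (epow : forall x k, 0 < x -> x ^ k = exp (INR k * ln x)).
{ intros x k hx. rewrite <- Rpower_pow by auto. reflexivity. }
exists (exp (al * ln q)), (B * exp (al * ln (C / c'))).
assert (hCc : 0 < C / c') by (apply Rdiv_lt_0_compat; lra).
assert (concl : forall m a b k, b - a <= C * q ^ m -> a < b ->
   mu ^ k * (K b - K a) <= B -> c' <= M ^ k * (b - a) ->
   K b - K a <= B * exp (al * ln (C / c')) * exp (al * ln q) ^ m).
{ intros m a b k h1 hab h2 h3.
  assert (pm := pow_lt mu k ltac:(lra)). assert (pM := pow_lt M k ltac:(lra)).
  assert (pq := pow_lt q m ltac:(lra)).
  assert (h4 : c' <= M ^ k * (C * q ^ m)).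
  { apply Rle_trans with (1 := h3). apply Rmult_le_compat_l; lra. }
  apply Rle_trans with (B * / mu ^ k).
  { apply Rle_div_r; auto. lra. }
  rewrite Rmult_assoc. apply Rmult_le_compat_l; [lra|].
  rewrite (epow (exp (al * ln q))), ln_exp, <- exp_plus, (epow mu) by (try apply exp_pos; lra).
  rewrite <- exp_Ropp.
  assert (h5 : 0 <= ln (C / c') + INR m * ln q + INR k * ln M).
  { rewrite <- ln_1. rewrite <- (ln_exp (INR m * ln q)), <- (ln_exp (INR k * ln M)).
    rewrite <- !epow by lra. rewrite <- !ln_mult; auto; [|apply Rmult_lt_0_compat; auto].
    assert (1 <= C / c' * q ^ m * M ^ k).
    { replace (C / c' * q ^ m * M ^ k) with (M ^ k * (C * q ^ m) / c') by (field; lra).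
      apply Rle_div_r; lra. }
    destruct H as [H|H]; [apply Rlt_le, ln_increasing; lra|rewrite <- H; lra]. }
  assert (h6 : - (INR k * ln mu) <= al * ln (C / c') + INR m * (al * ln q)).
  { replace (INR k * ln mu) with (al * (INR k * ln M)) by (unfold al; field; lra).
    nra. }
  destruct h6 as [h6|h6]; [apply Rlt_le, exp_increasing; lra|rewrite h6; lra]. }
split; [split|split].
- apply exp_pos.
- rewrite <- exp_0. apply exp_increasing. nra.
- apply Rmult_lt_0_compat; [lra|apply exp_pos].
- intros m a b hab hba.
  assert (pq := pow_lt q m ltac:(lra)).
  destruct hab as [hab|hab].
  + assert (q ^ m <= 1) by (rewrite <- (pow1 m); apply pow_incr; lra).
    destruct (key a b hab ltac:(nra)) as [k [[k1 k2]|[k1 k2]]].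
    * now apply (concl m a b k).
    * apply (concl m a b 0%nat); auto; simpl; lra.
  + rewrite hab, Rminus_diag. apply Rlt_le, Rmult_lt_0_compat.
    * apply Rmult_lt_0_compat; [lra|apply exp_pos].
    * apply pow_lt, exp_pos.
Qed.

Lemma linearizing_iter (F P L : R -> R) (p q e : R) : 0 < q < 1 ->
  linearizing F p q e P L -> forall n y, Rabs y <= e ->
  Nat.iter n F (P y) = P (q ^ n * y).
Proof.
intros hq lz. induction n as [|n IH]; intros y hy; simpl.
- f_equal; ring.
- rewrite IH by auto. rewrite (lz_F _ _ _ _ _ _ lz).
  + f_equal; ring.
  + rewrite Rabs_mult, (Rabs_pos_eq (q ^ n)) by (apply pow_le; lra).
    assert (q ^ n <= 1) by (rewrite <- (pow1 n); apply pow_incr; lra).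
    assert (0 < q ^ n) by (apply pow_lt; lra).
    generalize (Rabs_pos y); nra.
Qed.

Lemma linearizing_mvt (F P L : R -> R) (p q e : R) : linearizing F p q e P L ->
  forall y z, Rabs y <= e -> Rabs z <= e -> y <= z ->
  (z - y) / 2 <= P z - P y <= 2 * (z - y).
Proof.
intros lz y z hy hz hyz.
apply Rabs_le_between in hy. apply Rabs_le_between in hz.
destruct (MVT_gen P y z (Derive P)) as [c [hc ec]].
- intros x hx. rewrite Rmin_left, Rmax_right in hx by auto.
  apply (lz_D _ _ _ _ _ _ lz). apply Rabs_le; lra.
- intros x hx. rewrite Rmin_left, Rmax_right in hx by auto.
  apply continuity_pt_filterlim, analytic_continuous, (lz_P _ _ _ _ _ _ lz).
  apply Rabs_le; lra.
- rewrite Rmin_left, Rmax_right in hc by auto.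
  destruct (lz_D _ _ _ _ _ _ lz c) as [_ b]; [apply Rabs_le; lra|].
  rewrite ec. split; nra.
Qed.

(* The multiplier of a conjugate contraction: orbits converge exponentially
   fast on both sides. *)
Lemma hyperbolic_transfer (K Ki F P L : R -> R) (p q e l : R) : line_homeo K Ki ->
  0 < q < 1 -> linearizing F p q e P L -> deg1 (fun x => Ki (F (K x))) ->
  geometric_modulus Ki -> is_derive (fun x => Ki (F (K x))) (Ki p) l -> l < 1.
Proof.
intros LK hq lz df hmod hd.
destruct LK as (dK & dKi & KKi & KiK).
assert (he := lz_e _ _ _ _ _ _ lz).
destruct (hmod q (2 * e) hq ltac:(lra)) as (q' & C' & hq' & hC' & hm).
set (a := fun m => Ki (P (q ^ m * e))).
assert (qm : forall m, 0 < q ^ m <= 1).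
{ intro m; split; [apply pow_lt; lra|]. rewrite <- (pow1 m); apply pow_incr; lra. }
assert (hqe : forall m, Rabs (q ^ m * e) <= e).
{ intro m. specialize (qm m). rewrite Rabs_pos_eq; nra. }
assert (ha : forall m, 0 < a m - Ki p <= C' * q' ^ m).
{ intro m. specialize (qm m).
  destruct (linearizing_mvt F P L p q e lz 0 (q ^ m * e)) as [b1 b2]; auto.
  { rewrite Rabs_R0; lra. } { nra. }
  rewrite (lz_0 _ _ _ _ _ _ lz) in b1, b2.
  assert (p < P (q ^ m * e)) by nra. split.
  - assert (z := proj1 dKi _ _ H). unfold a; lra.
  - apply hm; [lra|]. nra. }
assert (hstep : forall m, Ki (F (K (a m))) = a (S m)).
{ intro m. unfold a. rewrite KKi, (lz_F _ _ _ _ _ _ lz) by auto.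
  simpl. do 2 f_equal. ring. }
apply Rnot_le_lt. intro hl.
(* If the multiplier were at least 1, the orbit [a] would approach the fixed point no faster than
   [l' ^ k], whereas the modulus of [Ki] imposes the faster rate [q']. Any number strictly between
   [q'] and 1 serves as [l']. *)
set (l' := (1 + q') / 2).
apply is_derive_Reals in hd.
destruct (hd (1 - l')) as [d hdd]; [unfold l'; lra|].
assert (F p = p).
{ rewrite <- (lz_0 _ _ _ _ _ _ lz). rewrite (lz_F _ _ _ _ _ _ lz) by (rewrite Rabs_R0; lra).
  now rewrite Rmult_0_r. }
assert (grow : forall t, 0 < t < d -> l' * t <= Ki (F (K (Ki p + t))) - Ki p).
{ intros t ht. specialize (hdd t ltac:(lra) ltac:(rewrite Rabs_pos_eq; lra)).
  rewrite KKi, H in hdd. apply Rabs_def2 in hdd. destruct hdd as [_ h].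
  assert (h2 : l' < (Ki (F (K (Ki p + t))) - Ki p) / t) by lra.
  apply Rlt_div_r in h2; lra. }
destruct (pow_lt_any q' (d / C') hq') as [m0 hm0].
{ apply Rdiv_lt_0_compat; auto. apply cond_pos. }
assert (small : forall k, a (m0 + k)%nat - Ki p < d).
{ intro k. apply Rle_lt_trans with (1 := proj2 (ha (m0 + k)%nat)).
  apply Rle_lt_trans with (C' * q' ^ m0).
  - apply Rmult_le_compat_l; [lra|]. apply pow_antitone; auto; lia.
  - apply Rlt_div_r in hm0; auto. lra. }
assert (low : forall k, l' ^ k * (a m0 - Ki p) <= a (m0 + k)%nat - Ki p).
{ induction k as [|k IH]; [rewrite Nat.add_0_r; simpl; lra|].
  rewrite Nat.add_succ_r, <- hstep.
  assert (z := grow (a (m0 + k)%nat - Ki p)). 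
  replace (Ki p + (a (m0 + k)%nat - Ki p)) with (a (m0 + k)%nat) in z by ring.
  specialize (z (conj (proj1 (ha _)) (small k))). simpl.
  apply Rle_trans with (2 := z). rewrite Rmult_assoc.
  apply Rmult_le_compat_l; auto. unfold l'; lra. }
assert (hratio : 0 < q' / l' < 1).
{ unfold l'. split; [apply Rdiv_lt_0_compat; lra|]. apply Rlt_div_l; lra. }
set (X := C' * q' ^ m0 / (a m0 - Ki p)).
assert (pa := proj1 (ha m0)).
assert (pq0 := pow_lt q' m0 ltac:(lra)).
assert (hX : 0 < X) by (apply Rdiv_lt_0_compat; nra).
destruct (pow_lt_any (q' / l') (/ X) hratio ltac:(now apply Rinv_0_lt_compat)) as [k hk].
assert (z := low k). assert (z' := proj2 (ha (m0 + k)%nat)).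
rewrite pow_add in z'.
assert (pl := pow_lt l' k ltac:(unfold l'; lra)).
unfold Rdiv in hk. rewrite Rpow_mult_distr, pow_inv in hk.
assert (h1 : q' ^ k < / X * l' ^ k).
{ apply Rlt_div_l in hk; auto. }
assert (h2 : X * q' ^ k < l' ^ k).
{ apply (Rmult_lt_compat_l X) in h1; auto.
  replace (X * (/ X * l' ^ k)) with (l' ^ k) in h1 by (field; lra). auto. }
assert (h3 : X * (a m0 - Ki p) = C' * q' ^ m0) by (unfold X; field; lra).
assert (h4 : X * q' ^ k * (a m0 - Ki p) < l' ^ k * (a m0 - Ki p)) by (apply Rmult_lt_compat_r; lra).
replace (X * q' ^ k * (a m0 - Ki p)) with (X * (a m0 - Ki p) * q' ^ k) in h4 by ring.
rewrite h3 in h4. lra.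
Qed.

(** The constant is the maximum of |G''/G'| over a period. Positivity of G' comes from monotonicity
    and from the analytic inverse, which excludes zeros of G'. *)
Lemma analytic_log_lipschitz (K Ki g gi : R -> R) : line_homeo K Ki -> deg1 g ->
  (forall x, g (gi x) = x) -> (forall x, gi (g x) = x) ->
  (forall x, analytic_at (fun t => K (g (Ki t))) x) ->
  (forall x, analytic_at (fun t => K (gi (Ki t))) x) -> log_lipschitz K Ki g.
Proof.
intros (dK & dKi & KKi & KiK) dg e e' ha hb.
set (G := fun t => K (g (Ki t))) in *. set (Gi := fun t => K (gi (Ki t))) in *.
assert (dG : deg1 G) by (apply (deg1_comp K (fun t => g (Ki t))); auto; now apply deg1_comp).
assert (exG : forall x, ex_derive G x) by (intro; now apply analytic_ex_derive).
assert (exGi : forall x, ex_derive Gi x) by (intro; now apply analytic_ex_derive).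
assert (hprod : forall x, Derive Gi (G x) * Derive G x = 1).
{ intro x. rewrite Rmult_comm, <- Derive_comp by auto.
  rewrite (Derive_ext _ (fun t => t)); [apply Derive_id|].
  intro t. unfold G, Gi. now rewrite KiK, e', KKi. }
assert (pos : forall x, 0 < Derive G x).
{ intro x. destruct (Rle_lt_dec (Derive G x) 0) as [c|c]; auto. exfalso.
  assert (hz : Derive G x < 0).
  { destruct c as [c|c]; auto. specialize (hprod x). rewrite c in hprod; lra. }
  assert (dx := Derive_correct _ _ (exG x)). apply is_derive_Reals in dx.
  destruct (dx (- Derive G x) ltac:(lra)) as [d hd]. assert (pd := cond_pos d).
  specialize (hd (d / 2) ltac:(lra) ltac:(rewrite Rabs_pos_eq; lra)).
  apply Rabs_def2 in hd.
  assert (hlt : G x < G (x + d / 2)) by (apply dG; lra).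
  assert (0 < (G (x + d / 2) - G x) / (d / 2)) by (apply Rdiv_lt_0_compat; lra). lra. }
assert (per : forall x, Derive G (x + 1) = Derive G x).
{ intro x. unfold Derive. f_equal. apply Lim_ext. intro t.
  replace (x + 1 + t) with (x + t + 1) by ring. rewrite !(proj2 dG).
  f_equal; ring. }
assert (ex2 : forall x, ex_derive (Derive G) x).
{ intro x. apply (analytic_ex_derive_n G x (ha x) 2). }
assert (ex3 : forall x, ex_derive (Derive (Derive G)) x).
{ intro x. apply (analytic_ex_derive_n G x (ha x) 3). }
assert (per2 : forall x, Derive (Derive G) (x + 1) = Derive (Derive G) x).
{ intro x. unfold Derive at 1 3. f_equal. apply Lim_ext. intro t.
  replace (x + 1 + t) with (x + t + 1) by ring. now rewrite !per. }
set (psi := fun x => Rabs (Derive (Derive G) x / Derive G x)).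
assert (cpsi : forall x, 0 <= x <= 1 -> continuity_pt psi x).
{ intros x _. unfold psi. apply (continuity_pt_comp (fun x => Derive (Derive G) x / Derive G x) Rabs).
  - apply continuity_pt_div.
    + apply continuity_pt_filterlim. apply (ex_derive_continuous (Derive (Derive G))), ex3.
    + apply continuity_pt_filterlim. apply (ex_derive_continuous (Derive G)), ex2.
    + generalize (pos x); lra.
  - apply Rcontinuity_abs. }
destruct (continuity_ab_maj psi 0 1 ltac:(lra) cpsi) as [mx [hmx _]].
assert (perpsi : forall x k, psi (x + INR k) = psi x).
{ intros x k. induction k as [|k IH]; [simpl; now rewrite Rplus_0_r|].
  rewrite S_INR, <- Rplus_assoc. unfold psi at 1. rewrite per, per2. exact IH. }
assert (bound : forall x, psi x <= psi mx).
{ intro x. assert (hi := Int_part_bounds x). set (k := Int_part x) in *.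
  rewrite <- (Rplus_0_r x).
  destruct (Z_le_gt_dec 0 k) as [c|c].
  - replace (x + 0) with (x - IZR k + INR (Z.to_nat k)).
    + rewrite perpsi. apply hmx; lra.
    + rewrite INR_IZR_INZ, Z2Nat.id by lia. ring.
  - rewrite Rplus_0_r, <- (perpsi x (Z.to_nat (- k))).
    rewrite INR_IZR_INZ, Z2Nat.id by lia. rewrite opp_IZR. apply hmx; lra. }
split; [|split].
- exact exG.
- intro y. apply pos.
- exists (psi mx). unfold dv. fold G. intros x y.
  assert (main : forall u v, u <= v -> Rabs (ln (Derive G u) - ln (Derive G v)) <= psi mx * Rabs (u - v)).
  { intros u v huv.
    destruct (MVT_gen (fun t => ln (Derive G t)) u v
      (fun t => Derive (Derive G) t / Derive G t)) as [c [hc ec]].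
    - intros t _.
      assert (z := is_derive_comp ln (Derive G) t _ _
        (is_derive_ln _ (pos t)) (Derive_correct _ _ (ex2 t))).
      exact z.
    - intros t _. apply continuity_pt_filterlim.
      apply (continuous_comp (Derive G) ln).
      + apply (ex_derive_continuous (Derive G)), ex2.
      + apply (ex_derive_continuous ln). eexists. apply is_derive_ln, pos.
    - rewrite (Rabs_minus_sym (ln _)), (Rabs_minus_sym u), ec, Rabs_mult.
      apply Rmult_le_compat_r; [apply Rabs_pos|]. apply bound. }
  destruct (Rle_lt_dec (K x) (K y)) as [c|c]; [now apply main|].
  rewrite (Rabs_minus_sym (ln _)), (Rabs_minus_sym (K x)). apply main; lra.
Qed.

(** * Closeness to the identity in a linearizing chart *)

Lemma linearizing_derive_unif (F P L : R -> R) (p q e : R) : linearizing F p q e P L ->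
  forall k, 0 < k -> exists d, 0 < d /\ forall y z, Rabs y <= e -> Rabs z <= e ->
    Rabs (y - z) <= d -> Rabs (Derive P y / Derive P z - 1) <= k.
Proof.
intros lz k hk.
destruct (@Heine_cor2 (Derive P) (- e) e) with (eps := mkposreal (k / 2) ltac:(lra)) as [d hd].
{ intros x hx. apply continuity_pt_filterlim, (ex_derive_continuous (Derive P)).
  apply (analytic_ex_derive_n P x (lz_P _ _ _ _ _ _ lz x ltac:(apply Rabs_le; lra)) 2). }
assert (pd := cond_pos d).
exists (d / 2). split; [lra|]. intros y z hy hz hyz.
destruct (lz_D _ _ _ _ _ _ lz y hy) as [_ b1]. destruct (lz_D _ _ _ _ _ _ lz z hz) as [_ b2].
apply Rabs_le_between in hy. apply Rabs_le_between in hz.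
specialize (hd y z ltac:(lra) ltac:(lra) ltac:(lra)). simpl in hd.
replace (Derive P y / Derive P z - 1) with ((Derive P y - Derive P z) / Derive P z) by (field; lra).
unfold Rdiv. rewrite Rabs_mult, Rabs_inv, (Rabs_pos_eq (Derive P z)) by lra.
apply Rle_div_l; [lra|]. nra.
Qed.

(** [Derive] has a value even where the derivative does not exist, so [ex_derive] is required
    explicitly. *)
Definition C1_close (eta : R) (f : R -> R) (a b : R) : Prop :=
  forall x, a <= x <= b -> ex_derive f x /\ Rabs (f x - x) <= eta /\
    Rabs (Derive f x - 1) <= eta.

Lemma product_near_one (x y k : R) : 0 <= k <= 1 -> Rabs (x - 1) <= k -> Rabs (y - 1) <= k ->
  Rabs (x * y - 1) <= 3 * k.
Proof.
intros hk hx hy. apply Rabs_le_between in hx. apply Rabs_le_between in hy.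
apply Rabs_le; split; nra.
Qed.

(** The radius [e'] is chosen before [eta]. The explicit form of [d] serves to return from the chart
    to the original derivative in [climb]. *)
Lemma chart_near (F P L : R -> R) (p q e : R) : linearizing F p q e P L ->
  forall r0, 0 < r0 -> exists e', 0 < e' <= e / 2 /\ forall eta, 0 < eta ->
  exists eta', 0 < eta' /\ forall f, C1_close eta' f (p - r0) (p + r0) ->
  forall w, Rabs w <= e' -> Rabs (L (f (P w))) <= e /\ P (L (f (P w))) = f (P w) /\
    Rabs (P w - p) <= r0 /\
    Rabs (L (f (P w)) - w) <= eta /\
    exists d, is_derive (fun w => L (f (P w))) w d /\ Rabs (d - 1) <= eta /\
      d = Derive P w / Derive P (L (f (P w))) * Derive f (P w).
Proof.
intros lz r0 hr0. assert (he := lz_e _ _ _ _ _ _ lz).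
destruct (lz_loc _ _ _ _ _ _ lz) as [d0 [hd0 hloc]].
set (e' := Rmin (e / 2) (Rmin (r0 / 2) (d0 / 4))).
assert (he' : 0 < e') by (repeat apply Rmin_pos; lra).
assert (he1 : e' <= e / 2) by apply Rmin_l.
assert (he2 : e' <= r0 / 2) by (eapply Rle_trans; [apply Rmin_r|apply Rmin_l]).
assert (he3 : e' <= d0 / 4) by (eapply Rle_trans; [apply Rmin_r|apply Rmin_r]).
exists e'. split; [lra|]. intros eta heta.
set (k := Rmin (eta / 3) 1).
assert (hk : 0 < k <= 1) by (unfold k; split; [apply Rmin_pos; lra|apply Rmin_r]).
assert (hk3 : 3 * k <= eta) by (unfold k; generalize (Rmin_l (eta / 3) 1); lra).
destruct (linearizing_derive_unif F P L p q e lz k (proj1 hk)) as [dd [hdd hunif]].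
set (eta' := Rmin (Rmin k (d0 / 2)) (dd / 2)).
assert (heta' : 0 < eta') by (repeat apply Rmin_pos; lra).
assert (h1 : eta' <= k) by (eapply Rle_trans; [apply Rmin_l|apply Rmin_l]).
assert (h2 : eta' <= d0 / 2) by (eapply Rle_trans; [apply Rmin_l|apply Rmin_r]).
assert (h3 : eta' <= dd / 2) by apply Rmin_r.
set (eta2 := Rmin eta' (eta / 2)).
assert (heta2 : 0 < eta2) by (apply Rmin_pos; lra).
assert (h4 : eta2 <= eta') by apply Rmin_l. assert (h5 : eta2 <= eta / 2) by apply Rmin_r.
exists eta2. split; auto. intros f hf w hw.
assert (hPw : Rabs (P w - p) <= 2 * Rabs w).
{ rewrite <- (lz_0 _ _ _ _ _ _ lz).
  destruct (Rle_lt_dec 0 w) as [c|c].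
  - destruct (linearizing_mvt F P L p q e lz 0 w) as [b1 b2]; try lra; [rewrite Rabs_R0; lra|].
    rewrite !Rabs_pos_eq by lra. lra.
  - destruct (linearizing_mvt F P L p q e lz w 0) as [b1 b2]; try lra; [rewrite Rabs_R0; lra|].
    rewrite !Rabs_left1 by lra. lra. }
assert (hPw' : p - r0 <= P w <= p + r0) by (apply Rabs_le_between in hPw; lra).
destruct (hf (P w) hPw') as (fd & f0 & f1).
destruct (hloc (f (P w))) as [l1 l2].
{ replace (f (P w) - p) with ((f (P w) - P w) + (P w - p)) by ring.
  apply Rle_trans with (1 := Rabs_triang _ _). lra. }
set (v := L (f (P w))) in *.
assert (hvw : Rabs (v - w) <= 2 * Rabs (f (P w) - P w)).
{ rewrite <- l2. destruct (Rle_lt_dec w v) as [c|c].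
  - destruct (linearizing_mvt F P L p q e lz w v) as [b1 b2]; try lra.
    rewrite !Rabs_pos_eq by lra. lra.
  - destruct (linearizing_mvt F P L p q e lz v w) as [b1 b2]; try lra.
    rewrite !Rabs_left1 by lra. lra. }
split; auto. split; auto. split; [lra|]. split; [lra|].
destruct (lz_L _ _ _ _ _ _ lz v l1) as (L1 & L2 & L3).
assert (dvd := lz_D _ _ _ _ _ _ lz w ltac:(lra)). destruct dvd as [dP bP].
exists (Derive P w / Derive P v * Derive f (P w)). split; [|split]; auto.
- rewrite l2 in L2, L3.
  assert (dL := Derive_correct _ _ (analytic_ex_derive _ _ L2)).
  rewrite L3 in dL.
  assert (dfp := is_derive_comp f P w _ _ (Derive_correct _ _ fd) dP).
  assert (dc := is_derive_comp L (fun t => f (P t)) w _ _ dL dfp).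
  replace (Derive P w / Derive P v * Derive f (P w)) with
    (scal (scal (Derive P w) (Derive f (P w))) (/ Derive P v)); [exact dc|].
  unfold scal; simpl; unfold mult; simpl. unfold Rdiv. ring.
- apply Rle_trans with (3 * k); auto. apply product_near_one; [lra| |lra].
  apply hunif; try lra. rewrite Rabs_minus_sym; lra.
Qed.

(** * Elements close to the identity that move a hyperbolic fixed point *)

Lemma C1_close_sub (eta eta' : R) (f : R -> R) (a b a' b' : R) : eta <= eta' ->
  a <= a' -> b' <= b -> C1_close eta f a b -> C1_close eta' f a' b'.
Proof. intros h h1 h2 h3 x hx. destruct (h3 x ltac:(lra)) as (u & v & w). repeat split; auto; lra. Qed.

Lemma linearizing_abs (F P L : R -> R) (p q e : R) : linearizing F p q e P L ->
  forall y z, Rabs y <= e -> Rabs z <= e ->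
  Rabs (y - z) / 2 <= Rabs (P y - P z) <= 2 * Rabs (y - z).
Proof.
intros lz y z hy hz. destruct (Rle_lt_dec z y) as [c|c].
- destruct (linearizing_mvt F P L p q e lz z y hz hy c). rewrite !Rabs_pos_eq; lra.
- destruct (linearizing_mvt F P L p q e lz y z hy hz ltac:(lra)).
  rewrite !(Rabs_left1 (_ - _)) by lra. lra.
Qed.

Lemma iter_inj (F : R -> R) : (forall x y, F x = F y -> x = y) ->
  forall m x y, Nat.iter m F x = Nat.iter m F y -> x = y.
Proof. intros h m; induction m; simpl; auto. Qed.

(* In the linearizing chart phi is w |-> f(q^m w) / q^m, and C^1-closeness to the
   identity of a map fixing 0 is invariant under such a rescaling. *)
Lemma conj_iter_close (F P L : R -> R) (p q e : R) : 0 < q < 1 -> linearizing F p q e P L ->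
  (forall x y, F x = F y -> x = y) -> forall r0, 0 < r0 ->
  exists s, 0 < s /\ forall eta, 0 < eta -> exists eta', 0 < eta' /\
  forall f, C1_close eta' f (p - r0) (p + r0) -> f p = p ->
  forall m phi, (forall x, ex_derive phi x) ->
    (forall x, Nat.iter m F (phi x) = f (Nat.iter m F x)) ->
    C1_close eta phi (p - s) (p + s).
Proof.
intros hq lz inj r0 hr0. assert (he := lz_e _ _ _ _ _ _ lz).
destruct (chart_near F P L p q e lz r0 hr0) as [e' [he' hchart]].
destruct (lz_loc _ _ _ _ _ _ lz) as [d0 [hd0 hloc]].
set (s := Rmin d0 (e' / 8)).
assert (hs : 0 < s) by (apply Rmin_pos; lra).
assert (hs1 : s <= d0) by apply Rmin_l. assert (hs2 : s <= e' / 8) by apply Rmin_r.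
exists s. split; auto. intros eta heta.
set (k := Rmin (eta / 3) 1).
assert (hk : 0 < k <= 1) by (unfold k; split; [apply Rmin_pos; lra|apply Rmin_r]).
assert (hk3 : 3 * k <= eta) by (unfold k; generalize (Rmin_l (eta / 3) 1); lra).
destruct (linearizing_derive_unif F P L p q e lz k (proj1 hk)) as [dd [hdd hunif]].
set (ze := Rmin (Rmin k (dd / (e' + 1))) (eta / (4 * (e' + 1)))).
assert (hze : 0 < ze).
{ repeat apply Rmin_pos; try lra; apply Rdiv_lt_0_compat; lra. }
assert (z1 : ze <= k) by (eapply Rle_trans; [apply Rmin_l|apply Rmin_l]).
assert (z2 : ze * (e' + 1) <= dd).
{ apply Rle_div_r; [lra|]. eapply Rle_trans; [apply Rmin_l|apply Rmin_r]. }
assert (z3 : ze * (4 * (e' + 1)) <= eta).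
{ apply Rle_div_r; [lra|]. apply Rmin_r. }
destruct (hchart ze hze) as [eta' [heta' hc]].
exists eta'. split; auto. intros f hf hfp m phi exphi hphi.
assert (qm : 0 < q ^ m <= 1).
{ split; [apply pow_lt; lra|]. rewrite <- (pow1 m); apply pow_incr; lra. }
assert (L0 : L p = 0).
{ rewrite <- (lz_0 _ _ _ _ _ _ lz) at 1. apply (lz_L _ _ _ _ _ _ lz). rewrite Rabs_R0; lra. }
(* As [f] fixes [p], the bound on the derivative integrates to a displacement proportional to
   [Rabs w], a bound that survives division by [q ^ m]. *)
assert (fix_close : forall w, Rabs w <= e' -> Rabs (L (f (P w)) - w) <= ze * Rabs w).
{ intros w hw.
  destruct (MVT_gen (fun t => L (f (P t)) - t) 0 w (fun t => Derive (fun t => L (f (P t))) t - 1))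
    as [c [hcc ec]].
  - intros t ht.
    assert (htw : Rabs t <= e').
    { apply Rabs_le_between in hw. apply Rabs_le.
      revert ht; unfold Rmin, Rmax; destruct (Rle_dec 0 w); lra. }
    destruct (hc f hf t htw) as (_ & _ & _ & _ & d & hd & _).
    apply (is_derive_minus (fun t => L (f (P t))) (fun t => t) t _ 1).
    + apply Derive_correct. eexists; exact hd.
    + apply (is_derive_id t).
  - intros t ht.
    assert (htw : Rabs t <= e').
    { apply Rabs_le_between in hw. apply Rabs_le.
      revert ht; unfold Rmin, Rmax; destruct (Rle_dec 0 w); lra. }
    destruct (hc f hf t htw) as (_ & _ & _ & _ & d & hd & _).
    apply continuity_pt_minus; [|apply derivable_continuous_pt, derivable_pt_id].
    apply continuity_pt_filterlim, (ex_derive_continuous (fun t => L (f (P t)))).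
    eexists; exact hd.
  - assert (hcw : Rabs c <= e').
    { apply Rabs_le_between in hw. apply Rabs_le.
      revert hcc; unfold Rmin, Rmax; destruct (Rle_dec 0 w); lra. }
    destruct (hc f hf c hcw) as (_ & _ & _ & _ & d & hd & hd1 & _).
    assert (eD : Derive (fun t => L (f (P t))) c = d) by (apply is_derive_unique; exact hd).
    cbv beta in ec. rewrite eD in ec.
    rewrite (lz_0 _ _ _ _ _ _ lz), hfp, L0, !Rminus_0_r in ec.
    rewrite ec, Rabs_mult. apply Rmult_le_compat_r; auto. apply Rabs_pos. }
set (zz := fun y => / q ^ m * L (f (P (q ^ m * y)))).
assert (hw : forall y, Rabs y <= e' -> Rabs (q ^ m * y) <= e').
{ intros y hy. rewrite Rabs_mult, (Rabs_pos_eq (q ^ m)) by lra. generalize (Rabs_pos y); nra. }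
assert (hz : forall y, Rabs y <= e' -> Rabs (zz y - y) <= ze * Rabs y).
{ intros y hy. unfold zz.
  replace (/ q ^ m * L (f (P (q ^ m * y))) - y) with
    (/ q ^ m * (L (f (P (q ^ m * y))) - q ^ m * y)) by (field; lra).
  rewrite Rabs_mult, Rabs_inv, (Rabs_pos_eq (q ^ m)) by lra.
  specialize (fix_close _ (hw y hy)). rewrite Rabs_mult, (Rabs_pos_eq (q ^ m)) in fix_close by lra.
  apply (Rmult_le_reg_l (q ^ m)); [lra|]. rewrite <- Rmult_assoc, Rinv_r by lra. lra. }
assert (hzb : forall y, Rabs y <= e' / 2 -> Rabs (zz y) <= e).
{ intros y hy. specialize (hz y ltac:(lra)). generalize (Rabs_pos y); intro.
  replace (zz y) with ((zz y - y) + y) by ring.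
  apply Rle_trans with (1 := Rabs_triang _ _). nra. }
assert (formula : forall y, Rabs y <= e' / 2 -> phi (P y) = P (zz y)).
{ intros y hy. apply (iter_inj F inj m).
  rewrite hphi, !(linearizing_iter F P L p q e hq lz) by (auto; try apply hzb; auto; lra).
  destruct (hc f hf (q ^ m * y) (hw y ltac:(lra))) as (_ & e2 & _).
  rewrite <- e2. f_equal. unfold zz. field. lra. }
intros x hx.
destruct (hloc x) as [lx1 lx2]; [apply Rabs_le; lra|].
set (y := L x) in *.
assert (hy : Rabs y <= e' / 4).
{ destruct (linearizing_abs F P L p q e lz y 0) as [b1 _]; auto; [rewrite Rabs_R0; lra|].
  rewrite (lz_0 _ _ _ _ _ _ lz), lx2, Rminus_0_r in b1.
  assert (Rabs (x - p) <= s) by (apply Rabs_le; lra). lra. }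
split; [apply exphi|].
assert (hzy := hz y ltac:(lra)). assert (py := Rabs_pos y).
split.
- rewrite <- lx2, formula by lra.
  destruct (linearizing_abs F P L p q e lz (zz y) y) as [_ b2]; auto; [apply hzb; lra|].
  nra.
- destruct (hc f hf (q ^ m * y) (hw y ltac:(lra))) as (_ & _ & _ & _ & d & hd & hd1 & _).
  assert (dz : is_derive zz y d).
  { replace d with (/ q ^ m * (q ^ m * d)) by (field; lra).
    apply is_derive_scal.
    apply (is_derive_comp (fun w => L (f (P w))) (fun t => q ^ m * t) y d (q ^ m)); auto.
    evar_last; [apply is_derive_scal, (is_derive_id y)|]. simpl. apply Rmult_1_r. }
  destruct (lz_D _ _ _ _ _ _ lz (zz y) ltac:(apply hzb; lra)) as [dPz bPz].
  destruct (lz_D _ _ _ _ _ _ lz y lx1) as [dPy bPy].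
  assert (d1 : is_derive (fun t => phi (P t)) y (d * Derive P (zz y))).
  { apply (is_derive_ext_loc (fun t => P (zz t))).
    - apply (locally_Rabs y (e' / 4)); [lra|]. intros t ht. symmetry. apply formula.
      replace t with ((t - y) + y) by ring. apply Rle_trans with (1 := Rabs_triang _ _). lra.
    - apply (is_derive_comp P zz y _ _ dPz dz). }
  assert (d2 : is_derive (fun t => phi (P t)) y (Derive P y * Derive phi x)).
  { rewrite <- lx2. apply (is_derive_comp phi P y _ _ (Derive_correct _ _ (exphi _)) dPy). }
  assert (ed : d * Derive P (zz y) = Derive P y * Derive phi x).
  { rewrite <- (is_derive_unique _ _ _ d1). now apply is_derive_unique. }
  replace (Derive phi x) with (Derive P (zz y) / Derive P y * d).
  2:{ apply (Rmult_eq_reg_l (Derive P y)); [|lra]. rewrite <- ed. field. lra. }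
  apply Rle_trans with (3 * k); auto. apply product_near_one; [lra| |lra].
  apply hunif; auto; [apply hzb; lra|].
  apply Rle_trans with (1 := hzy). apply Rle_trans with (2 := z2). nra.
Qed.

Lemma C1_close_inv (eta : R) (f fi : R -> R) (a b : R) : 0 < eta <= 1 / 2 -> deg1 f -> deg1 fi ->
  (forall x, f (fi x) = x) -> (forall x, fi (f x) = x) -> (forall x, ex_derive fi x) ->
  C1_close eta f a b -> C1_close (2 * eta) fi (a + eta) (b - eta).
Proof.
intros he df dfi e e' exi h x hx.
assert (hb : a <= fi x <= b).
{ split; apply (deg1_le_inv f df); rewrite e.
  - destruct (h a ltac:(lra)) as (_ & h1 & _). apply Rabs_le_between in h1. lra.
  - destruct (h b ltac:(lra)) as (_ & h1 & _). apply Rabs_le_between in h1. lra. }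
destruct (h (fi x) hb) as (exf & h1 & h2). rewrite e in h1.
split; auto. split.
- rewrite Rabs_minus_sym. lra.
- assert (hprod : Derive f (fi x) * Derive fi x = 1).
  { rewrite Rmult_comm, <- Derive_comp by auto.
    rewrite (Derive_ext _ (fun t => t)); [apply Derive_id|]. auto. }
  apply Rabs_le_between in h2. set (D := Derive f (fi x)) in *. set (D' := Derive fi x) in *.
  assert (D' = / D) by (field_simplify_eq; lra).
  assert (D' - 1 = (1 - D) * / D) by (rewrite H; field; lra).
  rewrite H0. assert (0 < / D <= 2).
  { split; [apply Rinv_0_lt_compat; lra|]. replace 2 with (/ (1 / 2)) by field.
    apply Rinv_le_contravar; lra. }
  apply Rabs_le; nra.
Qed.

Definition side (H Hi g : R -> R) : R -> R := fun x => H (g (Hi x)).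

Section TwoSides.
Variables (Gm : (R -> R) -> Prop) (H Hi : R -> R).
Hypothesis GG : lift_group Gm.
Hypothesis LH : line_homeo H Hi.
Hypothesis AN : forall g, Gm g -> forall x, analytic_at g x /\ analytic_at (side H Hi g) x.
Hypothesis MIN : forall x y eps, 0 < eps -> exists g, Gm g /\ Rabs (g x - y) < eps.

Lemma Gm_ex_derive (g : R -> R) (x : R) : Gm g -> ex_derive g x.
Proof. intro h. apply analytic_ex_derive, (AN g h x). Qed.

Lemma Gm_ex_derive_side (g : R -> R) (x : R) : Gm g -> ex_derive (side H Hi g) x.
Proof. intro h. apply analytic_ex_derive, (AN g h x). Qed.

Lemma side_deg1 (g : R -> R) : Gm g -> deg1 (side H Hi g).
Proof.
intro h. destruct LH as (dH & dHi & _).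
apply (deg1_comp H (fun t => g (Hi t))); auto. apply deg1_comp; auto. now apply (lg_deg _ GG).
Qed.

Lemma side_comp (f g : R -> R) : side H Hi (fun x => f (g x)) =
  fun x => side H Hi f (side H Hi g x).
Proof.
apply functional_extensionality; intro x. unfold side.
now rewrite (proj2 (proj2 (proj2 LH))).
Qed.

Lemma side_iter (F : R -> R) (m : nat) (x : R) :
  Nat.iter m (side H Hi F) x = H (Nat.iter m F (Hi x)).
Proof.
induction m as [|m IH]; simpl.
- now rewrite (proj1 (proj2 (proj2 LH))).
- rewrite IH. unfold side. now rewrite (proj2 (proj2 (proj2 LH))).
Qed.

(** [q2] and [q1] are the multipliers on the original line and on its image by [H], where lifts of
    G_2 and of G_1 act in the main application. *)
Definition hyperbolic_at (p q2 q1 : R) : Prop := exists F, Gm F /\ F p = p /\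
  is_derive F p q2 /\ is_derive (side H Hi F) (H p) q1.

Lemma derive_conj (k ki F : R -> R) (p q : R) : (forall x, ki (k x) = x) ->
  ex_derive k p -> ex_derive ki (k p) -> F p = p -> is_derive F p q ->
  is_derive (fun x => k (F (ki x))) (k p) q.
Proof.
intros e dk dki eF dF.
assert (d1 := is_derive_comp F ki (k p) q (Derive ki (k p))).
rewrite e in d1. specialize (d1 dF (Derive_correct _ _ dki)).
assert (d2 := is_derive_comp k (fun x => F (ki x)) (k p) (Derive k p)
  (scal (Derive ki (k p)) q)).
cbv beta in d2. rewrite e, eF in d2. specialize (d2 (Derive_correct _ _ dk) d1).
assert (prod : Derive k p * Derive ki (k p) = 1).
{ rewrite <- Derive_comp; auto.
  rewrite (Derive_ext _ (fun t => t)); [apply Derive_id|]. auto. }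
replace q with (scal (scal (Derive ki (k p)) q) (Derive k p)); [exact d2|].
unfold scal; simpl; unfold mult; simpl.
replace (Derive ki (k p) * q * Derive k p) with (Derive k p * Derive ki (k p) * q) by ring.
rewrite prod; ring.
Qed.

Lemma hyperbolic_conj (p q2 q1 : R) (k : R -> R) : Gm k -> hyperbolic_at p q2 q1 ->
  hyperbolic_at (k p) q2 q1.
Proof.
intros Hk (F & HF & eF & d2 & d1).
destruct (lg_inv _ GG k Hk) as (ki & Hki & e & e').
exists (fun x => k (F (ki x))). split; [|split; [|split]].
- apply (lg_comp _ GG k (fun x => F (ki x))); auto. apply (lg_comp _ GG F); auto.
- now rewrite e', eF.
- exact (derive_conj k ki F p q2 e' (Gm_ex_derive k p Hk)
    (Gm_ex_derive ki (k p) Hki) eF d2).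
- destruct LH as (_ & _ & HHi & HiH).
  replace (H (k p)) with (side H Hi k (H p)) by (unfold side; now rewrite HiH).
  rewrite (side_comp k (fun x => F (ki x))), (side_comp F ki).
  apply (derive_conj (side H Hi k) (side H Hi ki) (side H Hi F) (H p) q1).
  + intro x. unfold side. now rewrite HiH, e', HHi.
  + exact (Gm_ex_derive_side k _ Hk).
  + exact (Gm_ex_derive_side ki _ Hki).
  + unfold side. now rewrite HiH, eF.
  + exact d1.
Qed.

Definition close2 (eta : R) (g : R -> R) (p r : R) : Prop :=
  C1_close eta g (p - r) (p + r) /\ C1_close eta (side H Hi g) (H p - r) (H p + r).

Lemma near_close (a b p : R) : a < p < b -> exists r, 0 < r /\
  forall eta, 0 < eta -> exists eta', 0 < eta' /\ forall g, Gm g ->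
  near H Hi eta' g a b -> close2 eta g p r.
Proof.
intro hp. assert (LH' := LH). destruct LH' as (dH & dHi & HHi & HiH).
assert (h1 := proj1 dH _ _ (proj1 hp)). assert (h2 := proj1 dH _ _ (proj2 hp)).
set (r := Rmin (Rmin (p - a) (b - p)) (Rmin (H p - H a) (H b - H p))).
assert (hr : 0 < r) by (unfold r; repeat apply Rmin_pos; lra).
assert (r1 : r <= p - a) by (eapply Rle_trans; [apply Rmin_l|apply Rmin_l]).
assert (r2 : r <= b - p) by (eapply Rle_trans; [apply Rmin_l|apply Rmin_r]).
assert (r3 : r <= H p - H a) by (eapply Rle_trans; [apply Rmin_r|apply Rmin_l]).
assert (r4 : r <= H b - H p) by (eapply Rle_trans; [apply Rmin_r|apply Rmin_r]).
exists r. split; auto. intros eta heta.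
destruct (line_homeo_unif H Hi LH eta heta) as [d [hd hunif]].
exists (Rmin eta d). split; [now apply Rmin_pos|].
assert (m1 := Rmin_l eta d). assert (m2 := Rmin_r eta d).
intros g Hg hn. split; intros x hx.
- destruct (hn x ltac:(lra)) as (n1 & n2 & n3). split; [exact (Gm_ex_derive g x Hg)|].
  split; [lra|]. change (Rabs (dv ids ids g x - 1) <= eta). lra.
- assert (hy : a <= Hi x <= b).
  { split; apply (deg1_le_inv H dH); rewrite HHi; lra. }
  destruct (hn (Hi x) hy) as (n1 & n2 & n3).
  split; [exact (Gm_ex_derive_side g x Hg)|]. split.
  + unfold side. rewrite <- (HHi x) at 2. apply hunif. lra.
  + unfold dv in n3. rewrite HHi in n3. fold (side H Hi g) in n3. lra.
Qed.

Lemma close2_inv (eta : R) (g gi : R -> R) (p r : R) : 0 < eta <= 1 / 2 -> Gm g -> Gm gi ->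
  (forall x, g (gi x) = x) -> (forall x, gi (g x) = x) -> eta <= r / 2 ->
  close2 eta g p r -> close2 (2 * eta) gi p (r / 2).
Proof.
intros he Hg Hgi e e' hr [c1 c2]. split.
- apply (C1_close_sub (2 * eta) _ gi (p - r + eta) (p + r - eta)); try lra.
  apply (C1_close_inv eta g gi (p - r) (p + r)); auto; try now apply (lg_deg _ GG).
  intro x; exact (Gm_ex_derive gi x Hgi).
- apply (C1_close_sub (2 * eta) _ (side H Hi gi) (H p - r + eta) (H p + r - eta)); try lra.
  destruct LH as (_ & _ & HHi & HiH).
  apply (C1_close_inv eta (side H Hi g) (side H Hi gi) (H p - r) (H p + r)); auto;
    try now apply side_deg1.
  + intro x. unfold side. now rewrite HiH, e, HHi.
  + intro x. unfold side. now rewrite HiH, e', HHi.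
  + intro x; exact (Gm_ex_derive_side gi x Hgi).
Qed.

(** The sign of the displacement is a normalisation, reached by passing to the inverse of [g] when
    necessary ([moving_of_nonfixed]). *)
Definition moving (p r : R) : Prop := 0 < r /\ forall eta, 0 < eta ->
  exists g, Gm g /\ p < g p /\ close2 eta g p r.

Lemma moving_of_nonfixed (p r : R) : 0 < r ->
  (forall eta, 0 < eta -> exists g, Gm g /\ g p <> p /\ close2 eta g p r) ->
  moving p (r / 2).
Proof.
intros hr h. split; [lra|]. intros eta heta.
set (k := Rmin (Rmin (eta / 2) (1 / 2)) (r / 2)).
assert (hk : 0 < k) by (unfold k; repeat apply Rmin_pos; lra).
assert (k1 : k <= eta / 2) by (eapply Rle_trans; [apply Rmin_l|apply Rmin_l]).
assert (k2 : k <= 1 / 2) by (eapply Rle_trans; [apply Rmin_l|apply Rmin_r]).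
assert (k3 : k <= r / 2) by apply Rmin_r.
destruct (h k hk) as (g & Hg & hne & hc).
destruct (Rtotal_order (g p) p) as [c|[c|c]]; [|contradiction|].
- destruct (lg_inv _ GG g Hg) as (gi & Hgi & e & e').
  exists gi. split; auto. split.
  + apply (deg1_lt_inv g (lg_deg _ GG g Hg)). now rewrite e.
  + destruct (close2_inv k g gi p r ltac:(lra) Hg Hgi e e' k3 hc) as [c1 c2].
    split; eapply C1_close_sub; [| | |exact c1| | | |exact c2]; lra.
- exists g. split; auto. split; auto. destruct hc as [c1 c2].
  split; eapply C1_close_sub; [| | |exact c1| | | |exact c2]; lra.
Qed.

(* If all the maps close to the identity fix p, conjugating them by powers of
   the contraction at p keeps them close to the identity near p, and makes
   them move another point q of the orbit of p: otherwise they would fix the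
   sequence F^m(q), which tends to p. *)
Lemma moving_fixed_point (p0 q2 q1 : R) : 0 < q2 < 1 -> 0 < q1 < 1 ->
  hyperbolic_at p0 q2 q1 -> C1_nondiscrete Gm H Hi ->
  exists p r, hyperbolic_at p q2 q1 /\ moving p r.
Proof.
intros hq2 hq1 hyp0 (a & b & hab & hnd).
assert (LH' := LH). destruct LH' as (dH & dHi & HHi & HiH).
destruct (MIN p0 ((a + b) / 2) ((b - a) / 2) ltac:(lra)) as (k & Hk & hk).
set (p := k p0) in *. assert (hp : a < p < b) by (apply Rabs_def2 in hk; lra).
assert (hyp := hyperbolic_conj p0 q2 q1 k Hk hyp0). fold p in hyp.
destruct (near_close a b p hp) as (r & hr & hnc).
destruct (classic (forall eta, 0 < eta -> exists g, Gm g /\ g p <> p /\ close2 eta g p r))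
  as [c|c].
{ exists p, (r / 2). split; auto. now apply moving_of_nonfixed. }
apply not_all_ex_not in c. destruct c as [eta0 c].
apply imply_to_and in c. destruct c as [heta0 c].
assert (fixp : forall g, Gm g -> close2 eta0 g p r -> g p = p).
{ intros g Hg hg. apply NNPP. intro hne. apply c. now exists g. }
assert (hyp' := hyp). destruct hyp' as (F & HF & eF & d2 & d1).
assert (dF := lg_deg _ GG F HF).
destruct (lg_inv _ GG F HF) as (Fi & HFi & eFi & eFi').
destruct (linearization F p q2 (proj1 (AN F HF p)) eF d2 hq2) as (e2 & P2 & L2 & lz2).
assert (eF1 : side H Hi F (H p) = H p) by (unfold side; now rewrite HiH, eF).
destruct (linearization (side H Hi F) (H p) q1 (proj2 (AN F HF (H p))) eF1 d1 hq1)
  as (e1 & P1 & L1 & lz1).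
assert (inj2 : forall x y, F x = F y -> x = y).
{ intros x y h. rewrite <- (eFi' x), <- (eFi' y). now rewrite h. }
assert (inj1 : forall x y, side H Hi F x = side H Hi F y -> x = y).
{ intros x y h. unfold side in h. rewrite <- (HHi x), <- (HHi y). f_equal.
  apply inj2. rewrite <- (HiH (F (Hi x))), h. apply HiH. }
destruct (conj_iter_close F P2 L2 p q2 e2 hq2 lz2 inj2 r hr) as (s2 & hs2 & cn2).
destruct (conj_iter_close (side H Hi F) P1 L1 (H p) q1 e1 hq1 lz1 inj1 r hr) as (s1 & hs1 & cn1).
destruct (line_homeo_unif H Hi LH (s1 / 2) ltac:(lra)) as (d & hd & hunif).
destruct (lz_loc _ _ _ _ _ _ lz2) as (d0 & hd0 & hloc).
(* [p'] must lie in the zones of validity of [conj_iter_close] on both lines, and in the chart at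
   [p] so that its orbit under [F] tends to [p]. *)
set (t := Rmin (Rmin (s2 / 2) d) d0).
assert (ht : 0 < t) by (unfold t; repeat apply Rmin_pos; lra).
assert (t1 : t <= s2 / 2) by (eapply Rle_trans; [apply Rmin_l|apply Rmin_l]).
assert (t2 : t <= d) by (eapply Rle_trans; [apply Rmin_l|apply Rmin_r]).
assert (t3 : t <= d0) by apply Rmin_r.
destruct (MIN p (p + t / 2) (t / 2) ltac:(lra)) as (k' & Hk' & hk').
set (p' := k' p) in *.
assert (hp' : p < p' < p + t) by (apply Rabs_def2 in hk'; lra).
exists p', (Rmin (s2 / 2) (s1 / 2) / 2).
split; [now apply (hyperbolic_conj p q2 q1 k')|].
assert (m1 := Rmin_l (s2 / 2) (s1 / 2)). assert (m2 := Rmin_r (s2 / 2) (s1 / 2)).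
assert (hHp' : Rabs (H p' - H p) <= s1 / 2).
{ apply hunif. rewrite Rabs_pos_eq; lra. }
apply Rabs_le_between in hHp'.
apply moving_of_nonfixed; [repeat apply Rmin_pos; lra|].
intros eta heta.
destruct (cn2 eta heta) as (z2 & hz2 & cn2'). destruct (cn1 eta heta) as (z1 & hz1 & cn1').
(* Closeness [eta0] forces [f] to fix [p], as [conj_iter_close] requires. *)
set (z := Rmin eta0 (Rmin z2 z1)).
assert (hz : 0 < z) by (unfold z; repeat apply Rmin_pos; lra).
assert (za : z <= eta0) by apply Rmin_l.
assert (zb : z <= z2) by (eapply Rle_trans; [apply Rmin_r|apply Rmin_l]).
assert (zc : z <= z1) by (eapply Rle_trans; [apply Rmin_r|apply Rmin_r]).
destruct (hnc z hz) as (z' & hz' & hnc').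
destruct (hnd z' hz') as (f & Hf & nt & hnf).
assert (cf := hnc' f Hf hnf). destruct cf as [cf2 cf1].
assert (ef : f p = p).
{ apply fixp; auto. split; eapply C1_close_sub; [| | |exact cf2| | | |exact cf1]; lra. }
assert (Giter : forall G, Gm G -> forall m, Gm (Nat.iter m G)).
{ intros G HG m. induction m as [|m IH]; [exact (lg_id _ GG)|].
  exact (lg_comp _ GG G (Nat.iter m G) HG IH). }
assert (iterK : forall m x, Nat.iter m F (Nat.iter m Fi x) = x).
{ induction m as [|m IH]; intro x; auto. rewrite Nat.iter_succ_r. simpl. now rewrite eFi, IH. }
assert (exm : exists m, f (Nat.iter m F p') <> Nat.iter m F p').
{ apply NNPP. intro hno. apply nt. exists 0%Z. intro x. unfold ids. simpl. rewrite Rplus_0_r.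
  assert (f x - x = 0); [|lra].
  apply (identity_principle (fun x => f x - x) p).
  - intro y. apply analytic_at_minus_id, (AN f Hf y).
  - intros e he. destruct (hloc p') as [l1 l2]; [rewrite Rabs_pos_eq; lra|].
    destruct (pow_lt_any q2 (e / (2 * e2)) hq2) as [m hm].
    { apply Rdiv_lt_0_compat; auto. generalize (lz_e _ _ _ _ _ _ lz2); lra. }
    exists (Nat.iter m F p'). split.
    + split.
      * assert (dm := lg_deg _ GG _ (Giter F HF m)).
        assert (fm : Nat.iter m F p = p).
        { clear hm dm. induction m as [|m IH]; simpl; auto. now rewrite IH. }
        assert (zz := proj1 dm _ _ (proj1 hp')). rewrite fm in zz. rewrite Rabs_pos_eq; lra.
      * rewrite <- l2, (linearizing_iter F P2 L2 p q2 e2 hq2 lz2) by auto.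
        rewrite <- (lz_0 _ _ _ _ _ _ lz2).
        assert (he2 := lz_e _ _ _ _ _ _ lz2).
        assert (pq := pow_lt q2 m ltac:(lra)).
        assert (q2 ^ m <= 1) by (rewrite <- (pow1 m); apply pow_incr; lra).
        assert (hb : Rabs (q2 ^ m * L2 p') <= q2 ^ m * e2).
        { rewrite Rabs_mult, (Rabs_pos_eq (q2 ^ m)) by lra. apply Rmult_le_compat_l; lra. }
        destruct (linearizing_abs F P2 L2 p q2 e2 lz2 (q2 ^ m * L2 p') 0) as [_ b2].
        { nra. } { rewrite Rabs_R0; lra. }
        apply Rle_lt_trans with (1 := b2). rewrite Rminus_0_r.
        apply Rlt_div_r in hm; [|lra]. lra.
    + apply Rminus_diag_eq. apply NNPP. intro hc. apply hno. now exists m. }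
destruct exm as [m hm].
set (phi := fun x => Nat.iter m Fi (f (Nat.iter m F x))).
assert (Hphi : Gm phi).
{ apply (lg_comp _ GG (Nat.iter m Fi) (fun x => f (Nat.iter m F x))); auto.
  apply (lg_comp _ GG f (Nat.iter m F)); auto. }
assert (ephi : forall x, Nat.iter m F (phi x) = f (Nat.iter m F x)) by (intro; apply iterK).
exists phi. split; auto. split.
- intro hc. apply hm. rewrite <- ephi, hc. reflexivity.
- assert (w2 : C1_close eta phi (p - s2) (p + s2)).
  { apply (cn2' f) with (m := m); auto.
    - eapply C1_close_sub; [| | |exact cf2]; lra.
    - intro x; exact (Gm_ex_derive phi x Hphi). }
  assert (w1 : C1_close eta (side H Hi phi) (H p - s1) (H p + s1)).
  { apply (cn1' (side H Hi f)) with (m := m); auto.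
    - eapply C1_close_sub; [| | |exact cf1]; lra.
    - unfold side. now rewrite HiH, ef.
    - intro x; exact (Gm_ex_derive_side phi x Hphi).
    - intro x. rewrite !side_iter. unfold side. now rewrite !HiH, ephi. }
  split; eapply C1_close_sub; [| | |exact w2| | | |exact w1]; lra.
Qed.
End TwoSides.

(** * Expandability of all points *)

Lemma near_translation (phi : R -> R) (e' eta : R) :
  (forall w, Rabs w <= e' -> exists d, is_derive phi w d /\ Rabs (d - 1) <= eta) ->
  forall w w', Rabs w <= e' -> Rabs w' <= e' ->
  Rabs ((phi w - w) - (phi w' - w')) <= eta * Rabs (w - w').
Proof.
intros h w w' hw hw'.
apply Rabs_le_between in hw. apply Rabs_le_between in hw'.
destruct (MVT_gen (fun t => phi t - t) w' w (fun t => Derive phi t - 1)) as [c [hc ec]].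
- intros t ht.
  assert (htw : Rabs t <= e').
  { apply Rabs_le. revert ht; unfold Rmin, Rmax; destruct (Rle_dec w' w); lra. }
  destruct (h t htw) as (d & hd & _).
  apply (is_derive_minus phi (fun t => t) t _ 1).
  + apply Derive_correct. eexists; exact hd.
  + apply (is_derive_id t).
- intros t ht.
  assert (htw : Rabs t <= e').
  { apply Rabs_le. revert ht; unfold Rmin, Rmax; destruct (Rle_dec w' w); lra. }
  destruct (h t htw) as (d & hd & _).
  apply continuity_pt_minus; [|apply derivable_continuous_pt, derivable_pt_id].
  apply continuity_pt_filterlim, (ex_derive_continuous phi). eexists; exact hd.
- assert (hcw : Rabs c <= e').
  { apply Rabs_le. revert hc; unfold Rmin, Rmax; destruct (Rle_dec w' w); lra. }
  destruct (h c hcw) as (d & hd & hd1).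
  assert (eD : Derive phi c = d) by (apply is_derive_unique; exact hd).
  cbv beta in ec. rewrite ec, eD, Rabs_mult.
  apply Rmult_le_compat_r; auto. apply Rabs_pos.
Qed.

Lemma scale_up (q t e : R) : 0 < q < 1 -> 0 < t < e ->
  exists m, q * e <= t / q ^ m < e.
Proof.
intros hq ht.
destruct (pow_lt_any q (t / e) hq) as [n hn].
{ apply Rdiv_lt_0_compat; lra. }
assert (hn' : e <= t / q ^ n).
{ assert (pn := pow_lt q n ltac:(lra)). apply Rle_div_r; auto.
  apply Rlt_div_r in hn; [|lra]. lra. }
clear hn. induction n as [|n IH].
- simpl in hn'. lra.
- assert (pn := pow_lt q n ltac:(lra)).
  destruct (Rlt_le_dec (t / q ^ n) e) as [c|c]; auto.
  exists n. split; auto. simpl in hn'.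
  replace (t / (q * q ^ n)) with (t / q ^ n / q) in hn' by (field; lra).
  apply Rle_div_r in hn'; lra.
Qed.

Lemma scale_down (q R0 Y : R) : 0 < q < 1 -> 0 < R0 <= Y ->
  exists m, q * R0 < q ^ m * Y <= R0.
Proof.
intros hq hR.
destruct (pow_lt_any q (R0 / Y) hq) as [n hn].
{ apply Rdiv_lt_0_compat; lra. }
apply Rlt_div_r in hn; [|lra]. apply Rlt_le in hn.
induction n as [|n IH].
- exists 0%nat. simpl in *. split; nra.
- destruct (Rlt_le_dec R0 (q ^ n * Y)) as [c|c]; auto.
  exists (S n). split; auto. simpl. nra.
Qed.

Section Expandability.
Variables (Gm : (R -> R) -> Prop) (F P L : R -> R) (p q e r : R).
Hypothesis GG : lift_group Gm.
Hypothesis AN : forall g, Gm g -> forall x, analytic_at g x.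
Hypothesis POS : forall g, Gm g -> forall x, 0 < Derive g x.
Hypothesis MIN : forall x y eps, 0 < eps -> exists g, Gm g /\ Rabs (g x - y) < eps.
Hypothesis HF : Gm F.
Hypothesis hq : 0 < q < 1.
Hypothesis lz : linearizing F p q e P L.
Hypothesis hr : 0 < r.
Hypothesis mv : forall eta, 0 < eta -> exists g, Gm g /\ p < g p /\ C1_close eta g (p - r) (p + r).

(* d is the derivative in the linearizing coordinate. *)
Definition chart_step (k : R -> R) (y z d : R) : Prop :=
  Gm k /\ Rabs y < e /\ Rabs z < e /\ k (P y) = P z /\
  is_derive k (P y) (d * Derive P z / Derive P y).

Lemma P_pos (y : R) : Rabs y < e -> / 2 <= Derive P y <= 2.
Proof. intro h. apply (lz_D _ _ _ _ _ _ lz y). lra. Qed.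

Lemma chart_step_comp (k k' : R -> R) (y z w d d' : R) :
  chart_step k y z d -> chart_step k' z w d' -> chart_step (fun x => k' (k x)) y w (d * d').
Proof.
intros (G1 & a1 & a2 & a3 & a4) (G2 & b1 & b2 & b3 & b4).
split; [exact (lg_comp _ GG k' k G2 G1)|]. split; auto. split; auto. split.
- now rewrite a3.
- rewrite <- a3 in b4. assert (h := is_derive_comp k' k (P y) _ _ b4 a4).
  assert (p1 := P_pos y a1). assert (p2 := P_pos z a2).
  replace (d * d' * Derive P w / Derive P y) with
    (scal (d * Derive P z / Derive P y) (d' * Derive P w / Derive P z)); [exact h|].
  unfold scal; simpl; unfold mult; simpl. field. lra.
Qed.

Lemma chart_step_F (y : R) : Rabs y < e -> chart_step F y (q * y) q.
Proof.
intro hy. assert (hqy : Rabs (q * y) < e).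
{ rewrite Rabs_mult, (Rabs_pos_eq q) by lra. generalize (Rabs_pos y); nra. }
split; auto. split; auto. split; auto. split; [now apply (lz_F _ _ _ _ _ _ lz y), Rlt_le|].
assert (dF := Derive_correct _ _ (analytic_ex_derive _ _ (AN F HF (P y)))).
destruct (lz_D _ _ _ _ _ _ lz y ltac:(lra)) as [dP bP].
destruct (lz_D _ _ _ _ _ _ lz (q * y) ltac:(lra)) as [dPq bPq].
assert (d1 := is_derive_comp F P y _ _ dF dP).
assert (d2 : is_derive (fun t => F (P t)) y (q * Derive P (q * y))).
{ apply (is_derive_ext_loc (fun t => P (q * t))).
  - apply (locally_Rabs y (e - Rabs y)); [lra|]. intros t ht. symmetry.
    apply (lz_F _ _ _ _ _ _ lz). replace t with ((t - y) + y) by ring.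
    apply Rle_trans with (1 := Rabs_triang _ _). lra.
  - apply (is_derive_comp P (fun t => q * t) y _ q); auto.
    evar_last; [apply is_derive_scal, (is_derive_id y)|]. simpl. apply Rmult_1_r. }
assert (ed : Derive P y * Derive F (P y) = q * Derive P (q * y)).
{ rewrite <- (is_derive_unique _ _ _ d2). symmetry. exact (is_derive_unique _ _ _ d1). }
replace (q * Derive P (q * y) / Derive P y) with (Derive F (P y)); auto.
rewrite <- ed. field. lra.
Qed.

Lemma chart_step_inv (k : R -> R) (y z d : R) : d <> 0 -> chart_step k y z d ->
  exists ki, chart_step ki z y (/ d).
Proof.
intros hd (G1 & a1 & a2 & a3 & a4).
destruct (lg_inv _ GG k G1) as (ki & Gki & e1 & e2).
exists ki. split; auto. split; auto. split; auto. split.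
- now rewrite <- a3.
- assert (p1 := P_pos y a1). assert (p2 := P_pos z a2).
  assert (dk := Derive_correct _ _ (analytic_ex_derive _ _ (AN ki Gki (k (P y))))).
  assert (h := is_derive_comp ki k (P y) _ _ dk a4).
  assert (hi : is_derive (fun x => ki (k x)) (P y) 1).
  { apply (is_derive_ext (fun t => t)); [intro; now rewrite e2|]. apply (is_derive_id (P y)). }
  assert (ed : d * Derive P z / Derive P y * Derive ki (k (P y)) = 1).
  { rewrite <- (is_derive_unique _ _ _ hi). symmetry. exact (is_derive_unique _ _ _ h). }
  rewrite a3 in *.
  replace (/ d * Derive P y / Derive P z) with (Derive ki (P z)); auto.
  apply (Rmult_eq_reg_l (d * Derive P z / Derive P y)).
  + rewrite ed. field. repeat split; lra.
  + intro hz. rewrite hz in ed. lra.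
Qed.

Lemma chart_step_id (y : R) : Rabs y < e -> chart_step ids y y 1.
Proof.
intro hy. split; [exact (lg_id _ GG)|]. split; auto. split; auto. split; auto.
assert (p1 := P_pos y hy).
replace (1 * Derive P y / Derive P y) with 1 by (field; lra). apply (is_derive_id (P y)).
Qed.

Lemma chart_step_pow (m : nat) (y : R) : Rabs y < e -> exists k, chart_step k y (q ^ m * y) (q ^ m).
Proof.
intro hy. induction m as [|m [k hk]].
- exists ids. simpl. rewrite Rmult_1_l. now apply chart_step_id.
- exists (fun x => F (k x)). simpl. rewrite (Rmult_comm q (q ^ m)).
  apply (chart_step_comp k F y (q ^ m * y)); auto.
  replace (q ^ m * q * y) with (q * (q ^ m * y)) by ring. apply chart_step_F, hk.
Qed.

(* Iterating an almost-translation by delta moves a point at distance at most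
   R0 of 0 into [-2 delta, 0) with almost no loss of derivative. *)
Lemma climb (g : R -> R) (e' eta delta R0 : R) : 0 < eta <= 1 / 6 -> 0 < delta ->
  0 < e' <= e / 2 -> 2 * delta <= e / 4 -> eta <= e / 4 -> R0 <= e' -> eta * R0 <= delta / 4 ->
  Gm g -> L (g (P 0)) = delta ->
  (forall w, Rabs w <= e' -> P (L (g (P w))) = g (P w) /\ Rabs (L (g (P w)) - w) <= eta /\
     exists d, is_derive (fun w => L (g (P w))) w d /\ Rabs (d - 1) <= eta /\
      d = Derive P w / Derive P (L (g (P w))) * Derive g (P w)) ->
  forall n y, - R0 <= y < 0 -> - y <= 2 * delta + INR n * (3 / 4 * delta) ->
  exists k z d, chart_step k y z d /\ - (2 * delta) <= z < 0 /\ (1 - eta) ^ n <= d.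
Proof.
intros heta hdel he' hd4 heta4 hR hR4 Hg h0 hch.
assert (ntr := near_translation (fun w => L (g (P w))) e' eta
  ltac:(intros w hw; destruct (hch w hw) as (_ & _ & d & d1 & d2 & _); exists d; auto)).
induction n as [|n IH]; intros y hy hn.
- exists ids, y, 1. simpl in *. split; [|lra]. apply chart_step_id. rewrite Rabs_left; lra.
- destruct (Rle_lt_dec (- y) (2 * delta)) as [c|c].
  { exists ids, y, 1. split; [|split; [lra|]].
    - apply chart_step_id. rewrite Rabs_left; lra.
    - assert (chart_H : (1 - eta) ^ S n <= 1 ^ S n) by (apply pow_incr; lra).
      rewrite pow1 in chart_H. exact chart_H. }
  assert (hye : Rabs y <= e') by (rewrite Rabs_left; lra).
  destruct (hch y hye) as (c1 & c2 & d & d1 & d2 & d3).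
  assert (z1 := ntr y 0 hye ltac:(rewrite Rabs_R0; lra)). cbv beta in z1.
  rewrite h0, !Rminus_0_r, (Rabs_left y) in z1 by lra.
  assert (hz2 : eta * - y <= delta / 4) by nra.
  set (y' := L (g (P y))) in *. apply Rabs_le_between in z1.
  assert (hy' : y + 3 / 4 * delta <= y' <= y + 5 / 4 * delta) by lra.
  destruct (IH y') as (k & z & d' & st & hz & hd'); [lra| |].
  { rewrite S_INR in hn. lra. }
  exists (fun x => k (g x)), z, (d * d'). split; [|split; auto].
  + apply (chart_step_comp g k y y'); auto.
    split; auto. split; [rewrite Rabs_left; lra|]. split; [rewrite Rabs_left; lra|].
    split; auto.
    assert (p1 := P_pos y ltac:(rewrite Rabs_left; lra)).
    assert (p2 := P_pos y' ltac:(rewrite Rabs_left; lra)).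
    replace (d * Derive P y' / Derive P y) with (Derive g (P y)).
    * apply Derive_correct, analytic_ex_derive, AN; auto.
    * rewrite d3. field. lra.
  + simpl. apply Rabs_le_between in d2. apply Rmult_le_compat; try lra. apply pow_le; lra.
Qed.

Lemma bernoulli (eta : R) (n : nat) : 0 <= eta <= 1 -> 1 - INR n * eta <= (1 - eta) ^ n.
Proof.
intro h. induction n as [|n IH]; [simpl; lra|]. rewrite S_INR. simpl.
destruct (Rle_lt_dec 0 (1 - INR n * eta)).
- assert (pn := pos_INR n). nra.
- assert (0 <= (1 - eta) ^ n) by (apply pow_le; lra). nra.
Qed.

(** The map is [k4 o k2 o F^m o g0]. In the chart, [F^m] contracts by a factor of order [R0], at
    least of order [delta / eta]; the iterates of [g] in [k2] lose at most a factor 2 and stop at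
    distance about [delta] or less; the inverse power of [F] in [k4] expands by order [1 / delta].
    The product is at least of order [1 / eta], which beats the fixed derivative of [g0]. *)
Lemma everywhere_expandable (x : R) : exists k, Gm k /\ 1 < Derive k x.
Proof.
assert (he := lz_e _ _ _ _ _ _ lz).
destruct (chart_near F P L p q e lz r hr) as [e' [he' hchart]].
assert (L0 : L p = 0).
{ rewrite <- (lz_0 _ _ _ _ _ _ lz) at 1. apply (lz_L _ _ _ _ _ _ lz). rewrite Rabs_R0; lra. }
destruct (lz_loc _ _ _ _ _ _ lz) as [d0 [hd0 hloc]].
set (t := Rmin d0 (e' / 4)).
assert (ht : 0 < t) by (apply Rmin_pos; lra).
assert (t1 : t <= d0) by apply Rmin_l. assert (t2 : t <= e' / 4) by apply Rmin_r.
(* The target is on the left of [p] because the maps [g] to be iterated move [p] to the right. *)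
destruct (MIN x (p - t / 2) (t / 2) ltac:(lra)) as (g0 & Hg0 & hg0).
apply Rabs_def2 in hg0.
destruct (hloc (g0 x)) as [l1 l2]; [rewrite Rabs_left; lra|].
set (y0 := L (g0 x)) in *.
assert (hy0 : - e' < y0 < 0).
{ destruct (linearizing_abs F P L p q e lz y0 0) as [b1 b2]; auto; [rewrite Rabs_R0; lra|].
  rewrite (lz_0 _ _ _ _ _ _ lz), l2, Rminus_0_r in b1, b2.
  rewrite (Rabs_left (g0 x - p)) in b1, b2 by lra.
  split.
  - assert (Rabs y0 < e') by lra. apply Rabs_def2 in H; lra.
  - destruct (Rlt_le_dec y0 0); auto. exfalso.
    destruct (linearizing_mvt F P L p q e lz 0 y0) as [b3 _]; auto; [rewrite Rabs_R0; lra|].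
    rewrite (lz_0 _ _ _ _ _ _ lz), l2 in b3. lra. }
assert (hg0' := POS g0 Hg0 x). set (D0 := Derive g0 x) in *.
set (Y := - y0). assert (hY : 0 < Y < e') by (unfold Y; lra).
set (c := Rmin (1 / 4) Y). assert (hc : 0 < c) by (apply Rmin_pos; lra).
assert (hc1 : c <= 1 / 4) by apply Rmin_l. assert (hc2 : c <= Y) by apply Rmin_r.
set (T := q * q * e * c / (4 * Y)).
assert (hT : 0 < T) by (unfold T; apply Rdiv_lt_0_compat; [repeat apply Rmult_lt_0_compat|]; lra).
(* The expansion in the chart will be at least [T / eta]. This [eta] makes it at least [8 / D0], and
   leaving the chart costs at most a factor 4. *)
set (eta := Rmin (Rmin (1 / 6) (e / 8)) (T * D0 / 8)).
assert (pTD : 0 < T * D0) by nra.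
assert (heta : 0 < eta) by (unfold eta; repeat apply Rmin_pos; lra).
assert (h1 : eta <= 1 / 6) by (eapply Rle_trans; [apply Rmin_l|apply Rmin_l]).
assert (h2 : eta <= e / 8) by (eapply Rle_trans; [apply Rmin_l|apply Rmin_r]).
assert (h3 : eta <= T * D0 / 8) by apply Rmin_r.
destruct (hchart eta heta) as (eta' & heta' & hch).
destruct (mv eta' heta') as (g & Hg & hgp & hgc).
specialize (hch g hgc).
set (delta := L (g (P 0))).
destruct (hch 0 ltac:(rewrite Rabs_R0; lra)) as (b1 & b2 & _ & b3 & _).
fold delta in b1, b2, b3. rewrite Rminus_0_r in b3.
rewrite (lz_0 _ _ _ _ _ _ lz) in b2.
assert (hdel : 0 < delta).
{ destruct (Rlt_le_dec 0 delta); auto. exfalso.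
  destruct (linearizing_mvt F P L p q e lz delta 0) as [b4 _]; auto; [rewrite Rabs_R0; lra|].
  rewrite (lz_0 _ _ _ _ _ _ lz), b2 in b4. lra. }
rewrite Rabs_pos_eq in b3 by lra.
(* Up to distance [R0] from 0, the displacement of [g] differs from [delta] by at most
   [eta * R0 <= delta / 4]. *)
set (R0 := Rmin (delta / (4 * eta)) Y).
assert (hR0 : 0 < R0) by (apply Rmin_pos; [apply Rdiv_lt_0_compat|]; lra).
assert (hR1 : eta * R0 <= delta / 4).
{ apply Rle_trans with (eta * (delta / (4 * eta))).
  - apply Rmult_le_compat_l; [lra|apply Rmin_l].
  - right; field; lra. }
assert (hR2 : R0 <= Y) by apply Rmin_r.
assert (hR3 : c * delta <= R0 * eta).
{ unfold R0, Rmin. destruct (Rle_dec (delta / (4 * eta)) Y) as [w|w].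
  - replace (delta / (4 * eta) * eta) with (delta / 4) by (field; lra). nra.
  - nra. }
destruct (scale_down q R0 Y hq ltac:(lra)) as [m [hm1 hm2]].
destruct (chart_step_pow m y0 ltac:(rewrite Rabs_left; lra)) as [k1 st1].
set (y1 := q ^ m * y0) in *.
assert (hy1 : - R0 <= y1 < 0).
{ unfold y1. replace (q ^ m * y0) with (- (q ^ m * Y)) by (unfold Y; ring). nra. }
(* Just above [1 / (3 * eta)] steps of at least [3 / 4 * delta] cover [R0 <= delta / (4 * eta)], and
   by [bernoulli] the factor [(1 - eta) ^ n] is still at least 1/2. *)
destruct (nfloor_ex (1 / (3 * eta))) as [n0 [hn0 hn1]].
{ apply Rdiv_le_0_compat; lra. }
set (n := S n0).
assert (hneta : INR n * eta <= 1 / 2).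
{ unfold n. rewrite S_INR. apply Rle_div_r in hn0; lra. }
destruct (climb g e' eta delta R0 ltac:(lra) hdel he' ltac:(lra) ltac:(lra) ltac:(lra) hR1 Hg
  eq_refl) with (n := n) (y := y1) as (k2 & z & d & st2 & hz & hd); auto.
{ intros w hw. destruct (hch w hw) as (_ & w2 & _ & w4 & w5). auto. }
{ assert (1 < 3 * eta * INR n).
  { unfold n. rewrite S_INR. apply Rlt_div_l in hn1; lra. }
  assert (R0 <= 3 / 4 * delta * INR n).
  { apply (Rmult_le_reg_l eta); auto.
    assert (0 <= delta * (3 * eta * INR n - 1)) by (apply Rmult_le_pos; lra). lra. }
  lra. }
assert (hd2 : 1 / 2 <= d).
{ apply Rle_trans with (2 := hd). apply Rle_trans with (2 := bernoulli eta n ltac:(lra)). lra. }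
destruct (scale_up q (2 * delta) e hq ltac:(lra)) as [m' [hm3 hm4]].
assert (pm := pow_lt q m ltac:(lra)). assert (pm' := pow_lt q m' ltac:(lra)).
assert (hz' : Rabs (z / q ^ m') < e).
{ unfold Rdiv. rewrite Rabs_mult, Rabs_inv, (Rabs_pos_eq (q ^ m')), Rabs_left by lra.
  apply Rle_lt_trans with (2 := hm4). unfold Rdiv. apply Rmult_le_compat_r; [|lra].
  apply Rlt_le, Rinv_0_lt_compat; lra. }
destruct (chart_step_pow m' (z / q ^ m') hz') as [k3 st3].
replace (q ^ m' * (z / q ^ m')) with z in st3 by (field; lra).
destruct (chart_step_inv k3 _ _ _ (Rgt_not_eq _ _ pm') st3) as [k4 st4].
assert (st := chart_step_comp _ _ _ _ _ _ _ (chart_step_comp _ _ _ _ _ _ _ st1 st2) st4).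
set (k := fun x => k4 (k2 (k1 x))) in *.
destruct st as (Gk & _ & s2 & s3 & s4).
set (Lam := q ^ m * d * / q ^ m') in *.
exists (fun x => k (g0 x)). split; [exact (lg_comp _ GG k g0 Gk Hg0)|].
rewrite l2 in s4.
assert (dc := is_derive_comp k g0 x _ _ s4
  (Derive_correct _ _ (analytic_ex_derive _ _ (AN g0 Hg0 x)))).
assert (ec : Derive (fun x => k (g0 x)) x =
  D0 * (Lam * Derive P (z / q ^ m') / Derive P y0)) by exact (is_derive_unique _ _ _ dc).
rewrite ec.
assert (p1 := P_pos y0 ltac:(rewrite Rabs_left; lra)). assert (p2 := P_pos _ hz').
assert (hLam : T / eta <= Lam).
{ apply Rle_div_l; auto.
  assert (w1 : q * R0 / Y < q ^ m) by (apply Rlt_div_l; lra).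
  assert (w2 : q * e / (2 * delta) <= / q ^ m').
  { apply Rle_div_l; [lra|]. unfold Rdiv in hm3. lra. }
  assert (w3 : 0 < q * e / (2 * delta)) by (apply Rdiv_lt_0_compat; nra).
  assert (w4 : q * R0 / Y * (1 / 2) <= q ^ m * d).
  { assert (0 < q * R0 / Y) by (apply Rdiv_lt_0_compat; nra). nra. }
  assert (w5 : q * R0 / Y * (1 / 2) * (q * e / (2 * delta)) <= Lam).
  { unfold Lam. apply Rmult_le_compat; try lra.
    assert (0 < q * R0 / Y) by (apply Rdiv_lt_0_compat; nra). lra. }
  apply Rle_trans with (q * R0 / Y * (1 / 2) * (q * e / (2 * delta)) * eta).
  - replace (q * R0 / Y * (1 / 2) * (q * e / (2 * delta)) * eta) with
      (q * q * e / (4 * Y * delta) * (R0 * eta)) by (field; lra).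
    replace T with (q * q * e / (4 * Y * delta) * (c * delta)) by (unfold T; field; lra).
    apply Rmult_le_compat_l; auto.
    apply Rlt_le, Rdiv_lt_0_compat; repeat apply Rmult_lt_0_compat; lra.
  - apply Rmult_le_compat_r; lra. }
assert (hTe : 8 <= T / eta * D0).
{ replace (T / eta * D0) with (T * D0 / eta) by (field; lra).
  apply (proj1 (Rle_div_r 8 (T * D0) eta heta)). lra. }
assert (hLD : 8 <= Lam * D0) by nra.
assert (hLpos : 0 < Lam) by nra.
assert (w6 : / 4 <= Derive P (z / q ^ m') / Derive P y0) by (apply Rle_div_r; lra).
replace (D0 * (Lam * Derive P (z / q ^ m') / Derive P y0)) with
  (Lam * D0 * (Derive P (z / q ^ m') / Derive P y0)) by (field; lra).
nra.
Qed.
End Expandability.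

(** * The conjugacy in linearizing coordinates *)

(** [eta] is to be chosen after the number [K] of steps: then [eta * y <= kap * delta] all along,
    and each step has length [delta] up to [kap * delta]. *)
Lemma near_progression (phi : R -> R) (e' eta delta kap : R) (K : nat) :
  0 < delta -> 0 <= eta -> phi 0 = delta -> 2 * INR K * delta <= e' ->
  2 * INR K * eta <= kap -> kap <= 1 ->
  (forall w w', Rabs w <= e' -> Rabs w' <= e' ->
     Rabs ((phi w - w) - (phi w' - w')) <= eta * Rabs (w - w')) ->
  forall j, (j <= K)%nat ->
  INR j * delta * (1 - kap) <= Nat.iter j phi 0 <= INR j * delta * (1 + kap).
Proof.
intros hd he h0 hK hk hk1 h. induction j as [|j IH]; intro hj.
- simpl. lra.
- specialize (IH ltac:(lia)). rewrite S_INR. simpl Nat.iter.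
  set (y := Nat.iter j phi 0) in *.
  assert (pj := pos_INR j).
  assert (hjK : INR j + 1 <= INR K) by (rewrite <- S_INR; apply le_INR; auto).
  assert (pjd : 0 <= INR j * delta) by nra.
  assert (hkap : 0 <= kap) by nra.
  assert (hy : 0 <= y <= 2 * INR K * delta).
  { split; [nra|]. apply Rle_trans with (1 := proj2 IH).
    assert (INR j * delta <= INR K * delta) by (apply Rmult_le_compat_r; lra). nra. }
  assert (z := h y 0 ltac:(rewrite Rabs_pos_eq; lra) ltac:(rewrite Rabs_R0; lra)).
  rewrite h0, !Rminus_0_r, (Rabs_pos_eq y) in z by lra.
  apply Rabs_le_between in z.
  assert (eta * y <= kap * delta).
  { apply Rle_trans with (eta * (2 * INR K * delta)); [apply Rmult_le_compat_l; lra|nra]. }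
  split; nra.
Qed.

Section Linear.
Variables (Gm : (R -> R) -> Prop) (H Hi F P2 L2 P1 L1 : R -> R) (p q2 q1 e2 e1 r : R).
Hypothesis LH : line_homeo H Hi.
Hypothesis hq2 : 0 < q2 < 1.
Hypothesis hq1 : 0 < q1 < 1.
Hypothesis lz2 : linearizing F p q2 e2 P2 L2.
Hypothesis lz1 : linearizing (side H Hi F) (H p) q1 e1 P1 L1.
Hypothesis mv : moving Gm H Hi p r.

Let dH : deg1 H := proj1 LH.
Let HiH : forall x, Hi (H x) = x := proj2 (proj2 (proj2 LH)).
Let HHi : forall x, H (Hi x) = x := proj1 (proj2 (proj2 LH)).

Let he2 : 0 < e2 := lz_e _ _ _ _ _ _ lz2.
Let he1 : 0 < e1 := lz_e _ _ _ _ _ _ lz1.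

(** It conjugates the homothety of ratio [q2] to that of ratio [q1], as the charts linearize [F] and
    its conjugate. *)
Definition chart_H (y : R) : R := L1 (H (P2 y)).

Lemma chart_H_domain : exists eps, 0 < eps <= e2 /\
  (exists d, 0 < d /\ (forall x, Rabs (x - p) <= d -> Rabs (L2 x) <= e2 /\ P2 (L2 x) = x) /\
     forall y, Rabs y <= eps -> Rabs (P2 y - p) <= d / 2) /\
  (exists d, 0 < d /\ (forall x, Rabs (x - H p) <= d -> Rabs (L1 x) <= e1 /\ P1 (L1 x) = x) /\
     forall y, Rabs y <= eps -> Rabs (H (P2 y) - H p) <= d / 2).
Proof.
destruct (lz_loc _ _ _ _ _ _ lz2) as [d2 [hd2 hloc2]].
destruct (lz_loc _ _ _ _ _ _ lz1) as [d1 [hd1 hloc1]].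
destruct (line_homeo_unif H Hi LH (d1 / 2) ltac:(lra)) as [d [hd hunif]].
set (eps := Rmin e2 (Rmin (d2 / 4) (d / 2))).
assert (heps : 0 < eps) by (unfold eps; repeat apply Rmin_pos; lra).
assert (h1 : eps <= e2) by apply Rmin_l.
assert (h2 : eps <= d2 / 4) by (eapply Rle_trans; [apply Rmin_r|apply Rmin_l]).
assert (h3 : eps <= d / 2) by (eapply Rle_trans; [apply Rmin_r|apply Rmin_r]).
assert (hP : forall y, Rabs y <= eps -> Rabs (P2 y - p) <= 2 * eps).
{ intros y hy. rewrite <- (lz_0 _ _ _ _ _ _ lz2).
  destruct (linearizing_abs F P2 L2 p q2 e2 lz2 y 0) as [_ b]; try lra.
  - rewrite Rabs_R0; lra.
  - rewrite Rminus_0_r in b. lra. }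
exists eps. split; [lra|]. split.
- exists d2. split; auto. split; auto. intros y hy. specialize (hP y hy). lra.
- exists d1. split; auto. split; auto. intros y hy. specialize (hP y hy).
  apply hunif. lra.
Qed.

(** [chart_H] maps the first [K] iterates of 0 under [g], read in one chart, to those under its
    conjugate, read in the other; both are nearly arithmetic progressions. Dividing by powers of the
    multipliers brings them to a fixed scale. As [K] is arbitrary, [chart_H] preserves ratios
    exactly. *)
Lemma conjugate_linear : exists T s, 0 < T /\ 0 < s /\
  (exists eps d2 d1, T < eps /\ eps <= e2 /\ 0 < d2 /\ 0 < d1 /\
    (forall x, Rabs (x - p) <= d2 -> Rabs (L2 x) <= e2 /\ P2 (L2 x) = x) /\
    (forall x, Rabs (x - H p) <= d1 -> Rabs (L1 x) <= e1 /\ P1 (L1 x) = x) /\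
    forall y, Rabs y <= eps -> Rabs (P2 y - p) <= d2 / 2 /\ Rabs (H (P2 y) - H p) <= d1 / 2) /\
  forall y, 0 <= y <= T -> H (P2 y) = P1 (s * y) /\ Rabs (s * y) <= e1.
Proof.
destruct chart_H_domain as (eps & heps & (d2 & hd2 & loc2 & dom2) & (d1 & hd1 & loc1 & dom1)).
assert (hhP : forall y, Rabs y <= eps -> Rabs (chart_H y) <= e1 /\ P1 (chart_H y) = H (P2 y)).
{ intros y hy. apply loc1. specialize (dom1 y hy). lra. }
assert (hh0 : chart_H 0 = 0).
{ unfold chart_H. rewrite (lz_0 _ _ _ _ _ _ lz2), <- (lz_0 _ _ _ _ _ _ lz1).
  apply (lz_L _ _ _ _ _ _ lz1). rewrite Rabs_R0; lra. }
assert (hhincr : forall y z, Rabs y <= eps -> Rabs z <= eps -> y < z -> chart_H y < chart_H z).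
{ intros y z hy hz hyz. destruct (Rlt_le_dec (chart_H y) (chart_H z)) as [c|c]; auto. exfalso.
  destruct (hhP y hy) as [y1 y2]. destruct (hhP z hz) as [z1 z2].
  destruct (linearizing_mvt _ P1 L1 _ q1 e1 lz1 (chart_H z) (chart_H y)) as [b _]; auto.
  destruct (linearizing_mvt F P2 L2 p q2 e2 lz2 y z) as [b' _]; try lra.
  rewrite y2, z2 in b. assert (P2 y < P2 z) by lra. apply dH in H0. lra. }
assert (hhscale : forall m y, Rabs y <= eps -> chart_H (q2 ^ m * y) = q1 ^ m * chart_H y).
{ assert (one : forall y, Rabs y <= eps -> chart_H (q2 * y) = q1 * chart_H y).
  { intros y hy. destruct (hhP y hy) as [y1 y2]. unfold chart_H at 1.
    rewrite <- (lz_F _ _ _ _ _ _ lz2) by lra.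
    replace (H (F (P2 y))) with (side H Hi F (P1 (chart_H y))).
    2:{ rewrite y2. unfold side. now rewrite HiH. }
    rewrite (lz_F _ _ _ _ _ _ lz1) by auto. apply (lz_L _ _ _ _ _ _ lz1).
    rewrite Rabs_mult, (Rabs_pos_eq q1) by lra. generalize (Rabs_pos (chart_H y)); nra. }
  induction m as [|m IH]; intros y hy; simpl; [now rewrite !Rmult_1_l|].
  rewrite Rmult_assoc, one, IH by (auto;
    rewrite Rabs_mult, (Rabs_pos_eq (q2 ^ m)) by (apply pow_le; lra);
    assert (q2 ^ m <= 1) by (rewrite <- (pow1 m); apply pow_incr; lra);
    assert (0 < q2 ^ m) by (apply pow_lt; lra); generalize (Rabs_pos y); nra).
  ring. }
assert (hhunif : forall om, 0 < om -> exists d, 0 < d /\ forall y z,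
  Rabs y <= eps -> Rabs z <= eps -> Rabs (y - z) <= d -> Rabs (chart_H y - chart_H z) <= om).
{ intros om hom. destruct (line_homeo_unif H Hi LH (om / 2) ltac:(lra)) as [d [hd hu]].
  exists (d / 2). split; [lra|]. intros y z hy hz hyz.
  destruct (hhP y hy) as [y1 y2]. destruct (hhP z hz) as [z1 z2].
  destruct (linearizing_abs _ P1 L1 _ q1 e1 lz1 (chart_H y) (chart_H z) y1 z1) as [b _].
  destruct (linearizing_abs F P2 L2 p q2 e2 lz2 y z) as [_ b']; try lra.
  rewrite y2, z2 in b. assert (w := hu (P2 y) (P2 z) ltac:(lra)). lra. }
destruct mv as [hr mv'].
destruct (chart_near F P2 L2 p q2 e2 lz2 r hr) as (e2' & he2' & ch2).
destruct (chart_near (side H Hi F) P1 L1 (H p) q1 e1 lz1 r hr) as (e1' & he1' & ch1).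
set (T0 := eps / 2). assert (hT0 : 0 < T0) by (unfold T0; lra).
(* [e] and [c] are the steps of the rescaled progressions on the two lines, both at most of order
   [1 / K]; the length covered is at least [q2 * T0] whatever [K] is. *)
assert (prog : forall K kap, (1 <= K)%nat -> 0 < kap <= 1 / 2 ->
  exists e c, 0 < e /\ 0 < c /\ q2 * T0 <= INR K * e <= T0 /\ INR K * c <= 2 * e1 /\
  forall j, (j <= K)%nat -> exists u, INR j * e * (1 - kap) <= u <= INR j * e * (1 + kap) /\
    INR j * c * (1 - kap) <= chart_H u <= INR j * c * (1 + kap)).
{ intros K kap hK hkap. assert (hK' : 1 <= INR K) by (apply (le_INR 1); auto).
  set (eta := Rmin (Rmin (kap / (2 * INR K)) (T0 / (4 * INR K)))
    (Rmin (e2' / (2 * INR K)) (e1' / (2 * INR K)))).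
  assert (heta : 0 < eta) by (unfold eta; repeat apply Rmin_pos; apply Rdiv_lt_0_compat; lra).
  assert (f1 : 2 * INR K * eta <= kap).
  { rewrite Rmult_comm. apply Rle_div_r; [lra|].
    eapply Rle_trans; [apply Rmin_l|apply Rmin_l]. }
  assert (f2 : 4 * INR K * eta <= T0).
  { rewrite Rmult_comm. apply Rle_div_r; [lra|].
    eapply Rle_trans; [apply Rmin_l|apply Rmin_r]. }
  assert (f3 : 2 * INR K * eta <= e2').
  { rewrite Rmult_comm. apply Rle_div_r; [lra|].
    eapply Rle_trans; [apply Rmin_r|apply Rmin_l]. }
  assert (f4 : 2 * INR K * eta <= e1').
  { rewrite Rmult_comm. apply Rle_div_r; [lra|].
    eapply Rle_trans; [apply Rmin_r|apply Rmin_r]. }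
  destruct (ch2 eta heta) as (z2 & hz2 & c2). destruct (ch1 eta heta) as (z1 & hz1 & c1).
  destruct (mv' (Rmin z2 z1) ltac:(now apply Rmin_pos)) as (g & Hg & hgp & g2 & g1).
  specialize (c2 g (C1_close_sub _ _ _ _ _ _ _ (Rmin_l z2 z1) (Rle_refl _) (Rle_refl _) g2)).
  specialize (c1 _ (C1_close_sub _ _ _ _ _ _ _ (Rmin_r z2 z1) (Rle_refl _) (Rle_refl _) g1)).
  set (G := fun w => L2 (g (P2 w))) in *. set (Ff := fun w => L1 (side H Hi g (P1 w))) in *.
  set (del2 := G 0). set (del1 := Ff 0).
  assert (b2 : P2 del2 = g p).
  { destruct (c2 0 ltac:(rewrite Rabs_R0; lra)) as (_ & a & _).
    now rewrite (lz_0 _ _ _ _ _ _ lz2) in a at 2. }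
  assert (b1 : P1 del1 = H (g p)).
  { destruct (c1 0 ltac:(rewrite Rabs_R0; lra)) as (_ & a & _).
    rewrite (lz_0 _ _ _ _ _ _ lz1) in a at 2. unfold side in a at 2. now rewrite HiH in a. }
  assert (pos : forall Fx P L pp q e dd, linearizing Fx pp q e P L -> Rabs dd <= e ->
    pp < P dd -> 0 < dd).
  { intros Fx P L pp q e dd lz hdd hlt. destruct (Rlt_le_dec 0 dd); auto. exfalso.
    destruct (linearizing_mvt Fx P L pp q e lz dd 0) as [b _]; auto.
    - rewrite Rabs_R0. generalize (lz_e _ _ _ _ _ _ lz); lra.
    - rewrite (lz_0 _ _ _ _ _ _ lz) in b. lra. }
  assert (hdel2 : 0 < del2).
  { apply (pos F P2 L2 p q2 e2); auto; [|now rewrite b2].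
    apply (c2 0). rewrite Rabs_R0; lra. }
  assert (hdel1 : 0 < del1).
  { apply (pos (side H Hi F) P1 L1 (H p) q1 e1); auto; [|rewrite b1; now apply dH].
    apply (c1 0). rewrite Rabs_R0; lra. }
  assert (sm2 : del2 <= eta).
  { destruct (c2 0 ltac:(rewrite Rabs_R0; lra)) as (_ & _ & _ & a & _).
    change (Rabs (del2 - 0) <= eta) in a. rewrite Rminus_0_r, Rabs_pos_eq in a; lra. }
  assert (sm1 : del1 <= eta).
  { destruct (c1 0 ltac:(rewrite Rabs_R0; lra)) as (_ & _ & _ & a & _).
    change (Rabs (del1 - 0) <= eta) in a. rewrite Rminus_0_r, Rabs_pos_eq in a; lra. }
  assert (np2 := near_progression G e2' eta del2 kap K hdel2 ltac:(lra) eq_refl ltac:(nra) f1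
    ltac:(lra) (near_translation G e2' eta ltac:(intros w hw; destruct (c2 w hw) as
      (_ & _ & _ & _ & d & a1 & a2 & _); exists d; auto))).
  assert (np1 := near_progression Ff e1' eta del1 kap K hdel1 ltac:(lra) eq_refl ltac:(nra) f1
    ltac:(lra) (near_translation Ff e1' eta ltac:(intros w hw; destruct (c1 w hw) as
      (_ & _ & _ & _ & d & a1 & a2 & _); exists d; auto))).
  assert (rng : forall j, (j <= K)%nat -> 0 <= Nat.iter j G 0 <= 2 * INR K * del2 /\
    0 <= Nat.iter j Ff 0 <= 2 * INR K * del1).
  { intros j hj. assert (pj := pos_INR j). assert (hjK : INR j <= INR K) by (now apply le_INR).
    destruct (np2 j hj). destruct (np1 j hj).
    assert (0 <= INR j * del2 <= INR K * del2) by (split; nra).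
    assert (0 <= INR j * del1 <= INR K * del1) by (split; nra).
    repeat split; nra. }
  assert (corr : forall j, (j <= K)%nat -> chart_H (Nat.iter j G 0) = Nat.iter j Ff 0).
  { induction j as [|j IH]; intro hj; [exact hh0|].
    specialize (IH ltac:(lia)). destruct (rng j ltac:(lia)) as [r2 r1].
    simpl. rewrite <- IH. set (y := Nat.iter j G 0) in *.
    assert (hyK : 2 * INR K * del2 <= 2 * INR K * eta) by nra.
    destruct (c2 y ltac:(rewrite Rabs_pos_eq; lra)) as (_ & a & _).
    destruct (hhP y ltac:(rewrite Rabs_pos_eq; unfold T0 in *; lra)) as [_ a'].
    unfold chart_H at 1, G, Ff. rewrite a, a'. unfold side. now rewrite HiH. }
  (* The same power of [F] rescales both lines. Only the first scale is prescribed; the second one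
     is bounded through the domain of the chart. *)
  destruct (scale_up q2 (INR K * del2) T0 hq2) as [m hm].
  { split; [nra|]. nra. }
  assert (pm2 := pow_lt q2 m ltac:(lra)). assert (pm1 := pow_lt q1 m ltac:(lra)).
  set (e := del2 / q2 ^ m). set (c := del1 / q1 ^ m).
  assert (eK : INR K * e = INR K * del2 / q2 ^ m) by (unfold e; field; lra).
  assert (he : 0 < e) by (apply Rdiv_lt_0_compat; auto).
  assert (hc : 0 < c) by (apply Rdiv_lt_0_compat; auto).
  assert (terms : forall j, (j <= K)%nat -> exists u,
    INR j * e * (1 - kap) <= u <= INR j * e * (1 + kap) /\
    INR j * c * (1 - kap) <= chart_H u <= INR j * c * (1 + kap)).
  { intros j hj. set (y := Nat.iter j G 0).
    assert (n2 := np2 j hj). assert (n1 := np1 j hj). fold y in n2.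
    assert (div2 : INR j * e * (1 - kap) <= y / q2 ^ m <= INR j * e * (1 + kap)).
    { unfold e. replace (INR j * (del2 / q2 ^ m) * (1 - kap)) with (INR j * del2 * (1 - kap) / q2 ^ m) by (field; lra).
      replace (INR j * (del2 / q2 ^ m) * (1 + kap)) with (INR j * del2 * (1 + kap) / q2 ^ m) by (field; lra).
      split; apply Rmult_le_compat_r; try lra; apply Rlt_le, Rinv_0_lt_compat; lra. }
    exists (y / q2 ^ m). split; auto.
    assert (hje : 0 <= INR j * e <= T0).
    { assert (pj := pos_INR j). assert (INR j <= INR K) by (now apply le_INR). split; nra. }
    assert (hu : Rabs (y / q2 ^ m) <= eps).
    { rewrite Rabs_pos_eq; [unfold T0 in *; nra|nra]. }
    assert (eh : chart_H (y / q2 ^ m) = Nat.iter j Ff 0 / q1 ^ m).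
    { assert (z := hhscale m (y / q2 ^ m) hu).
      replace (q2 ^ m * (y / q2 ^ m)) with y in z by (field; lra).
      unfold y in z at 1. rewrite corr in z by auto. rewrite z. field. lra. }
    rewrite eh. unfold c.
    replace (INR j * (del1 / q1 ^ m) * (1 - kap)) with (INR j * del1 * (1 - kap) / q1 ^ m) by (field; lra).
    replace (INR j * (del1 / q1 ^ m) * (1 + kap)) with (INR j * del1 * (1 + kap) / q1 ^ m) by (field; lra).
    split; apply Rmult_le_compat_r; try lra; apply Rlt_le, Rinv_0_lt_compat; lra. }
  exists e, c. split; auto. split; auto. split; [lra|]. split; auto.
  destruct (terms K (le_n K)) as (u & u1 & u2).
  assert (hu : Rabs u <= eps).
  { rewrite Rabs_pos_eq; unfold T0 in *; nra. }
  destruct (hhP u hu) as [a _]. apply Rabs_le_between in a.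
  assert (0 < INR K * c) by nra. nra. }
set (T := q2 * T0). assert (hT : 0 < T) by (unfold T; nra).
assert (hTT : T < T0) by (unfold T; nra).
assert (approx : forall y z, 0 <= y <= T -> 0 <= z <= T -> forall om, 0 < om ->
  Rabs (chart_H y * z - chart_H z * y) <= om).
{ intros y z hy hz om hom.
  (* Three errors of at most [om / 4]: two from replacing [chart_H] by the progression, [2 * w * T]
     each, and one from the grid. *)
  set (w := om / (8 * T)). assert (hw : 0 < w) by (apply Rdiv_lt_0_compat; lra).
  destruct (hhunif w hw) as [d [hd hu]].
  set (kap := Rmin (Rmin (1 / 2) (d / (2 * T0))) (w / (2 * e1))).
  assert (hkap : 0 < kap).
  { unfold kap; repeat apply Rmin_pos; try lra; apply Rdiv_lt_0_compat; lra. }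
  assert (k1 : kap <= 1 / 2) by (eapply Rle_trans; [apply Rmin_l|apply Rmin_l]).
  assert (k2 : kap * (2 * T0) <= d).
  { apply Rle_div_r; [lra|]. eapply Rle_trans; [apply Rmin_l|apply Rmin_r]. }
  assert (k3 : kap * (2 * e1) <= w).
  { apply Rle_div_r; [lra|]. apply Rmin_r. }
  (* From [K * e <= T0] and [K * c <= 2 * e1], this [K] gives [e <= d / 2] and [c * T <= om / 4]. *)
  destruct (nfloor_ex (2 * T0 / d + 8 * e1 * T / om)) as [n0 [_ hn0]].
  { apply Rplus_le_le_0_compat; apply Rdiv_le_0_compat; try lra. nra. }
  set (K := S n0). assert (hK : 2 * T0 / d + 8 * e1 * T / om < INR K) by (unfold K; rewrite S_INR; auto).
  assert (q1' : 0 <= 2 * T0 / d) by (apply Rdiv_le_0_compat; lra).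
  assert (q2' : 0 <= 8 * e1 * T / om) by (apply Rdiv_le_0_compat; nra).
  assert (hK1 : 2 * T0 <= INR K * d) by (apply Rle_div_l; lra).
  assert (hK2 : 8 * e1 * T <= INR K * om) by (apply Rle_div_l; lra).
  assert (hKp : 0 < INR K) by lra.
  destruct (prog K kap ltac:(unfold K; lia) ltac:(lra)) as (e & c & he & hc & hKe & hKc & hterm).
  assert (est : forall y, 0 <= y <= T -> exists j, (j <= K)%nat /\
    0 <= y - INR j * e <= e /\ Rabs (chart_H y - INR j * c) <= 2 * w).
  { clear y z hy hz. intros y hy.
    destruct (grid_find 0 e y he K) as [j [hj hj']].
    { unfold T in hy. lra. } { unfold K; lia. }
    exists j. split; [lia|]. rewrite S_INR in hj'.
    split; [lra|].
    destruct (hterm j ltac:(lia)) as (u & u1 & u2).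
    assert (pj := pos_INR j). assert (hjK : INR j <= INR K) by (apply le_INR; lia).
    assert (je : 0 <= INR j * e <= T0) by (split; nra).
    assert (jc : 0 <= INR j * c <= 2 * e1) by (split; nra).
    assert (jke : INR j * e * kap <= d / 2) by nra.
    assert (jkc : INR j * c * kap <= w) by nra.
    assert (he' : e <= d / 2).
    { apply (Rmult_le_reg_l (INR K)); auto. lra. }
    assert (hyu : Rabs (chart_H y - chart_H u) <= w).
    { apply hu.
      - rewrite Rabs_pos_eq; unfold T0 in *; lra.
      - rewrite Rabs_pos_eq; unfold T0 in *; nra.
      - apply Rabs_le; lra. }
    apply Rabs_le_between in hyu. apply Rabs_le; lra. }
  destruct (est y hy) as (j & hj & j1 & j2). destruct (est z hz) as (l & hl & l1 & l2).
  assert (main : Rabs (INR j * c * z - INR l * c * y) <= om / 4).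
  { replace (INR j * c * z - INR l * c * y) with
      (c / e * ((z - INR l * e) * y - (y - INR j * e) * z)) by (field; lra).
    rewrite Rabs_mult, Rabs_pos_eq by (apply Rlt_le, Rdiv_lt_0_compat; auto).
    assert (Rabs ((z - INR l * e) * y - (y - INR j * e) * z) <= e * T).
    { apply Rabs_le; split; nra. }
    apply Rle_trans with (c / e * (e * T)).
    - apply Rmult_le_compat_l; auto. apply Rlt_le, Rdiv_lt_0_compat; auto.
    - replace (c / e * (e * T)) with (c * T) by (field; lra).
      apply (Rmult_le_reg_l (INR K)); auto. nra. }
  assert (hwT : w * T = om / 8) by (unfold w; field; lra).
  apply Rabs_le_between in j2. apply Rabs_le_between in l2. apply Rabs_le_between in main.
  assert (Rabs ((chart_H y - INR j * c) * z) <= om / 4).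
  { apply Rabs_le; split; nra. }
  assert (Rabs ((chart_H z - INR l * c) * y) <= om / 4).
  { apply Rabs_le; split; nra. }
  apply Rabs_le_between in H0. apply Rabs_le_between in H1.
  apply Rabs_le; split; nra. }
set (s := chart_H T / T).
assert (hhT : 0 < chart_H T).
{ rewrite <- hh0. apply hhincr; auto; try rewrite Rabs_R0; try rewrite Rabs_pos_eq;
    unfold T0 in *; lra. }
assert (lin : forall y, 0 <= y <= T -> chart_H y = s * y).
{ intros y hy. unfold s.
  assert (ez : chart_H y * T - chart_H T * y = 0).
  { destruct (Req_dec (chart_H y * T - chart_H T * y) 0) as [c|c]; auto. exfalso.
    assert (pc := Rabs_pos_lt _ c).
    assert (z := approx y T hy ltac:(lra) (Rabs (chart_H y * T - chart_H T * y) / 2) ltac:(lra)). lra. }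
  field_simplify_eq; lra. }
exists T, s. split; auto. split; [unfold s; apply Rdiv_lt_0_compat; auto|]. split.
- exists eps, d2, d1. repeat split; auto; try lra; try apply loc2; try apply loc1; auto.
  unfold T0 in *; lra.
- intros y hy. assert (ha : Rabs y <= eps) by (rewrite Rabs_pos_eq; unfold T0 in *; lra).
  destruct (hhP y ha) as [a b]. rewrite lin in a, b by auto. auto.
Qed.

(** Linearity holds on one side of the fixed point, so the point is taken in the interior of that
    range, at [P2 (T / 2)]: nearby [H] is [P1 (s * L2 x)] and its inverse is [P2 (L1 x / s)]. *)
Theorem conjugacy_analytic_somewhere :
  exists x, analytic_at H x /\ analytic_at Hi (H x).
Proof.
destruct conjugate_linear as (T & s & hT & hs &
  (eps & d2 & d1 & hTe & hee & hd2 & hd1 & loc2 & loc1 & dom) & lin).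
set (y0 := T / 2).
assert (hy0 : Rabs y0 <= eps) by (unfold y0; rewrite Rabs_pos_eq; lra).
destruct (dom y0 hy0) as [m2 m1].
destruct (lin y0 ltac:(unfold y0; lra)) as [l1 l2].
destruct (lz_L _ _ _ _ _ _ lz2 y0 ltac:(lra)) as (a1 & a2 & _).
destruct (lz_L _ _ _ _ _ _ lz1 (s * y0) l2) as (b1 & b2 & _).
assert (window : forall L x0 y1, continuous L x0 -> L x0 = y1 -> 0 < y1 ->
  exists d, 0 < d /\ forall x, Rabs (x - x0) < d -> 0 < L x < 2 * y1).
{ intros L x0 y1 hc e hp.
  assert (c' := proj1 (filterlim_locally _ _) hc (mkposreal y1 hp)).
  apply locally_Rabs_inv in c'. destruct c' as [d [hd hh']]. exists d. split; auto.
  intros x hx. specialize (hh' x hx). change (Rabs (L x - L x0) < y1) in hh'.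
  rewrite e in hh'. apply Rabs_def2 in hh'. lra. }
exists (P2 y0). split.
- destruct (window L2 (P2 y0) y0 (analytic_continuous _ _ a2) a1 ltac:(unfold y0; lra))
    as [d [hd hwin]].
  apply (analytic_at_ext (fun x => P1 (s * L2 x + 0))).
  + apply (locally_Rabs _ (Rmin d (d2 / 2))); [apply Rmin_pos; lra|].
    intros x hx. assert (n1 := Rmin_l d (d2 / 2)). assert (n2 := Rmin_r d (d2 / 2)).
    specialize (hwin x ltac:(lra)).
    destruct (loc2 x) as [_ e].
    { replace (x - p) with ((x - P2 y0) + (P2 y0 - p)) by ring.
      apply Rle_trans with (1 := Rabs_triang _ _). lra. }
    destruct (lin (L2 x)) as [e' _]; [unfold y0 in hwin; lra|].
    rewrite Rplus_0_r, <- e', e. reflexivity.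
  + apply (analytic_at_comp (fun t => P1 (s * t + 0)) L2); auto. rewrite a1.
    apply (analytic_at_comp P1 (fun t => s * t + 0)).
    * rewrite Rplus_0_r. now apply (lz_P _ _ _ _ _ _ lz1).
    * apply analytic_at_affine.
- rewrite l1. assert (hsy : 0 < s * y0) by (unfold y0; nra).
  destruct (window L1 (P1 (s * y0)) (s * y0) (analytic_continuous _ _ b2) b1 hsy) as [d [hd hwin]].
  apply (analytic_at_ext (fun x => P2 (/ s * L1 x + 0))).
  + apply (locally_Rabs _ (Rmin d (d1 / 2))); [apply Rmin_pos; lra|].
    intros x hx. assert (n1 := Rmin_l d (d1 / 2)). assert (n2 := Rmin_r d (d1 / 2)).
    specialize (hwin x ltac:(lra)). rewrite <- l1 in hx.
    destruct (loc1 x) as [_ e].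
    { replace (x - H p) with ((x - H (P2 y0)) + (H (P2 y0) - H p)) by ring.
      apply Rle_trans with (1 := Rabs_triang _ _). lra. }
    set (y := / s * L1 x).
    assert (hsy' : s * y = L1 x) by (unfold y; field; lra).
    assert (hy : 0 <= y <= T).
    { unfold y. assert (0 < / s) by now apply Rinv_0_lt_compat.
      split; [nra|]. apply (Rmult_le_reg_l s); auto. fold y. rewrite hsy'. unfold y0 in hwin. lra. }
    destruct (lin y hy) as [e' _]. rewrite Rplus_0_r.
    rewrite hsy', e in e'. rewrite <- e'. symmetry. apply HiH.
  + apply (analytic_at_comp (fun t => P2 (/ s * t + 0)) L1); auto. rewrite b1.
    apply (analytic_at_comp P2 (fun t => / s * t + 0)).
    * replace (/ s * (s * y0) + 0) with y0 by (field; lra). apply (lz_P _ _ _ _ _ _ lz2). lra.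
    * apply analytic_at_affine.
Qed.
End Linear.

(** * Lifts of subgroups of circle homeomorphisms *)

Lemma circle_eq (p q : circle) : proj1_sig p = proj1_sig q -> p = q.
Proof.
destruct p as [p hp], q as [q hq]; simpl; intro e. subst q.
f_equal; apply proof_irrelevance.
Qed.

Lemma cis_1 (x : R) : cis (x + 1) = cis x.
Proof.
apply circle_eq; simpl.
replace (2 * PI * (x + 1)) with (2 * PI * x + 2 * INR 1 * PI) by (simpl; ring).
now rewrite cos_period, sin_period.
Qed.

Lemma cis_Z (k : Z) (x : R) : cis (x + IZR k) = cis x.
Proof.
assert (hn : forall n x, cis (x + INR n) = cis x).
{ induction n as [|n IH]; intro y; [now rewrite Rplus_0_r|].
  rewrite S_INR. replace (y + (INR n + 1)) with (y + INR n + 1) by ring.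
  now rewrite cis_1. }
destruct (Z_le_gt_dec 0 k) as [c|c].
- rewrite <- (Z2Nat.id k c), <- INR_IZR_INZ. apply hn.
- rewrite <- (hn (Z.to_nat (- k)) (x + IZR k)).
  rewrite INR_IZR_INZ, Z2Nat.id, opp_IZR by lia. f_equal; ring.
Qed.

Lemma cis_inj (x y : R) : cis x = cis y -> exists k, x = y + IZR k.
Proof.
intro e. apply (f_equal (@proj1_sig _ _)) in e. simpl in e.
injection e as ec es.
assert (h : cos (2 * (PI * (x - y))) = 1).
{ replace (2 * (PI * (x - y))) with (2 * PI * x - 2 * PI * y) by ring.
  rewrite cos_minus, ec, es. generalize (sin2_cos2 (2 * PI * y)). unfold Rsqr. lra. }
rewrite cos_2a_sin in h.
assert (h0 : sin (PI * (x - y)) = 0) by nra.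
apply sin_eq_0_0 in h0. destruct h0 as [k hk]. exists k.
assert (hp := PI_RGT_0). nra.
Qed.

Lemma cis_surj (p : circle) : exists x, cis x = p.
Proof.
destruct p as [[a b] h].
assert (hab : a * a + b * b = 1).
{ unfold Cmod in h; simpl in h. apply (f_equal (fun t => t * t)) in h.
  rewrite sqrt_def in h by nra. lra. }
assert (ha : -1 <= a <= 1) by nra.
assert (hp := PI_RGT_0).
set (x := acos a / (2 * PI)).
assert (ex : 2 * PI * x = acos a) by (unfold x; field; lra).
assert (es : sin (acos a) = Rabs b).
{ rewrite sin_acos by auto. rewrite <- sqrt_Rsqr_abs. f_equal. unfold Rsqr. lra. }
destruct (Rle_lt_dec 0 b) as [c|c].
- exists x. apply circle_eq; simpl. rewrite ex, cos_acos, es by auto.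
  now rewrite Rabs_right by lra.
- exists (- x). apply circle_eq; simpl.
  replace (2 * PI * - x) with (- acos a) by lra.
  rewrite cos_neg, sin_neg, cos_acos, es by auto.
  rewrite Rabs_left by lra. now rewrite Ropp_involutive.
Qed.

(** The distance on the circle is that of the plane. As cos (2 pi (x - y)) is 1 minus half of the
    squared chord, and cos decreases on [0, pi], a short chord bounds the angle modulo integers. *)
Lemma chord_angle (eps : R) : 0 < eps -> exists d, 0 < d /\ forall x y,
  ball (cis y) d (cis x) -> exists k, Rabs (x + IZR k - y) < eps.
Proof.
intro he. set (e := Rmin eps (/ 4)).
assert (h1 : 0 < e) by (apply Rmin_pos; lra).
assert (h2 := Rmin_l eps (/ 4)). assert (h3 := Rmin_r eps (/ 4)). fold e in h2, h3.
assert (hp := PI_RGT_0).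
assert (hc : cos (2 * PI * e) < 1).
{ rewrite <- cos_0. apply cos_decreasing_1; nra. }
exists (Rmin 1 (1 - cos (2 * PI * e))). split; [apply Rmin_pos; lra|].
intros x y hb. set (d := Rmin 1 (1 - cos (2 * PI * e))) in *.
assert (d1 : d <= 1) by apply Rmin_l.
assert (d2 : d <= 1 - cos (2 * PI * e)) by apply Rmin_r.
assert (d0 : 0 < d) by (apply Rmin_pos; lra).
destruct hb as [hb1 hb2]. simpl in hb1, hb2.
change (Rabs (cos (2 * PI * x) - cos (2 * PI * y)) < d) in hb1.
change (Rabs (sin (2 * PI * x) - sin (2 * PI * y)) < d) in hb2.
set (k := Int_part (x - y + / 2)).
assert (hk := Int_part_bounds (x - y + / 2)). fold k in hk.
exists (- k)%Z. rewrite opp_IZR. set (t := x + - IZR k - y).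
assert (ht : Rabs t <= / 2) by (apply Rabs_le; unfold t; lra).
assert (ec : cos (2 * PI * Rabs t) = cos (2 * PI * (x - y))).
{ transitivity (cos (2 * PI * t)).
  { unfold Rabs. destruct Rcase_abs; auto. rewrite <- cos_neg. f_equal; ring. }
  assert (ez := cis_Z (- k) (x - y)). apply (f_equal (@proj1_sig _ _)) in ez. simpl in ez.
  injection ez as ez _. rewrite <- ez, opp_IZR. f_equal; unfold t; ring. }
assert (hlt : cos (2 * PI * e) < cos (2 * PI * Rabs t)).
{ rewrite ec. replace (2 * PI * (x - y)) with (2 * PI * x - 2 * PI * y) by ring.
  rewrite cos_minus.
  assert (i1 := sin2_cos2 (2 * PI * x)). assert (i2 := sin2_cos2 (2 * PI * y)).
  unfold Rsqr in i1, i2. apply Rabs_def2 in hb1. apply Rabs_def2 in hb2.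
  assert ((cos (2 * PI * x) - cos (2 * PI * y)) * (cos (2 * PI * x) - cos (2 * PI * y)) < d * d) by nra.
  assert ((sin (2 * PI * x) - sin (2 * PI * y)) * (sin (2 * PI * x) - sin (2 * PI * y)) < d * d) by nra.
  nra. }
assert (Rabs t < e); [|lra].
destruct (Rlt_le_dec (Rabs t) e) as [c|c]; auto. exfalso.
assert (pt := Rabs_pos t).
assert (cos (2 * PI * Rabs t) <= cos (2 * PI * e)); [|lra].
apply cos_decr_1; nra.
Qed.

Lemma ivt (F : R -> R) (a b y : R) : (forall x, continuous F x) -> a <= b ->
  F a <= y <= F b -> exists x, a <= x <= b /\ F x = y.
Proof.
intros hF hab hy. destruct (IVT_gen F a b y) as [x [hx e]].
- intro x. apply continuity_pt_filterlim. apply hF.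
- rewrite Rmin_left, Rmax_right by lra. lra.
- rewrite Rmin_left, Rmax_right in hx by lra. exists x; auto.
Qed.

Lemma continuous_Z_constant (D : R -> R) : (forall x, continuous D x) ->
  (forall x, exists k, D x = IZR k) -> forall x y, D x = D y.
Proof.
intros hD hk.
assert (h : forall x y, x <= y -> D x = D y).
{ intros x y hxy. destruct (hk x) as [k ek], (hk y) as [l el].
  destruct (Z.lt_trichotomy k l) as [c|[c|c]].
  - destruct (ivt D x y (IZR k + / 2) hD hxy) as [z [_ hz]].
    { rewrite ek, el. assert (IZR (k + 1) <= IZR l) by (apply IZR_le; lia).
      rewrite plus_IZR in H. lra. }
    destruct (hk z) as [m hm]. rewrite hm in hz.
    assert (m < k + 1)%Z by (apply lt_IZR; rewrite plus_IZR; lra).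
    assert (k < m)%Z by (apply lt_IZR; lra). lia.
  - now rewrite ek, el, c.
  - destruct (ivt (fun t => - D t) x y (- (IZR l + / 2))) as [z [_ hz]]; auto.
    { intro t. apply (continuous_opp D), hD. }
    { rewrite ek, el. assert (IZR (l + 1) <= IZR k) by (apply IZR_le; lia).
      rewrite plus_IZR in H. lra. }
    destruct (hk z) as [m hm]. rewrite hm in hz.
    assert (m < l + 1)%Z by (apply lt_IZR; rewrite plus_IZR; lra).
    assert (l < m)%Z by (apply lt_IZR; lra). lia. }
intros x y. destruct (Rle_lt_dec x y); [auto|symmetry; apply h; lra].
Qed.

Lemma lift_unique (f : circle -> circle) (F F' : R -> R) :
  is_lift f F -> is_lift f F' -> eqZ F F'.
Proof.
intros [c e] [c' e'].
assert (h : forall x, exists k, F x - F' x = IZR k).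
{ intro x. destruct (cis_inj (F x) (F' x)) as [k hk]; [now rewrite <- e, <- e'|].
  exists k. lra. }
destruct (h 0) as [k hk]. exists k. intro x.
assert (F x - F' x = F 0 - F' 0); [|lra].
apply (continuous_Z_constant (fun x => F x - F' x)); auto.
intro t. apply (continuous_minus F F'); auto.
Qed.

Lemma lift_shift (f : circle -> circle) (F : R -> R) (k : Z) :
  is_lift f F -> is_lift f (fun x => F x + IZR k).
Proof.
intros [c e]. split; intro x.
- apply (continuous_plus F (fun _ => IZR k)); [apply c|apply continuous_const].
- rewrite cis_Z. apply e.
Qed.

Lemma deg1_shift (F : R -> R) (k : Z) : deg1 F -> deg1 (fun x => F x + IZR k).
Proof. intros [a b]. split; intros; [apply Rplus_lt_compat_r; auto|rewrite b; ring]. Qed.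

Lemma lift_comp (f g : homeo) (F G : R -> R) :
  is_lift f F -> is_lift g G -> is_lift (hcomp f g) (fun x => F (G x)).
Proof.
intros [c e] [c' e']. split; intro x.
- apply continuous_comp; auto.
- simpl. now rewrite e', e.
Qed.

Lemma lift_id : is_lift hid ids.
Proof. split; intro x; [apply continuous_id|easy]. Qed.

Lemma deg1_inverse (F : R -> R) : deg1 F -> (forall x, continuous F x) ->
  exists Fi, line_homeo F Fi.
Proof.
intros dF cF.
destruct (choice_fun (fun y x => F x = y)) as [Fi hFi].
{ intro y. set (k := Int_part (y - F 0)). assert (hk := Int_part_bounds (y - F 0)).
  fold k in hk.
  destruct (ivt F (IZR k) (IZR (k + 1)) y cF) as [x [_ hx]]; [apply IZR_le; lia| |eauto].
  rewrite <- (Rplus_0_l (IZR k)), <- (Rplus_0_l (IZR (k + 1))), !(deg1_Z F dF), plus_IZR.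
  lra. }
assert (hi : forall x, Fi (F x) = x).
{ intro x. assert (e := hFi (F x)).
  destruct (Rtotal_order (Fi (F x)) x) as [c|[c|c]]; auto; apply dF in c; lra. }
exists Fi. split; [|split; [split|split]]; auto.
- intros x y hxy. apply (deg1_lt_inv F dF). now rewrite !hFi.
- intro x. rewrite <- (hFi x) at 1. destruct dF as [_ d]. now rewrite <- d, hi.
Qed.

Lemma inverse_lift (f : homeo) (F Fi : R -> R) :
  is_lift f F -> line_homeo F Fi -> is_lift (hinv f) Fi.
Proof.
intros [c e] L. split.
- apply (line_homeo_continuous Fi F), line_homeo_sym, L.
- destruct L as (_ & _ & h & _). intro x. simpl.
  rewrite <- (h x) at 1. now rewrite <- e, fwdK.
Qed.

(* A lift of degree at least 2 would identify two points of the circle. *)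
Lemma increasing_lift_deg1 (f : homeo) (F : R -> R) :
  is_lift f F -> (forall x y, x < y -> F x < F y) -> deg1 F.
Proof.
intros [c e] hm. split; auto. intro x.
destruct (cis_inj (F (x + 1)) (F x)) as [k hk].
{ now rewrite <- !e, cis_1. }
assert (h0 := hm x (x + 1) ltac:(lra)).
assert (k1 : (0 < k)%Z) by (apply lt_IZR; lra).
destruct (Z.eq_dec k 1) as [->|ne]; [easy|exfalso].
assert (k2 : 2 <= IZR k) by (apply IZR_le; lia).
destruct (ivt F x (x + 1) (F x + 1) c) as [y [hy ey]]; [lra|lra|].
assert (ef : cis y = cis x).
{ rewrite <- (fwdK f (cis y)), <- (fwdK f (cis x)), !e, ey. now rewrite cis_1. }
apply cis_inj in ef. destruct ef as [m hm'].
assert (x < y) by (destruct (proj1 hy) as [c'|c']; [auto|exfalso; rewrite c' in *; lra]).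
assert (y < x + 1) by (destruct (proj2 hy) as [c'|c']; [auto|exfalso; rewrite c' in *; lra]).
assert (0 < m)%Z by (apply lt_IZR; lra).
assert (m < 1)%Z by (apply lt_IZR; lra). lia.
Qed.

Lemma orientation_lift (f : homeo) : orientation_preserving f ->
  exists F Fi, line_homeo F Fi /\ is_lift f F /\ is_lift (hinv f) Fi.
Proof.
intros [F [l hm]]. assert (d := increasing_lift_deg1 f F l hm).
destruct (deg1_inverse F d (proj1 l)) as [Fi L].
exists F, Fi. repeat split; try apply L; try apply l;
  apply (inverse_lift f F Fi l L).
Qed.

Definition lifts (G : homeo -> Prop) (F : R -> R) : Prop :=
  exists g, G g /\ is_lift g F /\ deg1 F.

Section Lifts.
Variable G : homeo -> Prop.
Hypothesis SG : is_subgroup G.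
Hypothesis DG : forall g, G g -> diff_omega g.

Lemma lifts_exists (g : homeo) : G g -> exists F, is_lift g F /\ deg1 F.
Proof.
intro h. destruct (orientation_lift g (proj1 (DG g h))) as (F & Fi & L & l & _).
exists F; split; auto; apply L.
Qed.

Lemma lifts_group : lift_group (lifts G).
Proof.
destruct SG as (g1 & g2 & g3). split.
- exists hid. split; [|split]; auto; [apply lift_id|apply ids_line_homeo].
- intros F F' (f & hf & lf & df) (f' & hf' & lf' & df'). exists (hcomp f f').
  split; [|split]; auto; [now apply lift_comp|now apply deg1_comp].
- intros F (f & hf & lf & df). destruct (deg1_inverse F df (proj1 lf)) as [Fi L].
  exists Fi. split; [|split; apply L].
  exists (hinv f). split; [|split]; auto; [now apply (inverse_lift f F)|apply L].
- intro k. exists hid. split; [|split]; auto.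
  + exact (lift_shift hid ids k lift_id).
  + exact (deg1_shift ids k (proj1 ids_line_homeo)).
- intros F (f & _ & _ & d); auto.
Qed.

Lemma lifts_analytic (F : R -> R) : lifts G F -> forall x, analytic_at F x.
Proof.
intros (f & hf & lf & _) x. destruct (DG f hf) as (_ & (F' & lf' & an) & _).
destruct (lift_unique f F F' lf lf') as [k e].
apply (analytic_at_ext (fun t => 1 * F' t + IZR k)).
- apply filter_forall. intro y. rewrite e. ring.
- apply (analytic_at_comp (fun t => 1 * t + IZR k) F'); auto. apply analytic_at_affine.
Qed.

Lemma lifts_generating : finitely_generated G -> exists A, generating (lifts G) A.
Proof.
intros [l hl].
destruct (choice_fun (fun g F => G g -> is_lift g F /\ deg1 F)) as [lft hlft].
{ intro g. destruct (classic (G g)) as [c|c].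
  - destruct (lifts_exists g c) as [F h]. exists F; auto.
  - exists ids. tauto. }
destruct SG as (g1 & g2 & g3).
set (A := ids :: map lft (l ++ map hinv l)).
assert (hin : forall g, In g (l ++ map hinv l) -> G g).
{ assert (hi : forall g, In g l -> G g).
  { intros g hg. apply hl. now apply generated_in. }
  intros g hg. apply in_app_or in hg. destruct hg as [hg|hg]; auto.
  apply in_map_iff in hg. destruct hg as [g' [<- hg]]; auto. }
assert (GL : lift_group (lifts G)) by apply lifts_group.
assert (LA : letters (lifts G) A).
{ split.
  - now left.
  - intros s [<-|hs]; [apply (lg_id _ GL)|].
    apply in_map_iff in hs. destruct hs as [g [<- hg]].
    exists g. split; [|apply hlft]; auto.
  - intros s [<-|hs].
    { exists ids. split; [now left|]. apply eqZ_refl. }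
    apply in_map_iff in hs. destruct hs as [g [<- hg]].
    assert (hg' : In (hinv g) (l ++ map hinv l)).
    { apply in_app_or in hg. apply in_or_app. destruct hg as [hg|hg].
      - right. now apply in_map.
      - left. apply in_map_iff in hg. destruct hg as [g' [<- hg]].
        replace (hinv (hinv g')) with g'; auto. now apply homeo_ext. }
    exists (lft (hinv g)). split; [right; now apply in_map|].
    apply (lift_unique (hcomp (hinv g) g)).
    + apply lift_comp; apply hlft; auto.
    + replace (hcomp (hinv g) g) with hid; [apply lift_id|].
      apply homeo_ext; intro p; symmetry; apply fwdK. }
exists A. split; auto.
assert (hw : forall g, generated_by l g -> forall F, is_lift g F -> deg1 F -> exists n, word A n F).
{ intros g hg. unfold generated_by in hg.
  induction hg as [g hg| |f g hf IHf hg IHg|g hg IHg]; intros F lF dF.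
  - assert (hgl : In g (l ++ map hinv l)) by (apply in_or_app; auto).
    exists 1%nat. apply (word_eqZ A 1 F (lft g)).
    + apply (lift_unique g); auto. apply hlft; auto.
    + apply word_one. right. now apply in_map.
  - exists 1%nat. apply (word_eqZ A 1 F ids).
    + apply (lift_unique hid); auto. apply lift_id.
    + apply word_one. now left.
  - destruct (lifts_exists f) as [Ff [lf df]]; [now apply hl|].
    destruct (lifts_exists g) as [Fg [lg dg]]; [now apply hl|].
    destruct (IHf Ff lf df) as [n hn]. destruct (IHg Fg lg dg) as [m hm].
    exists (m + n)%nat. apply (word_eqZ A (m + n) F (fun x => Ff (Fg x))).
    + apply (lift_unique (hcomp f g)); auto. now apply lift_comp.
    + now apply word_comp.
  - destruct (deg1_inverse F dF (proj1 lF)) as [Fi L].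
    assert (li : is_lift g Fi) by (apply (inverse_lift (hinv g) F Fi lF L)).
    assert (hgg : G g) by now apply hl.
    destruct (IHg Fi li) as [n hn]; [apply L|].
    exists n. apply (word_inv (lifts G) A GL LA n Fi F); auto.
    + exists g; split; [|split]; auto; apply L.
    + exists (hinv g); split; [|split]; auto.
    + apply L. }
intros F (g & hg & lF & dF). apply (hw g); auto. now apply hl.
Qed.

Lemma lifts_minimal : (forall p, dense (orbit G p)) -> forall x y eps, 0 < eps ->
  exists F, lifts G F /\ Rabs (F x - y) < eps.
Proof.
intros hd x y eps he. destruct (chord_angle eps he) as (d & hd0 & hc).
destruct (hd (cis x) (cis y) (mkposreal d hd0)) as [p [[g [hg ->]] hb]].
destruct (lifts_exists g hg) as [F [lF dF]].
rewrite (proj2 lF) in hb. destruct (hc _ _ hb) as [k hk].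
exists (fun t => F t + IZR k). split; auto.
exists g. split; [|split]; auto; [now apply lift_shift|now apply deg1_shift].
Qed.

Lemma lifts_expandable : (forall p, expandable G p) ->
  forall y, exists F, lifts G F /\ 1 < Derive F y.
Proof.
intros he y. destruct (he (cis y)) as (g & d & hg & (F0 & x & l0 & ex & dd) & hd).
destruct (lifts_exists g hg) as [F [lF dF]]. exists F. split; [now exists g|].
destruct (lift_unique g F F0 lF l0) as [m em].
destruct (cis_inj x y ex) as [k ek].
rewrite (is_derive_unique F y d); auto.
apply (is_derive_ext (fun t => F0 (t + IZR k) + (IZR m - IZR k))).
- intro t. change R in t. assert (h := deg1_Z F dF k t). rewrite em in h. lra.
- rewrite ek in dd. replace d with (1 * d + 0) by ring.
  apply (is_derive_plus (fun t => F0 (t + IZR k)) (fun _ => IZR m - IZR k)).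
  + apply (is_derive_comp F0 (fun t => t + IZR k)); auto.
    auto_derive; auto.
  + apply (is_derive_const (IZR m - IZR k) y).
Qed.

Lemma lifts_C1_nondiscrete : locally_nondiscrete 2 G -> C1_nondiscrete (lifts G) ids ids.
Proof.
intros (al & be & g & F & hab & hg & hc).
(* [near] refers to a closed interval, the hypothesis to an open arc; any compact part of the arc
   would do. *)
exists (al + (be - al) / 3), (al + 2 * (be - al) / 3). split; [lra|].
intros eta heta. destruct (hc (mkposreal eta heta)) as [N hN].
specialize (hN N (le_n N)). destruct (hg N) as (h1 & h2 & h3).
destruct (Lub_Rbar_correct (fun r => exists j x, (j <= 2)%nat /\ al < x < be /\
  r = Rabs (Derive_n (fun x => F N x - x) j x))) as [ub _].
assert (hlt : forall j x, (j <= 2)%nat -> al < x < be ->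
  Rabs (Derive_n (fun x => F N x - x) j x) < eta).
{ intros j x hj hx. assert (chart_H := Rbar_le_lt_trans _ _ _ (ub _ (ex_intro _ j (ex_intro _ x
    (conj hj (conj hx eq_refl))))) hN). exact chart_H. }
assert (LF : lifts G (F N)).
{ exists (g N). split; [|split]; auto. destruct (lifts_exists (g N) h1) as [F0 [l0 d0]].
  destruct (lift_unique _ _ _ h3 l0) as [k e]. replace (F N) with (fun x => F0 x + IZR k).
  - now apply deg1_shift.
  - apply functional_extensionality; intro; now rewrite e. }
exists (F N). split; [|split]; auto.
- intros [k e]. apply h2. apply homeo_ext. intro p. destruct (cis_surj p) as [x <-].
  rewrite (proj2 h3), e. unfold ids. apply cis_Z.
- intros y hy. assert (hy' : al < y < be) by lra.
  assert (i0 := hlt 0%nat y ltac:(lia) hy'). assert (i1 := hlt 1%nat y ltac:(lia) hy').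
  simpl in i0, i1.
  assert (ed : Derive (fun x => F N x - x) y = Derive (F N) y - 1).
  { rewrite (Derive_minus (F N) (fun x => x)), Derive_id; auto.
    - apply analytic_ex_derive. now apply lifts_analytic.
    - apply ex_derive_id. }
  change (fun x0 => F N x0 - x0) with (fun x => F N x - x) in i1. 
  assert (e2 : dv ids ids (F N) y = Derive (F N) y) by reflexivity.
  rewrite e2. rewrite <- ed. repeat split; try (apply Rlt_le; exact i1). now apply Rlt_le.
Qed.

End Lifts.

(** * Analyticity of the conjugacy *)

(** Compactness of a period gives a finite cover, which serves on the whole line since lifts commute
    with integer translations. *)
Lemma expanding_of_expandable (Gm : (R -> R) -> Prop) : lift_group Gm ->
  (forall g, Gm g -> forall x, analytic_at g x) ->
  (forall y, exists F, Gm F /\ 1 < Derive F y) ->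
  exists X mu rho, (forall e, In e X -> Gm e) /\ expanding X ids ids mu rho.
Proof.
intros GG AN h.
(* [snd a] is both the gain and half the radius of expansion: points within [snd a] of the centre
   keep a window of that size on which the element expands. *)
destruct (choice_fun (fun y (a : (R -> R) * posreal) => Gm (fst a) /\
  forall z, Rabs (z - y) < 2 * snd a -> 1 + snd a <= Derive (fst a) z)) as [c hc].
{ intro y. destruct (h y) as [F [hF hd]].
  assert (cd : continuous (Derive F) y).
  { apply (ex_derive_continuous (Derive F)).
    exact (analytic_ex_derive_n F y (AN F hF y) 2). }
  set (nu := (Derive F y - 1) / 2). assert (hnu : 0 < nu) by (unfold nu; lra).
  destruct (proj1 (filterlim_locally _ _) cd (mkposreal nu hnu)) as [d hdl].
  assert (hp : 0 < Rmin nu (d / 2)).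
  { apply Rmin_pos; auto. generalize (cond_pos d); lra. }
  exists (F, mkposreal _ hp). split; auto. simpl. intros z hz.
  assert (m1 := Rmin_l nu (d / 2)). assert (m2 := Rmin_r nu (d / 2)).
  assert (hb : ball (Derive F y) nu (Derive F z)).
  { apply hdl. change (Rabs (z - y) < d). lra. }
  change (Rabs (Derive F z - Derive F y) < nu) in hb. apply Rabs_def2 in hb.
  unfold nu in *. lra. }
(* [compactness_list] yields a double negation, resolved by excluded middle. *)
destruct (classic (exists l : list (Compactness.Tn 1 R), forall x,
  bounded_n 1 (0, tt) (1, tt) x -> exists t, In t l /\
  bounded_n 1 (0, tt) (1, tt) t /\ close_n 1 (snd (c (fst t))) x t)) as [[l hl]|n].
2:{ exfalso. exact (compactness_list 1 (0, tt) (1, tt) (fun t => snd (c (fst t))) n). }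
destruct (list_uniform (fun (t : Compactness.Tn 1 R) N => / snd (c (fst t)) <= N) l)
  as [N [hN hu]].
{ intros; lra. }
{ intros t _. eexists; apply Rle_refl. }
assert (hN0 : 0 < / N) by (apply Rinv_0_lt_compat; lra).
exists (map (fun t => fst (c (fst t))) l), (1 + / N), (/ N). split; [|split; [lra|split; [lra|]]].
- intros e he. apply in_map_iff in he. destruct he as [t [<- _]]. apply hc.
- intro y. set (k := Int_part y). assert (hk := Int_part_bounds y). fold k in hk.
  destruct (hl (y - IZR k, tt)) as ([t []] & h1 & _ & h3); [simpl; split; [lra|auto]|].
  simpl in h3. destruct h3 as [h3 _].
  exists (fst (c t)). split; [apply in_map_iff; exists (t, tt); auto|].
  intros z hz. destruct (hc t) as [g1 g2].
  assert (hi := hu (t, tt) h1). simpl in hi.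
  assert (hi' : / N <= snd (c t)).
  { rewrite <- (Rinv_inv (snd (c t))). apply Rinv_le_contravar; auto.
    apply Rinv_0_lt_compat, cond_pos. }
  assert (e : dv ids ids (fst (c t)) z = Derive (fst (c t)) (z - IZR k)).
  { change (dv ids ids (fst (c t)) z) with (Derive (fst (c t)) z).
    symmetry. apply is_derive_unique.
    apply (is_derive_ext (fun u => fst (c t) (u + IZR k) + - IZR k)).
    - intro u. change R in u. rewrite (deg1_Z _ (lg_deg _ GG _ g1)).
      change (fst (c t) u + IZR k + - IZR k = fst (c t) u). ring.
    - replace (Derive (fst (c t)) z) with (1 * Derive (fst (c t)) z + 0) by ring.
      apply (is_derive_plus (fun u => fst (c t) (u + IZR k)) (fun _ => - IZR k)).
      + apply (is_derive_comp (fst (c t)) (fun u => u + IZR k)).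
        * replace (z - IZR k + IZR k) with z by ring. apply Derive_correct.
          apply analytic_ex_derive. now apply AN.
        * auto_derive; auto.
      + apply (is_derive_const (- IZR k)). }
  rewrite e. apply Rle_trans with (1 + snd (c t)); [lra|].
  apply g2. apply Rabs_def2 in h3. apply Rabs_def1; lra.
Qed.

(** The multiplier at a fixed point does not depend on the analytic coordinate: near 0, [kap o phi]
    is the identity, so the derivatives of [phi] and [kap] cancel. *)
Lemma chart_fixed_point (G : homeo -> Prop) (c : chart) (a l : R) (f : homeo) :
  (forall g, G g -> diff_omega g) -> G f ->
  0 < a -> (forall x, segment a x -> cimg c x) -> f (param c 0) = param c 0 ->
  is_derive (in_chart c f) 0 l ->
  exists F p, lifts G F /\ F p = p /\ is_derive F p l.
Proof.
intros DG hf ha himg hfix hd.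
assert (i0 : cimg c 0) by (apply himg; unfold segment; lra).
destruct (param_analytic c 0 i0) as [phi [an hphi]].
set (p := phi 0). set (kap := fun y => coord c (cis y)).
assert (e0 : param c 0 = cis p) by exact (locally_singleton _ _ hphi).
assert (ank : analytic_at kap p).
{ apply coord_analytic. rewrite <- e0. now apply param_dom. }
destruct (lifts_exists G DG f hf) as [F0 [l0 d0]].
destruct (cis_inj (F0 p) p) as [k hk].
{ rewrite <- (proj2 l0), <- e0. exact hfix. }
set (F := fun x => F0 x + IZR (- k)).
assert (lF : is_lift f F) by now apply lift_shift.
assert (LF : lifts G F) by (exists f; split; [|split]; auto; now apply deg1_shift).
assert (eF : F p = p) by (unfold F; rewrite hk, opp_IZR; ring).
exists F, p. split; [|split]; auto.
assert (dF := Derive_correct F p (analytic_ex_derive F p (lifts_analytic G DG F LF p))).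
assert (dk := Derive_correct kap p (analytic_ex_derive kap p ank)).
assert (dp := Derive_correct phi 0 (analytic_ex_derive phi 0 an)). 
assert (loc : locally 0 (fun x => cimg c x)).
{ apply (locally_Rabs 0 a); auto. intros y hy. apply himg. unfold segment.
  apply Rabs_le_between. rewrite Rminus_0_r in hy. lra. }
assert (d1 : is_derive (fun x => kap (phi x)) 0 (Derive phi 0 * Derive kap p)).
{ exact (is_derive_comp kap phi 0 _ _ dk dp). }
assert (d2 : is_derive (fun x => kap (phi x)) 0 1).
{ apply (is_derive_ext_loc (fun x => x)); [|apply (is_derive_id (0 : R))].
  generalize (filter_and _ _ loc hphi). apply filter_imp. intros x [hx ex].
  unfold kap. rewrite <- ex. symmetry. now apply paramK. }
assert (e1 : Derive phi 0 * Derive kap p = 1).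
{ rewrite <- (is_derive_unique _ _ _ d1). now apply is_derive_unique. }
assert (d3 : is_derive (in_chart c f) 0 (Derive phi 0 * (Derive F p * Derive kap p))).
{ apply (is_derive_ext_loc (fun x => kap (F (phi x)))).
  - revert hphi. apply filter_imp. intros x ex. unfold kap, in_chart.
    now rewrite ex, (proj2 lF).
  - apply (is_derive_comp (fun t => kap (F t)) phi 0 _ _); [|exact dp].
    apply (is_derive_comp kap F p); [rewrite eF; exact dk|exact dF]. }
assert (e2 : l = Derive F p).
{ rewrite <- (is_derive_unique _ _ _ hd), (is_derive_unique _ _ _ d3).
  transitivity ((Derive phi 0 * Derive kap p) * Derive F p); [ring|rewrite e1; ring]. }
now rewrite e2.
Qed.

Lemma analytic_at_open (f : R -> R) (x : R) : analytic_at f x ->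
  exists d, 0 < d /\ forall y, Rabs (y - x) < d -> analytic_at f y.
Proof.
intro h. destruct (analytic_at_ana f x h) as (r & M & hr & an). exists r; split; auto.
intros y hy. apply (analytic_at_ext (fun t => (fun u => f (x + u)) (1 * t + - x))).
- apply filter_forall. intro t. f_equal. ring.
- apply (analytic_at_comp (fun u => f (x + u)) (fun t => 1 * t + - x)).
  + apply (ana_analytic_inside _ r M); auto.
    replace (1 * y + - x) with (y - x) by ring. auto.
  + apply analytic_at_affine.
Qed.

Lemma conjugate_lift (h : homeo) (G1 G2 : homeo -> Prop) (H Hi F : R -> R) :
  conjugates h G1 G2 -> line_homeo H Hi -> is_lift h H -> is_lift (hinv h) Hi ->
  lifts G1 F -> lifts G2 (fun x => Hi (F (H x))).
Proof.
intros hc LH lH lHi (f & hf & lf & df).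
exists (hcomp (hinv h) (hcomp f h)). split; [apply hc; eauto|split].
- exact (lift_comp (hinv h) (hcomp f h) Hi (fun x => F (H x)) lHi (lift_comp f h F H lf lH)).
- apply (deg1_comp Hi (fun x => F (H x))); [apply LH|]. apply (deg1_comp F H); auto; apply LH.
Qed.

Lemma conjugate_lift_back (h : homeo) (G1 G2 : homeo -> Prop) (H Hi F : R -> R) :
  conjugates h G1 G2 -> line_homeo H Hi -> is_lift h H -> is_lift (hinv h) Hi ->
  lifts G2 F -> lifts G1 (fun x => H (F (Hi x))).
Proof.
intros hc LH lH lHi (g & hg & lg & dg). apply hc in hg. destruct hg as [f [hf ->]].
exists f. split; [auto|split].
- replace f with (hcomp h (hcomp (hcomp (hinv h) (hcomp f h)) (hinv h))).
  + exact (lift_comp h _ H (fun x => F (Hi x)) lH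
      (lift_comp _ (hinv h) F Hi lg lHi)).
  + apply homeo_ext. intro p. simpl. now rewrite !bwdK.
- apply (deg1_comp H (fun x => F (Hi x))); [apply LH|]. apply (deg1_comp F Hi); auto; apply LH.
Qed.

Lemma lift_group_log_lipschitz (Gm : (R -> R) -> Prop) (K Ki : R -> R) : lift_group Gm -> line_homeo K Ki ->
  (forall g, Gm g -> forall x, analytic_at (fun t => K (g (Ki t))) x) ->
  forall g, Gm g -> log_lipschitz K Ki g.
Proof.
intros GG LK AN g hg. destruct (lg_inv _ GG g hg) as (gi & hgi & e1 & e2).
apply (analytic_log_lipschitz K Ki g gi); auto. now apply (lg_deg _ GG).
Qed.

(** Uniform continuity carries C^0-smallness through the conjugacy. C^1-smallness may be lost;
    [C0_to_C1_nondiscrete] recovers it. *)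
Lemma conjugate_C0_nondiscrete (Gm1 Gm2 : (R -> R) -> Prop) (H Hi : R -> R) :
  line_homeo H Hi -> (forall F, Gm1 F -> Gm2 (fun x => Hi (F (H x)))) ->
  C1_nondiscrete Gm1 ids ids ->
  exists a b, a < b /\ forall eta, 0 < eta -> exists g, Gm2 g /\ ~ eqZ g ids /\
    forall y, a <= y <= b -> Rabs (g y - y) <= eta.
Proof.
intros LH c12 (a & b & hab & hn).
exists (Hi a), (Hi b). split; [apply LH; auto|]. intros eta heta.
destruct (line_homeo_unif Hi H (line_homeo_sym _ _ LH) eta heta) as (d & hd & hu).
destruct (hn d hd) as (g & hg & hne & hnear).
exists (fun x => Hi (g (H x))). split; [auto|split].
- intros [k e]. apply hne. exists k. intro y. unfold ids in *.
  assert (e' := e (Hi y)). simpl in e'. destruct LH as (dH & _ & hH & hHi).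
  rewrite hH in e'. apply (f_equal H) in e'.
  now rewrite hH, (deg1_Z H dH), hH in e'.
- intros y hy. destruct LH as (dH & _ & hH & hHi).
  rewrite <- (hHi y) at 2. apply hu. apply hnear.
  split; [rewrite <- (hH a)|rewrite <- (hH b)]; apply (deg1_le H dH); apply hy.
Qed.

(** By minimality some [g] brings [x] near [x0], and [H] is [side H Hi gi o H o g] with [gi] the
    inverse of [g], a composition of maps analytic at the relevant points. *)
Lemma conjugacy_analytic_everywhere (Gm1 Gm2 : (R -> R) -> Prop) (H Hi : R -> R) (x0 : R) :
  line_homeo H Hi -> lift_group Gm1 -> lift_group Gm2 ->
  (forall g, Gm1 g -> forall x, analytic_at g x) ->
  (forall g, Gm2 g -> forall x, analytic_at g x) ->
  (forall g, Gm2 g -> Gm1 (side H Hi g)) ->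
  (forall x y eps, 0 < eps -> exists g, Gm2 g /\ Rabs (g x - y) < eps) ->
  analytic_at H x0 -> analytic_at Hi (H x0) ->
  forall x, analytic_at H x /\ analytic_at Hi (H x).
Proof.
intros LH GG1 GG2 AN1 AN2 c21 MIN aH aHi x.
destruct (analytic_at_open H x0 aH) as (d & hd & oH).
destruct (analytic_at_open Hi (H x0) aHi) as (d' & hd' & oHi).
destruct (line_homeo_unif H Hi LH (d' / 2) ltac:(lra)) as (d2 & hd2 & hu).
destruct (MIN x x0 (Rmin d d2) ltac:(apply Rmin_pos; lra)) as (g & hg & hgx).
assert (m1 := Rmin_l d d2). assert (m2 := Rmin_r d d2).
assert (b1 : analytic_at H (g x)) by (apply oH; lra).
assert (b2 : analytic_at Hi (H (g x))).
{ apply oHi. assert (Rabs (H (g x) - H x0) <= d' / 2) by (apply hu; lra). lra. }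
destruct (lg_inv _ GG2 g hg) as (gi & hgi & e1 & e2).
destruct LH as (_ & _ & hH & hHi). split.
- apply (analytic_at_ext (fun t => side H Hi gi (H (g t)))).
  { apply filter_forall. intro y. unfold side. now rewrite hHi, e2. }
  apply (analytic_at_comp (side H Hi gi) (fun t => H (g t))); [apply AN1; auto|].
  apply (analytic_at_comp H g); auto.
- apply (analytic_at_ext (fun t => gi (Hi (side H Hi g t)))).
  { apply filter_forall. intro y. unfold side. now rewrite hHi, e2. }
  apply (analytic_at_comp gi (fun t => Hi (side H Hi g t))); [apply AN2; auto|].
  apply (analytic_at_comp Hi (side H Hi g)); [|apply AN1; auto].
  unfold side. now rewrite hHi.
Qed.

Lemma conjugacy_analytic (Gm1 Gm2 : (R -> R) -> Prop) (A : list (R -> R))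
  (H Hi F : R -> R) (p l : R) :
  line_homeo H Hi -> lift_group Gm1 -> lift_group Gm2 -> generating Gm2 A ->
  (forall g, Gm1 g -> forall x, analytic_at g x) ->
  (forall g, Gm2 g -> forall x, analytic_at g x) ->
  (forall g, Gm1 g -> Gm2 (side Hi H g)) ->
  (forall g, Gm2 g -> Gm1 (side H Hi g)) ->
  (forall x y eps, 0 < eps -> exists g, Gm1 g /\ Rabs (g x - y) < eps) ->
  C1_nondiscrete Gm1 ids ids ->
  Gm1 F -> F p = p -> 0 < l < 1 -> is_derive F p l ->
  (forall y, exists g, Gm2 g /\ 1 < Derive g y) ->
  forall x, analytic_at H x /\ analytic_at Hi (H x).
Proof.
intros LH GG1 GG2 GA AN1 AN2 c12 c21 MIN1 ND HF Fp hl hd EXP.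
assert (LI := line_homeo_sym H Hi LH).
assert (MIN2 : forall x y eps, 0 < eps -> exists g, Gm2 g /\ Rabs (g x - y) < eps).
{ intros x y eps he.
  destruct (line_homeo_unif Hi H LI (eps / 2) ltac:(lra)) as (d & hd' & hu).
  destruct (MIN1 (H x) (H y) d hd') as (g & hg & hgx).
  exists (side Hi H g). split; auto.
  assert (Rabs (Hi (g (H x)) - Hi (H y)) <= eps / 2) by (apply hu; lra).
  destruct LH as (_ & _ & _ & e). rewrite e in H0. unfold side. lra. }
assert (S1 : forall g, Gm1 g -> log_lipschitz ids ids g).
{ apply (lift_group_log_lipschitz Gm1 ids ids GG1 ids_line_homeo). intros g hg. exact (AN1 g hg). }
assert (S2 : forall g, Gm2 g -> log_lipschitz ids ids g).
{ apply (lift_group_log_lipschitz Gm2 ids ids GG2 ids_line_homeo). intros g hg. exact (AN2 g hg). }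
assert (S12 : forall g, Gm1 g -> log_lipschitz Hi H g).
{ apply (lift_group_log_lipschitz Gm1 Hi H GG1 LI). intros g hg. exact (AN2 _ (c12 g hg)). }
assert (S21 : forall g, Gm2 g -> log_lipschitz H Hi g).
{ apply (lift_group_log_lipschitz Gm2 H Hi GG2 LH). intros g hg. exact (AN1 _ (c21 g hg)). }
(* [moving_fixed_point] is used with [H = Hi = ids], for G_1 alone. Expansion of G_1, which acts on
   the target of [H], gives the modulus of [H]; expansion of G_2 gives that of its inverse. *)
assert (HM1 : geometric_modulus H).
{ destruct (moving_fixed_point Gm1 ids ids GG1 ids_line_homeo
    (fun g hg x => conj (AN1 g hg x) (AN1 g hg x)) MIN1 p l l hl hl) as (p' & r & (F' & f1 & f2 & f3 & _) & (hr & mv)); auto.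
  { exists F. auto. }
  destruct (linearization F' p' l (AN1 F' f1 p') f2 f3 hl) as (e & P & L & lz).
  assert (E1 := everywhere_expandable Gm1 F' P L p' l e r GG1 AN1
    (fun g hg => proj1 (proj2 (S1 g hg))) MIN1 f1 hl lz hr).
  destruct (expanding_of_expandable Gm1 GG1 AN1) as (X & mu & rho & hX & EX).
  { apply E1. intros eta heta. destruct (mv eta heta) as (g & g1 & g2 & g3 & _).
    exists g; auto. }
  apply (geometric_modulus_of_expanding H Hi X mu rho LH EX).
  intros e' he'. split; [apply (lg_deg _ GG1); auto|auto]. }
destruct (expanding_of_expandable Gm2 GG2 AN2 EXP) as (X & mu & rho & hX & EX).
assert (HM2 : geometric_modulus Hi).
{ apply (geometric_modulus_of_expanding Hi H X mu rho LI EX).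
  intros e he. split; [apply (lg_deg _ GG2); auto|auto]. }
assert (ND2 : C1_nondiscrete Gm2 H Hi).
{ destruct (conjugate_C0_nondiscrete Gm1 Gm2 H Hi LH c12 ND) as (a & b & hab & hn).
  exact (C0_to_C1_nondiscrete Gm2 A X H Hi mu rho GG2 GA LH
    (fun g hg => conj (S2 g hg) (S21 g hg)) hX EX HM1 a b hab hn). }
(* The conjugate contraction has a positive multiplier [q], which [hyperbolic_transfer] shows to be
   less than 1; it may a priori differ from [l]. *)
set (F2 := side Hi H F). assert (hF2 : Gm2 F2) by exact (c12 F HF).
set (q := Derive F2 (Hi p)).
assert (hq0 : 0 < q) by (apply (proj1 (proj2 (S2 F2 hF2)))).
assert (dF2 : is_derive F2 (Hi p) q).
{ apply Derive_correct. now apply analytic_ex_derive, AN2. }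
assert (hq1 : q < 1).
{ destruct (linearization F p l (AN1 F HF p) Fp hd hl) as (e & P & L & lz).
  exact (hyperbolic_transfer H Hi F P L p l e q LH hl lz (lg_deg _ GG2 _ hF2) HM2 dF2). }
assert (eHH : H (Hi p) = p) by apply LH.
assert (hyp : hyperbolic_at Gm2 H Hi (Hi p) q l).
{ exists F2. split; [auto|split; [|split; auto]].
  - unfold F2, side. now rewrite eHH, Fp.
  - rewrite eHH. replace (side H Hi F2) with F; auto.
    apply functional_extensionality. intro x. unfold F2, side.
    destruct LH as (_ & _ & e & _). now rewrite !e. }
destruct (moving_fixed_point Gm2 H Hi GG2 LH
  (fun g hg x => conj (AN2 g hg x) (AN1 _ (c21 g hg) x)) MIN2 (Hi p) q l
  (conj hq0 hq1) hl hyp ND2) as (p' & r & (F' & f1 & f2 & f3 & f4) & mv).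
destruct (linearization F' p' q (AN2 F' f1 p') f2 f3 (conj hq0 hq1)) as (e2 & P2 & L2 & lz2).
destruct (linearization (side H Hi F') (H p') l (AN1 _ (c21 F' f1) _))
  as (e1 & P1 & L1 & lz1); auto.
{ unfold side. destruct LH as (_ & _ & _ & e). now rewrite e, f2. }
destruct (conjugacy_analytic_somewhere Gm2 H Hi F' P2 L2 P1 L1 p' q l e2 e1 r LH
  (conj hq0 hq1) hl lz2 lz1 mv) as (x0 & a1 & a2).
exact (conjugacy_analytic_everywhere Gm1 Gm2 H Hi x0 LH GG1 GG2 AN1 AN2 c21 MIN2 a1 a2).
Qed.

Theorem theorem5p1 :
  forall (G1 G2 : homeo -> Prop),
    is_subgroup G1 -> (forall g, G1 g -> diff_omega g) -> finitely_generated G1 ->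
    is_subgroup G2 -> (forall g, G2 g -> diff_omega g) -> finitely_generated G2 ->
    (exists h0 : homeo, conjugates h0 G1 G2) ->
    locally_nondiscrete 2 G1 ->
    (forall p, dense (orbit G1 p)) ->
    forall (c : chart) (a : R) (F1 : homeo) (lambda1 : R),
    0 < a ->
    (forall x, segment a x -> cimg c x) ->
    G1 F1 ->
    F1 (param c 0) = param c 0 ->
    0 < lambda1 < 1 ->
    is_derive (in_chart c F1) 0 lambda1 ->
    (forall eps : R, 0 < eps ->
      exists S1 : list homeo,
        (forall g, In g S1 -> G1 g) /\
        (forall g, In g S1 -> C2_close_id c a eps g) /\
        ~ solvable (generated_by S1) /\
        ~ has_finite_orbit (generated_by S1) /\
        exists n : nat, (1 <= n)%nat /\
          forall g : nat -> homeo,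
            (forall k, renormalized_comm F1 n (fun f => In f S1) k (g k)) ->
            C2_cvg_id c a g /\
            forall Theta : R, 0 < Theta ->
              is_lim_seq (fun k => real (C2_dist_id c a (g k)) / Theta ^ k) 0) ->
    (forall p, expandable G2 p) ->
    forall h : homeo,
      orientation_preserving h -> conjugates h G1 G2 -> diff_omega h.
Proof.
intros G1 G2 SG1 D1 _ SG2 D2 FG2 _ ND dens c a F1 l ha himg hF1 fix1 hl hd _ exp2 h oh hc.
destruct (orientation_lift h oh) as (H & Hi & LH & lH & lHi).
destruct (lifts_generating G2 SG2 D2 FG2) as [A GA].
destruct (chart_fixed_point G1 c a l F1 D1 hF1 ha himg fix1 hd) as (F & p & hF & Fp & dF).
assert (an := conjugacy_analytic (lifts G1) (lifts G2) A H Hi F p l LH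
  (lifts_group G1 SG1) (lifts_group G2 SG2) GA (lifts_analytic G1 D1) (lifts_analytic G2 D2)
  (fun g => conjugate_lift h G1 G2 H Hi g hc LH lH lHi)
  (fun g => conjugate_lift_back h G1 G2 H Hi g hc LH lH lHi)
  (lifts_minimal G1 D1 dens) (lifts_C1_nondiscrete G1 D1 ND) hF Fp hl dF
  (lifts_expandable G2 D2 exp2)).
split; [auto|split].
- exists H. split; [auto|]. intro x. apply an.
- exists Hi. split; [auto|]. intro x. destruct LH as (_ & _ & e & _).
  rewrite <- (e x). apply an.
Qed.
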